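(* Let $M\subset\mathbb{C}^N$ be (a germ at $0\in M$ of) a generic real-analytic submanifold of real codimension $d$, and let $H$ be a $\kappa$-nondegenerate holomorphic embedding of $M$ into a generic real-analytic submanifold $M'\subset\mathbb{C}^{N'}$, $N'\ge N$, with $H(0)=0\in M'$. Suppose that the Segre map $S^{\mathbf t}_0$ of $M$ is generically of full rank $N$. Then the space of infinitesimal deformations of $H$ is finite dimensional, and any infinitesimal deformation is determined by its $\mathbf t\kappa$-jet at $0$. In particular, any infinitesimal deformation of $H$ is determined by its $(d+1)\kappa$-jet at $0$, and if $M$ is a strictly pseudoconvex hypersurface, any infinitesimal deformation of $H$ is determined by its $2\kappa$-jet at $0$.
   Context: Let $n=N-d$ be the CR dimension of $M$. Choose normal coordinates $(z,w)\in\mathbb{C}^n\times\mathbb{C}^d$ near $0$: the complexification $\mathcal{M}\subset\mathbb{C}^{2N}_{z,\chi,w,\tau}$ of $M$ is $w=Q(z,\chi,\tau)$ (equivalently $\tau=\overline Q(\chi,z,w)$), where $Q\colon\mathbb{C}^{2n+d}\to\mathbb{C}^d$ is a germ of holomorphic map with $Q(z,0,\tau)\equiv Q(0,\chi,\tau)\equiv\tau$ and $Q(z,\chi,\overline Q(\chi,z,w))\equiv w$; a bar over a power series means that its coefficients are conjugated. The CR vector fields tangent to $\mathcal{M}$ are $L_j=\partial_{\chi_j}+\sum_{k=1}^d\overline Q^k_{\chi_j}(\chi,z,w)\,\partial_{\tau_k}$, $1\le j\le n$, and $L^\iota=L_1^{\iota^1}\cdots L_n^{\iota^n}$ for a multiindex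 $\iota\in\mathbb{N}^n$. Segre maps: $S^q_0\colon\mathbb{C}^{nq}\to\mathbb{C}^N$ (germs at $0$), $S^1_0(x_1)=(x_1,0)$, $S^q_0(x_1,\dots,x_q)=\big(x_1,Q(x_1,\overline{S}{}^{q-1}_0(x_2,\dots,x_q))\big)$, $x_j\in\mathbb{C}^n$. $\kappa$-nondegeneracy: let $R$ be the space spanned by the complex gradients $\rho_{Z'}(Z',\zeta')\in\mathbb{C}\{Z',\zeta'\}^{N'}$ of (the members of a system of) real-analytic real defining functions $\rho$ of $M'$. $H$ is $\kappa$-nondegenerate if $\kappa$ is the smallest integer for which there are multiindices $\iota_1,\dots,\iota_{N'}\in\mathbb{N}^n$ with $0\le|\iota_\ell|\le\kappa$ and $r^1,\dots,r^{N'}\in R$, $r^j=(r^j_1,\dots,r^j_{N'})$, such that $\det\big(L^{\iota_k}r^k_j(H(z,w),\overline H(\chi,\tau))\big)_{k,j=1,\dots,N'}\neq0$ at $0$. An infinitesimal deformation of $H$ is an $\alpha=(\alpha_1,\dots,\alpha_{N'})\in(\mathbb{C}\{z,w\})^{N'}$ with $\alpha(0)=0$ such that the real part of $\sum_j\alpha_j\,\partial/\partial Z_j'$ is tangent to $M'$ along $H(M)$, i.e. $\operatorname{Re}\sum_j\alpha_j\,\rho_{Z_j'}(H,\overline H)=0$ on $M$ for every defining function $\rho$ of $M'$. ''Determined by its $k$-jet'' means that two infinitesimal deformations of $H$ with the same $k$-jet at $0$ coincide. *)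

(* Defs.v *)
(* MathComp; C is R[i] for R : realType. *)
From HB Require Import structures.
From mathcomp Require Export all_boot all_order all_algebra.
From mathcomp Require Export boolp classical_sets reals.
From mathcomp Require Export complex.
From mathcomp Require Export mpoly.

Set Implicit Arguments.
Unset Strict Implicit.
Unset Printing Implicit Defensive.

Import Order.TTheory GRing.Theory Num.Theory.
Local Open Scope ring_scope.

(** * Power series in n variables

    A germ at 0 of a holomorphic function is its Taylor series, so the ring
    C{x_1, ..., x_n} is the set of [f : series R n] such that [convergent f],
    two germs being equal when all their coefficients are. *)

Definition series (R : realType) (n : nat) := 'X_{1..n} -> R[i].
Arguments series R n%_N.

Definition convergent (R : realType) (n : nat) (f : series R n) : Prop :=
  exists r A : R[i], 0 < r /\ forall m, `|f m| * r ^+ mdeg m <= A.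

(* The Taylor polynomial of degree k. *)
Definition trunc (R : realType) (n : nat) (f : series R n) (k : nat) :
    {mpoly R[i][n]} :=
  \sum_(m : 'X_{1..n < k.+1}) f m *: 'X_[m].

Definition pzero (R : realType) (n : nat) : series R n := fun _ => 0.
Arguments pzero R n%_N : clear implicits.

Definition pvar (R : realType) (n : nat) (i : 'I_n) : series R n :=
  fun m => (m == U_(i)%MM)%:R.

(* The coefficient of x^m in a product only depends on the Taylor polynomials
   of degree |m| of the factors. *)
Definition pmul (R : realType) (n : nat) (f g : series R n) : series R n :=
  fun m => (trunc f (mdeg m) * trunc g (mdeg m))@_m.

Definition pderiv (R : realType) (n : nat) (i : 'I_n) (f : series R n) :
    series R n :=
  fun m => f (m + U_(i))%MM *+ (m i).+1.

(* Coefficientwise conjugation: the bar over a power series. *)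
Definition pconj (R : realType) (n : nat) (f : series R n) : series R n :=
  fun m => (f m)^*.

(* f(g_1, ..., g_k). It is only meaningful (and only used) when every g_i has
   no constant term: then the coefficient of x^m only depends on the Taylor
   polynomials of degree |m|. *)
Definition psubst (R : realType) (k n : nat) (f : series R k)
    (g : 'I_k -> series R n) : series R n :=
  fun m => (comp_mpoly [tuple trunc (g i) (mdeg m) | i < k]
                       (trunc f (mdeg m)))@_m.

Definition bcat (T : Type) (a b : nat) (g : 'I_a -> T) (h : 'I_b -> T) :
    'I_(a + b) -> T :=
  fun i => match split i with inl j => g j | inr j => h j end.

(** * Values of power series and germs of sets at 0 *)

Definition sums_to (R : realType) (n : nat) (f : series R n)
    (x : 'rV[R[i]]_n) (s : R[i]) : Prop :=
  forall e : R[i], 0 < e ->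
  exists k0 : nat, forall k : nat, (k0 <= k)%N ->
    `|(trunc f k).@[fun i => x 0 i] - s| < e.

(* The sum of f at x (and 0 if the Taylor polynomials do not converge at x). *)
Definition eval (R : realType) (n : nat) (f : series R n) (x : 'rV[R[i]]_n) :
    R[i] :=
  xget 0 [set s | sums_to f x s].

Definition evalv (R : realType) (p n : nat) (f : 'I_p -> series R n)
    (x : 'rV[R[i]]_n) : 'rV[R[i]]_p :=
  \row_i eval (f i) x.

(* In R[i], [0 < e] says that e is real and positive. *)
Definition near0 (R : realType) (n : nat) (P : 'rV[R[i]]_n -> Prop) : Prop :=
  exists2 e : R[i], 0 < e & forall x : 'rV[R[i]]_n, (forall i, `|x 0 i| < e) -> P x.

Definition conjp (R : realType) (n : nat) (x : 'rV[R[i]]_n) : 'rV[R[i]]_n :=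
  map_mx (fun z : R[i] => z^*) x.

(** * Generic real-analytic submanifolds of C^N through 0

    A real-analytic function germ on C^N is Z |-> rho (Z, conj Z) with rho in
    C{Z, zeta}; the first N variables of a [series R (N + N)] are Z, the last N
    are zeta. A set M of points of C^N is only considered near 0. *)

(* [rho (Z, conj Z) = 0] is a system of d real defining equations near 0 of M,
   whose complex gradients at 0 are independent over C; so M is generic, of
   real codimension d. *)
Definition defining_system (R : realType) (N d : nat)
    (M : 'rV[R[i]]_N -> Prop) (rho : 'I_d -> series R (N + N)) : Prop :=
  [/\ forall k, convergent (rho k),
      forall k, rho k 0%MM = 0,
      near0 (fun Z => forall k,
        eval (rho k) (row_mx Z (conjp Z)) \is Num.real),
      row_free (\matrix_(k < d, j < N) pderiv (lshift N j) (rho k) 0%MM)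
    & near0 (fun Z =>
        M Z <-> forall k, eval (rho k) (row_mx Z (conjp Z)) = 0)].

Definition generic_submanifold (R : realType) (N d : nat)
    (M : 'rV[R[i]]_N -> Prop) : Prop :=
  exists rho : 'I_d -> series R (N + N), defining_system M rho.

Definition defining_function (R : realType) (N : nat) (d : nat)
    (M : 'rV[R[i]]_N -> Prop) (r : series R (N + N)) : Prop :=
  exists (rho : 'I_d -> series R (N + N)) (k : 'I_d),
    defining_system M rho /\ r = rho k.

(* The germ at 0 of the subset E of C^N x C^N is the complexification of M. *)
Definition is_complexification (R : realType) (N d : nat)
    (M : 'rV[R[i]]_N -> Prop) (E : 'rV[R[i]]_(N + N) -> Prop) : Prop :=
  exists2 rho : 'I_d -> series R (N + N), defining_system M rho
    & near0 (fun X => E X <-> forall k, eval (rho k) X = 0).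

(* Positivity of the Levi form at 0 of one of the defining functions of M; it
   then holds at all points of M near 0. *)
Definition strictly_pseudoconvex_hypersurface (R : realType) (N : nat)
    (M : 'rV[R[i]]_N -> Prop) : Prop :=
  exists2 rho : 'I_1 -> series R (N + N), defining_system M rho
    & forall v : 'rV[R[i]]_N, v != 0 ->
      \sum_j pderiv (lshift N j) (rho 0) 0%MM * v 0 j = 0 ->
      0 < \sum_j \sum_k
            pderiv (lshift N j) (pderiv (rshift N k) (rho 0)) 0%MM
            * v 0 j * (v 0 k)^*.

(** * Normal coordinates, Segre maps, CR vector fields

    Z = (z, w) and zeta = (chi, tau) are coordinates of C^(n + d), and the
    variables of Q : series R (n + (n + d)) are (z, (chi, tau)); accordingly
    those of [pconj Q] are (chi, (z, w)). *)

Definition normal_map (R : realType) (n d : nat)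
    (Q : 'I_d -> series R (n + (n + d))) : Prop :=
  let z i := pvar R (lshift (n + d)%N i) in
  let chi i := pvar R (rshift n (lshift d i)) in
  (* the last d variables: tau, or w in the last identity *)
  let tau i := pvar R (rshift n (rshift n i)) in
  let zero := fun _ : 'I_n => pzero R (n + (n + d)) in
  forall k : 'I_d,
  [/\ convergent (Q k),
      psubst (Q k) (bcat z (bcat zero tau)) =1 tau k,
      psubst (Q k) (bcat zero (bcat chi tau)) =1 tau k
    & psubst (Q k)
        (bcat z (bcat chi
          (fun l => psubst (pconj (Q l)) (bcat chi (bcat z tau))))) =1 tau k].

(* The coordinates (z, w) of C^(n + d) are normal for M: Q is a normal map and
   w = Q (z, chi, tau) is the complexification of M. *)
Definition normal_coordinates (R : realType) (n d : nat)
    (M : 'rV[R[i]]_(n + d) -> Prop) (Q : 'I_d -> series R (n + (n + d))) :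
    Prop :=
  normal_map Q /\
  @is_complexification R (n + d)%N d M (fun X =>
    rsubmx (lsubmx X) = evalv Q (row_mx (lsubmx (lsubmx X)) (rsubmx X))).

(* The Segre map S^q_0 in the variables (x_1, ..., x_q); note that
   q.+1 * n is n + q * n by computation. The value at q = 0 is a dummy. *)
Fixpoint segre (R : realType) (n d : nat)
    (Q : 'I_d -> series R (n + (n + d))) (q : nat) :
    'I_(n + d) -> series R (q * n) :=
  match q return 'I_(n + d) -> series R (q * n) with
  | 0%N => fun=> pzero R (0 * n)
  | p.+1 =>
    let x1 i := pvar R (lshift (p * n)%N i) in
    let x' i := pvar R (rshift n i) in
    bcat x1 (fun k : 'I_d =>
      if p == 0%N then pzero R (n + p * n)
      else psubst (Q k) (bcat x1 (fun i => psubst (pconj (@segre R n d Q p i)) x')))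
  end.
Arguments segre {R n d} Q q%_N i : rename.

(* The Jacobian matrix of S has rank p on a dense set of points near 0. *)
Definition generically_full_rank (R : realType) (m p : nat)
    (S : 'I_p -> series R m) : Prop :=
  near0 (fun x : 'rV[R[i]]_m => forall e : R[i], 0 < e ->
    exists2 y : 'rV[R[i]]_m, forall i, `|y 0 i - x 0 i| < e
      & \rank (\matrix_(i < p, j < m) eval (pderiv j (S i)) y) = p).

(* L_j, acting on power series in the variables ((z, w), (chi, tau)). *)
Definition cr_field (R : realType) (n d : nat)
    (Q : 'I_d -> series R (n + (n + d))) (j : 'I_n)
    (f : series R ((n + d) + (n + d))) : series R ((n + d) + (n + d)) :=
  let Z i := pvar R (lshift (n + d)%N i) in
  let chi i := pvar R (rshift (n + d)%N (lshift d i)) in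
  fun m =>
    pderiv (rshift (n + d)%N (lshift d j)) f m
    + \sum_(k < d)
        pmul (psubst (pderiv (lshift (n + d)%N j) (pconj (Q k))) (bcat chi Z))
             (pderiv (rshift (n + d)%N (rshift n k)) f) m.

(* L^iota = L_1^iota_1 ... L_n^iota_n *)
Definition cr_fields (R : realType) (n d : nat)
    (Q : 'I_d -> series R (n + (n + d))) (iota : 'X_{1..n})
    (f : series R ((n + d) + (n + d))) : series R ((n + d) + (n + d)) :=
  foldr (fun j g => iter (iota j) (cr_field Q j) g) f (enum 'I_n).

(** * Embeddings, nondegeneracy and infinitesimal deformations *)

Definition holomorphic_embedding (R : realType) (N N' : nat)
    (M : 'rV[R[i]]_N -> Prop) (M' : 'rV[R[i]]_N' -> Prop)
    (H : 'I_N' -> series R N) : Prop :=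
  [/\ forall j, convergent (H j),
      forall j, H j 0%MM = 0,
      \rank (\matrix_(j < N', i < N) pderiv i (H j) 0%MM) = N
    & near0 (fun Z => M Z -> M' (evalv H Z))].

(* r (H (Z), bar H (zeta)) *)
Definition pullback (R : realType) (N N' : nat) (H : 'I_N' -> series R N)
    (r : series R (N' + N')) : series R (N + N) :=
  psubst r
    (bcat (fun i => psubst (H i) (fun l => pvar R (lshift N l)))
          (fun i => psubst (pconj (H i)) (fun l => pvar R (rshift N l)))).

(* The complex span of the gradients rho_Z' of the defining functions of M'. *)
Definition gradient_span (R : realType) (N' d' : nat)
    (M' : 'rV[R[i]]_N' -> Prop) (r : 'I_N' -> series R (N' + N')) : Prop :=
  exists (s : nat) (c : 'I_s -> R[i]) (rho : 'I_s -> series R (N' + N')),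
    (forall i, defining_function d' M' (rho i)) /\
    forall j m, r j m = \sum_i c i * pderiv (lshift N' j) (rho i) m.

Definition nondegenerate_order (R : realType) (n d N' d' : nat)
    (Q : 'I_d -> series R (n + (n + d))) (M' : 'rV[R[i]]_N' -> Prop)
    (H : 'I_N' -> series R (n + d)) (k : nat) : Prop :=
  exists (iota : 'I_N' -> 'X_{1..n})
         (r : 'I_N' -> 'I_N' -> series R (N' + N')),
    [/\ forall l, (mdeg (iota l) <= k)%N,
        forall l, gradient_span d' M' (r l)
      & \det (\matrix_(l, j)
                cr_fields Q (iota l) (pullback H (r l j)) 0%MM) != 0].

Definition kappa_nondegenerate (R : realType) (n d N' d' : nat)
    (Q : 'I_d -> series R (n + (n + d))) (M' : 'rV[R[i]]_N' -> Prop)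
    (H : 'I_N' -> series R (n + d)) (kappa : nat) : Prop :=
  nondegenerate_order d' Q M' H kappa /\
  forall k, nondegenerate_order d' Q M' H k -> (kappa <= k)%N.

Definition infinitesimal_deformation (R : realType) (N N' d' : nat)
    (M : 'rV[R[i]]_N -> Prop) (M' : 'rV[R[i]]_N' -> Prop)
    (H alpha : 'I_N' -> series R N) : Prop :=
  [/\ forall j, convergent (alpha j),
      forall j, alpha j 0%MM = 0
    & forall rho, defining_function d' M' rho ->
      near0 (fun Z => M Z ->
        'Re (\sum_j eval (alpha j) Z
             * eval (pderiv (lshift N' j) rho)
                    (row_mx (evalv H Z) (conjp (evalv H Z)))) = 0)].

Definition finite_dim_deformations (R : realType) (N N' d' : nat)
    (M : 'rV[R[i]]_N -> Prop) (M' : 'rV[R[i]]_N' -> Prop)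
    (H : 'I_N' -> series R N) : Prop :=
  exists (D : nat) (b : 'I_D -> 'I_N' -> series R N),
    (forall i, infinitesimal_deformation d' M M' H (b i)) /\
    forall alpha, infinitesimal_deformation d' M M' H alpha ->
    exists c : 'I_D -> R,
      forall j m, alpha j m = \sum_i (c i)%:C%C * b i j m.

Definition determined_by_jet (R : realType) (N N' d' : nat)
    (M : 'rV[R[i]]_N -> Prop) (M' : 'rV[R[i]]_N' -> Prop)
    (H : 'I_N' -> series R N) (k : nat) : Prop :=
  forall alpha beta,
    infinitesimal_deformation d' M M' H alpha ->
    infinitesimal_deformation d' M M' H beta ->
    (forall j m, (mdeg m <= k)%N -> alpha j m = beta j m) ->
    forall j, alpha j =1 beta j.

(* Main.v *)
(* If a convergent F (Z, zeta) vanishes at (Z, conj Z) for Z in M, it vanishes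
   on the complexification of M: a contraction gives points (e z, w) of M with
   w = e s + O(e^2) for all z in C^n and s in R^d, and these directions are
   totally real, so the lowest homogeneous term of F on the complexification is
   0.

   Applied to Re sum_j alpha_j rho_(Z'_j) (H, conj H) and followed by the L^iota,
   this turns kappa-nondegeneracy into an expression of alpha (Z) as a
   combination of derivatives of order at most kappa of bar alpha (zeta), on the
   complexification. Since (S^(q+1), bar S^q) lies in the complexification, the
   m-jet of alpha along S^(q+1) is controlled by the (m + kappa)-jet of
   bar alpha along bar S^q. Hence alpha o S^t = 0 as soon as the t kappa-jet of
   alpha at 0 vanishes, and then alpha = 0 if S^t has generically full rank.
   Finite dimension follows as the jet map is injective and real linear.

   For d + 1, the generic rank of S^1 is at least n, so for some q <= d + 1 it
   does not increase from S^q to S^(q+1). Then every f with f o S^q = 0 has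
   f o S^(q+1) = 0: by Cramer's rule the derivatives of f o S^(q+1) in the new
   variables are combinations, with a nonzero denominator, of those in the old
   ones. This propagates to all S^t, t >= q, so that f o S^(d+1) = 0 implies
   f = 0.

   In the strictly pseudoconvex case, w o S^2 = 0 would make rho vanish at
   (z, 0, chi, 0), so that the Levi form would be 0 on the complex tangent
   space. Hence the rank increases from S^1 to S^2, to n + 1. *)
From HB Require Import structures.
Require Import Defs.
From mathcomp Require Import perm ring lra.
From mathcomp.multinomials Require Import ssrcomplements.

Set Implicit Arguments.
Unset Strict Implicit.
Unset Printing Implicit Defensive.

Import Order.TTheory GRing.Theory Num.Theory.
Local Open Scope ring_scope.

(** * The ring of power series *)

(** Most of the argument is algebra in the ring of formal series, an integral domain. Values at
    points are limits of Taylor polynomials, and they are turned into formal identities at two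
    places only: [complexification_identity] and [generic_minor]. At the first, the equation of [M]
    ties w to its conjugate, so it is not solved directly: a holomorphic fixed-point equation is,
    and the uniqueness of its solution supplies the reality. For d + 1, the Cramer denominators may
    vanish at 0, so division is replaced by a count of vanishing orders. Passing to larger t needs
    no further comparison of ranks: f o S^(q+1) is (Phi f)(x_1, bar S^q) with Phi independent of q,
    so the Taylor coefficients in x_1 of f o S^(q+1) and f o S^(q+2) are the same series, taken
    along bar S^q and along bar S^(q+1). An inclusion of kernels between S^q and S^(q+1) is thus
    inherited by the next pair. *)

Section Congruence.
Variable K : comNzRingType.

(** Congruence modulo the (k+1)-st power of the ideal of polynomials without constant term;
    [lowdeg k] is membership in its k-th power. *)
Definition eqd n k (p q : {mpoly K[n]}) :=
  forall m, (mdeg m <= k)%N -> p@_m = q@_m.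

Definition lowdeg n k (p : {mpoly K[n]}) :=
  forall m, (mdeg m < k)%N -> p@_m = 0.

Lemma eqdM n k (p p' q q' : {mpoly K[n]}) :
  eqd k p p' -> eqd k q q' -> eqd k (p * q) (p' * q').
Proof.
move=> hp hq m hm; rewrite !mcoeffM; apply: eq_bigr => -[[a ha] [b hb]] /= /eqP e.
by rewrite hp ?hq //; apply: leq_trans hm; rewrite e mdegD ?leq_addr ?leq_addl.
Qed.

Lemma eqdX n k (p p' : {mpoly K[n]}) e : eqd k p p' -> eqd k (p ^+ e) (p' ^+ e).
Proof. by move=> h; elim: e => [|e IH]; [move=> m _ | rewrite !exprS; apply: eqdM]. Qed.

Lemma eqd_prod n k I (r : seq I) (F G : I -> {mpoly K[n]}) :
  (forall i, eqd k (F i) (G i)) -> eqd k (\prod_(i <- r) F i) (\prod_(i <- r) G i).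
Proof. by move=> h; apply: big_ind2 => // *; apply: eqdM. Qed.

Lemma lowdegM n a b (p q : {mpoly K[n]}) :
  lowdeg a p -> lowdeg b q -> lowdeg (a + b) (p * q).
Proof.
move=> hp hq m hm; rewrite mcoeffM big1 // => -[[c hc] [d hd]] /= /eqP e.
case: (ltnP (mdeg c) a) => hca; first by rewrite hp // mul0r.
rewrite [q@_d]hq ?mulr0 //; move: hm; rewrite e mdegD => hm.
by rewrite -(ltn_add2l a); apply: leq_ltn_trans hm; rewrite leq_add2r.
Qed.

Lemma lowdegX n a (p : {mpoly K[n]}) e : lowdeg a p -> lowdeg (a * e) (p ^+ e).
Proof.
by move=> h; elim: e => [|e IH]; [rewrite muln0 | rewrite exprS mulnS; apply: lowdegM].
Qed.

Lemma lowdeg_prodX n p (G : 'I_p -> {mpoly K[n]}) (m : 'X_{1..p}) :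
  (forall i, lowdeg 1 (G i)) -> lowdeg (mdeg m) (\prod_i G i ^+ m i).
Proof.
move=> h; rewrite mdegE; elim/big_ind2: _ => // [x1 x2 y1 y2 h1 h2|i _].
  exact: (lowdegM h1 h2).
by have := @lowdegX _ 1 _ (m i) (h i); rewrite mul1n.
Qed.

Lemma mcoeff_comp n p (P : {mpoly K[p]}) (G : p.-tuple {mpoly K[n]}) m :
  (P \mPo G)@_m = \sum_(a <- msupp P) P@_a * (\prod_i tnth G i ^+ a i)@_m.
Proof.
rewrite comp_mpolyEX linear_sum /=.
by apply: eq_bigr => a _; rewrite mcoeffZ comp_mpolyX.
Qed.

(** First [G] is replaced by [G'], monomial by monomial. Then the monomials of degree above [k] drop
    out, because the entries of [G] have no constant term. *)
Lemma eqd_comp n p k (P P' : {mpoly K[p]}) (G G' : p.-tuple {mpoly K[n]}) :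
    eqd k P P' -> (forall i, eqd k (tnth G i) (tnth G' i)) ->
    (forall i, lowdeg 1 (tnth G i)) ->
  eqd k (P \mPo G) (P' \mPo G').
Proof.
move=> hP hG h0 m hm.
have -> : (P' \mPo G')@_m = (P' \mPo G)@_m.
  rewrite !mcoeff_comp; apply: eq_bigr => a _; congr (_ * _).
  by apply/esym; apply: (@eqd_prod _ k) => // i; apply: eqdX.
apply/eqP; rewrite -subr_eq0 -mcoeffB -linearB /=; apply/eqP.
rewrite mcoeff_comp big_seq big1 // => a ha.
have [hak|hak] := leqP (mdeg a) k; first by rewrite mcoeffB hP // subrr mul0r.
rewrite [X in _ * X](lowdeg_prodX h0) ?mulr0 //.
exact: leq_ltn_trans hm hak.
Qed.

Lemma mderiv_comp n p (P : {mpoly K[p]}) (G : p.-tuple {mpoly K[n]}) j :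
  (P \mPo G)^`M(j) = \sum_i (P^`M(i) \mPo G) * (tnth G i)^`M(j).
Proof.
have dX (q : {mpoly K[n]}) e : (q ^+ e)^`M(j) = q ^+ e.-1 * q^`M(j) *+ e.
  elim: e => [|[|e] IH]; first by rewrite expr0 mulr0n mderivC.
    by rewrite expr1 mul1r.
  by rewrite exprS mderivM IH /= mulrnAr mulrA -exprS [RHS]mulrS [_^`M(j) * _]mulrC.
elim/mpolyind: P => [|c m P _ _ IH].
  by rewrite raddf0 mderiv0 big1 // => i _; rewrite mderiv0 raddf0 mul0r.
rewrite raddfD mderivD IH /=.
under [in RHS]eq_bigr do rewrite mderivD raddfD mulrDl.
rewrite big_split; congr (_ + _) => /=.
rewrite comp_mpolyZ mderivZ.
under [in RHS]eq_bigr do rewrite mderivZ comp_mpolyZ -scalerAl mderivX comp_mpolyZ.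
rewrite -scaler_sumr; congr (_ *: _); rewrite comp_mpolyX.
(* The product rule along a duplicate-free list. The truncated subtraction in the exponent is
   harmless: the term carries the factor [e i]. *)
have dprod (r : seq 'I_p) (e : 'I_p -> nat) : uniq r ->
    (\prod_(i <- r) tnth G i ^+ e i)^`M(j) =
    \sum_(i <- r) (\prod_(l <- r) tnth G l ^+ (e l - (i == l))) * (tnth G i)^`M(j) *+ e i.
  elim: r => [_|i r IHr /= /andP[ir ur]]; first by rewrite !big_nil mderivC.
  rewrite !big_cons mderivM dX IHr // eqxx subn1; congr (_ + _).
    rewrite -mulrnAl mulrAC -!mulrnAl; congr (_ *+ _ * _ * _).
    rewrite !big_seq; apply: eq_bigr => l lr.
    by case: eqP ir => [->|_ _]; rewrite ?lr // subn0.
  rewrite mulr_sumr !big_seq; apply: eq_bigr => l lr.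
  rewrite big_cons; case: eqP ir => [<-|_ _]; first by rewrite lr.
  by rewrite subn0 mulrnAr mulrA.
rewrite dprod ?index_enum_uniq //; apply: eq_bigr => i _.
rewrite comp_mpolyX -scaler_nat scalerAl; congr (_ *: _ * _).
by apply: eq_bigr => l _; rewrite mnmBE mnm1E.
Qed.

Lemma comp_mpolyA n p q (P : {mpoly K[q]}) (G : q.-tuple {mpoly K[p]})
    (F : p.-tuple {mpoly K[n]}) :
  (P \mPo G) \mPo F = P \mPo [tuple tnth G i \mPo F | i < q].
Proof.
rewrite (comp_mpolyEX P G) linear_sum /= comp_mpolyEX.
apply: eq_bigr => m _; rewrite comp_mpolyZ !comp_mpolyX rmorph_prod; congr (_ *: _).
by apply: eq_bigr => i _; rewrite rmorphXn tnth_mktuple.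
Qed.

End Congruence.

(** * Formal power series as an integral domain *)

Section SeriesRing.
Variable R : realType.
Local Notation C := R[i].
Implicit Types n p : nat.

(** Unlike [trunc f k], an approximant may have terms above degree [k], so approximants can be
    multiplied and composed freely. Laws of polynomials become laws of series through
    [approx_eq]. *)
Definition approx n k (f : series R n) (P : {mpoly C[n]}) :=
  forall m, (mdeg m <= k)%N -> P@_m = f m.

Lemma mcoeff_trunc n (f : series R n) k m :
  (trunc f k)@_m = if (mdeg m <= k)%N then f m else 0.
Proof.
case: leqP => h; first by rewrite mcoeff_mpoly.
rewrite linear_sum /= big1 // => a _; rewrite mcoeffZ mcoeffX.
case: eqP => [e|_]; last by rewrite mulr0.
by have := bmdeg a; rewrite e ltnNge h.
Qed.

Lemma approx_trunc n (f : series R n) k : approx k f (trunc f k).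
Proof. by move=> m h; rewrite mcoeff_trunc h. Qed.
Arguments approx_trunc {n} f k m.

Lemma approx_le n (f : series R n) P k l :
  (l <= k)%N -> approx k f P -> approx l f P.
Proof. by move=> lk h m hm; apply: h; apply: leq_trans lk. Qed.

Lemma approx_eqd n (f : series R n) P Q k : approx k f P -> approx k f Q -> eqd k P Q.
Proof. by move=> hP hQ m hm; rewrite hP // hQ. Qed.

Lemma approx_eq n (f g : series R n) :
  (forall k, exists2 P, approx k f P & approx k g P) -> f = g.
Proof.
by move=> h; apply: funext => m; have [P <- // <-] := h (mdeg m).
Qed.

Lemma approx_mul n (f g : series R n) P Q k :
  approx k f P -> approx k g Q -> approx k (pmul f g) (P * Q).
Proof.
move=> hP hQ m hm; rewrite /pmul.
apply: (eqdM (k := mdeg m)) => //.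
  exact: (approx_eqd (approx_le hm hP) (approx_trunc _ _)).
exact: (approx_eqd (approx_le hm hQ) (approx_trunc _ _)).
Qed.

Definition padd n (f g : series R n) : series R n := fun m => f m + g m.
Definition popp n (f : series R n) : series R n := fun m => - f m.
Definition pconst n (c : C) : series R n := fun m => c * (m == 0%MM)%:R.
Arguments pconst n c m : clear implicits.

Lemma approx_const n c k : approx k (@pconst n c) c%:MP.
Proof. by move=> m _; rewrite mcoeffC. Qed.

Lemma approx_add n (f g : series R n) P Q k :
  approx k f P -> approx k g Q -> approx k (padd f g) (P + Q).
Proof. by move=> hP hQ m hm; rewrite mcoeffD hP // hQ. Qed.

HB.instance Definition _ n := gen_eqMixin (series R n).
HB.instance Definition _ n := gen_choiceMixin (series R n).

Fact paddA n : associative (@padd n).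
Proof. by move=> f g h; apply: funext => m; apply: addrA. Qed.
Fact paddC n : commutative (@padd n).
Proof. by move=> f g; apply: funext => m; apply: addrC. Qed.
Fact padd0 n : left_id (pzero R n) (@padd n).
Proof. by move=> f; apply: funext => m; apply: add0r. Qed.
Fact paddN n : left_inverse (pzero R n) (@popp n) (@padd n).
Proof. by move=> f; apply: funext => m; apply: addNr. Qed.
HB.instance Definition _ n :=
  GRing.isZmodule.Build (series R n) (@paddA n) (@paddC n) (@padd0 n) (@paddN n).

Fact pmulA n : associative (@pmul R n).
Proof.
move=> f g h; apply: approx_eq => k.
exists (trunc f k * (trunc g k * trunc h k)); last rewrite mulrA.
  by do 2?apply: approx_mul; apply: approx_trunc.
by do 2?apply: approx_mul; apply: approx_trunc.
Qed.
Fact pmulC n : commutative (@pmul R n).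
Proof.
move=> f g; apply: approx_eq => k; exists (trunc f k * trunc g k); last rewrite mulrC.
  by apply: approx_mul; apply: approx_trunc.
by apply: approx_mul; apply: approx_trunc.
Qed.
Fact pmul1 n : left_id (pconst n 1) (@pmul R n).
Proof.
move=> f; apply: approx_eq => k; exists (1%:MP * trunc f k); last rewrite mpolyC1 mul1r.
  by apply: approx_mul; [apply: approx_const | apply: approx_trunc].
exact: approx_trunc.
Qed.
Fact pmulDl n : left_distributive (@pmul R n) (@padd n).
Proof.
move=> f g h; apply: approx_eq => k.
exists ((trunc f k + trunc g k) * trunc h k); last rewrite mulrDl.
  by apply: approx_mul; [apply: approx_add|]; apply: approx_trunc.
by apply: approx_add; apply: approx_mul; apply: approx_trunc.
Qed.
Fact pone_neq0 n : pconst n 1 != 0 :> series R n.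
Proof.
apply/eqP => /(congr1 (fun f : series R n => f 0%MM)) /eqP.
by rewrite /pconst eqxx mulr1 oner_eq0.
Qed.
HB.instance Definition _ n := GRing.Zmodule_isComNzRing.Build (series R n)
  (@pmulA n) (@pmulC n) (@pmul1 n) (@pmulDl n) (@pone_neq0 n).

Lemma addE n (f g : series R n) m : (f + g) m = f m + g m. Proof. by []. Qed.
Lemma oppE n (f : series R n) m : (- f) m = - f m. Proof. by []. Qed.
Lemma zeroE n m : (0 : series R n) m = 0. Proof. by []. Qed.

Lemma approxD n (f g : series R n) P Q k :
  approx k f P -> approx k g Q -> approx k (f + g) (P + Q).
Proof. exact: approx_add. Qed.
Lemma approxM n (f g : series R n) P Q k :
  approx k f P -> approx k g Q -> approx k (f * g) (P * Q).
Proof. exact: approx_mul. Qed.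
Lemma approx1 n k : approx k (1 : series R n) 1.
Proof. by rewrite -mpolyC1; apply: approx_const. Qed.
Lemma approx0 n k : approx k (0 : series R n) 0.
Proof. by move=> m _; rewrite mcoeff0. Qed.
Lemma approx_sum n I (r : seq I) (F : I -> series R n) P k :
  (forall i, approx k (F i) (P i)) -> approx k (\sum_(i <- r) F i) (\sum_(i <- r) P i).
Proof. by move=> h; apply: big_ind2 => // [|*]; [apply: approx0 | apply: approxD]. Qed.

Lemma sumE n I (r : seq I) (P : pred I) (F : I -> series R n) m :
  (\sum_(i <- r | P i) F i) m = \sum_(i <- r | P i) F i m.
Proof. by elim/big_rec2: _ => // i y z _ <-. Qed.

Lemma constM n (f g : series R n) : (f * g) 0%MM = f 0%MM * g 0%MM.
Proof.
rewrite -(approxM (approx_trunc f 0) (approx_trunc g 0)) ?mdeg0 //.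
by rewrite rmorphM /= !mcoeff_trunc mdeg0.
Qed.

Lemma const1 n : (1 : series R n) 0%MM = 1.
Proof. by rewrite -(approx1 (k := 0)) ?mdeg0 // mcoeff1 eqxx. Qed.

Lemma constX n (f : series R n) e : (f ^+ e) 0%MM = f 0%MM ^+ e.
Proof. by elim: e => [|e IH]; [rewrite !expr0 const1 | rewrite !exprS constM IH]. Qed.

(* 1 / f = c (1 + h + h^2 + ...) where c = 1 / f(0) and h = 1 - c f. *)
Lemma series_unit n (f : series R n) : f 0%MM != 0 -> exists g, g * f = 1.
Proof.
move=> f0; pose h : series R n := 1 - pconst n (f 0%MM)^-1 * f.
have h0 : h 0%MM = 0.
  by rewrite /h addE oppE constM const1 /pconst eqxx mulr1 mulVf // subrr.
(* Powers of [h] beyond [mdeg m] cannot contribute, since [h] has no constant term. *)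
pose g : series R n := fun m => (\sum_(i < (mdeg m).+1) trunc h (mdeg m) ^+ i)@_m.
have tl k : lowdeg 1 (trunc h k).
  move=> m; rewrite ltnS leqn0 mdeg_eq0 => /eqP ->.
  by rewrite mcoeff_trunc mdeg0 h0.
have hg k : approx k g (\sum_(i < k.+1) trunc h k ^+ i).
  move=> m hm; rewrite /g -(big_mkord xpredT (fun i => trunc h k ^+ i)).
  rewrite (big_cat_nat (n := (mdeg m).+1)) //= mcoeffD !raddf_sum /=.
  rewrite [X in _ + X]big_nat_cond [X in _ + X]big1 ?addr0.
    rewrite -(big_mkord xpredT (fun i => (trunc h (mdeg m) ^+ i)@_m)).
    apply: eq_bigr => i _; apply: (eqdX (k := mdeg m)) => // a ha.
    by rewrite !mcoeff_trunc ha (leq_trans ha hm).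
  move=> i /andP[/andP[hi _] _].
  by apply: (lowdegX (e := i) (tl k)); rewrite mul1n.
exists (pconst n (f 0%MM)^-1 * g); rewrite mulrAC.
have -> : pconst n (f 0%MM)^-1 * f = 1 - h by rewrite /h opprB addrC subrK.
apply: approx_eq => k; exists ((1 - trunc h k) * \sum_(i < k.+1) trunc h k ^+ i).
  apply: approxM => //.
  by move=> m hm; rewrite mcoeffB addE oppE (approx1 hm) mcoeff_trunc hm.
rewrite -opprB mulNr -subrX1 opprB => m hm.
rewrite mcoeffB (lowdegX (e := k.+1) (tl k)) ?mul1n ?ltnS // subr0.
exact: (approx1 (k := k)).
Qed.

Definition psunit n : pred (series R n) := fun f => `[<exists g, g * f = 1>].
Definition psinv n (f : series R n) : series R n :=
  if f \in @psunit n then xget 0 [set g | g * f = 1] else f.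

Fact psmulVr n : {in @psunit n, left_inverse 1 (@psinv n) *%R}.
Proof.
move=> f uf; rewrite /psinv uf; case: xgetP => // h.
by move: uf => /asboolP[g gf]; have := h g.
Qed.
Fact psunitP n (f g : series R n) : g * f = 1 -> f \in @psunit n.
Proof. by move=> h; apply/asboolP; exists g. Qed.
Fact psinv_out n : {in [predC @psunit n], @psinv n =1 id}.
Proof. by move=> f; rewrite inE /psinv => /negbTE ->. Qed.
HB.instance Definition _ n := GRing.ComNzRing_hasMulInverse.Build (series R n)
  (@psmulVr n) (@psunitP n) (@psinv_out n).

Lemma unit_const n (f : series R n) : f 0%MM != 0 -> f \is a GRing.unit.
Proof. by move=> /series_unit[g gf]; apply: psunitP gf. Qed.

(** With [k] the order of [f], [trunc f k] is the lowest homogeneous term of [f]. *)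
Lemma series_neq0 n (f : series R n) : f != 0 ->
  exists k, (trunc f k != 0) /\ lowdeg k (trunc f k).
Proof.
move=> f0.
have ex : exists k, `[<exists m, mdeg m = k /\ f m != 0>].
  apply: contrapT => h; move/eqP: f0; apply; apply: funext => m.
  apply/eqP; apply: contrapT => /negP hm; apply: h.
  by exists (mdeg m); apply/asboolP; exists m.
case: (ex_minnP ex) => k /asboolP[m [mk fm]] kmin; exists k; split.
  apply: contra_neq fm => t0; have := mcoeff_trunc f k m.
  by rewrite t0 mcoeff0 mk leqnn.
move=> a ha; rewrite mcoeff_trunc (ltnW ha); apply/eqP; apply: contrapT => /negP fa.
have : (k <= mdeg a)%N by apply: kmin; apply/asboolP; exists a.
by rewrite leqNgt ha.
Qed.

(** The lowest homogeneous terms have a nonzero product, homogeneous of degree [a + b], whose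
    coefficients are those of [f * g] in that degree. *)
Fact series_idomain n (f g : series R n) : f * g = 0 -> (f == 0) || (g == 0).
Proof.
move=> fg; apply: contrapT => /negP; rewrite negb_or => /andP[f0 g0].
have [a [Pa la]] := series_neq0 f0; have [b [Pb lb]] := series_neq0 g0.
set P := trunc f a in Pa la; set Q := trunc g b in Pb lb.
have : P * Q != 0 by rewrite mulf_neq0.
apply/negP; rewrite negbK; apply/eqP/mpolyP => m; rewrite mcoeff0.
have [hm|hm] := ltnP (mdeg m) (a + b); first exact: (lowdegM la lb).
have [hm'|hm'] := ltnP (a + b) (mdeg m).
  rewrite mcoeffM big1 // => -[[c hc] [d hd]] /= /eqP e.
  rewrite !mcoeff_trunc; case: leqP => ca; last by rewrite mul0r.
  case: leqP => db; last by rewrite mulr0.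
  move: hm'; rewrite e mdegD => hm'.
  by have := leq_add ca db; rewrite leqNgt hm'.
have em : mdeg m = (a + b)%N by apply/eqP; rewrite eqn_leq hm hm'.
have <- : (f * g) m = 0 by rewrite fg.
rewrite -(approxM (approx_trunc f (a + b)) (approx_trunc g (a + b)) hm').
(* Truncating at [a + b] changes each factor only above its order, hence not the product in degree
   [a + b]. *)
set P' := trunc f _; set Q' := trunc g _.
have hP : lowdeg a.+1 (P' - P).
  move=> c; rewrite ltnS => hc.
  by rewrite mcoeffB !mcoeff_trunc hc (leq_trans hc (leq_addr _ _)) subrr.
have hQ : lowdeg b.+1 (Q' - Q).
  move=> c; rewrite ltnS => hc.
  by rewrite mcoeffB !mcoeff_trunc hc (leq_trans hc (leq_addl _ _)) subrr.
have -> : P' * Q' = P * Q + ((P' - P) * Q + P * (Q' - Q) + (P' - P) * (Q' - Q)).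
  by ring.
rewrite mcoeffD !mcoeffD (lowdegM hP lb) ?em // (lowdegM la hQ) ?em ?addnS //.
by rewrite (lowdegM hP hQ) ?em ?addr0 // addnS addSn ltnW.
Qed.
HB.instance Definition _ n :=
  GRing.ComUnitRing_isIntegral.Build (series R n) (@series_idomain n).

End SeriesRing.
Arguments approx_trunc {R n} f k m.
Arguments pconst R n c m : clear implicits.

(** * Substitution, derivation and conjugation of series *)

Section SeriesCalculus.
Variable R : realType.
Local Notation C := R[i].
Implicit Types n p q : nat.

Definition centered n p (g : 'I_p -> series R n) := forall i, g i 0%MM = 0.

Lemma approx_psubst n p k (f : series R p) P (g : 'I_p -> series R n) G :
    centered g -> approx k f P -> (forall i, approx k (g i) (G i)) ->
  approx k (psubst f g) (P \mPo [tuple G i | i < p]).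
Proof.
move=> g0 hP hG m hm; rewrite /psubst; apply: (eqd_comp (k := mdeg m)) => //.
- exact: (approx_eqd (approx_le hm hP) (approx_trunc _ _)).
- move=> i; rewrite !tnth_mktuple.
  exact: (approx_eqd (approx_le hm (hG i)) (approx_trunc _ _)).
- move=> i a; rewrite ltnS leqn0 mdeg_eq0 tnth_mktuple => /eqP ->.
  by rewrite (hG i) ?mdeg0 ?g0.
Qed.

Lemma approx_psubst_trunc n p k (f : series R p) (g : 'I_p -> series R n) :
  centered g -> approx k (psubst f g) (trunc f k \mPo [tuple trunc (g i) k | i < p]).
Proof.
by move=> g0; apply: approx_psubst; [exact: g0 | exact: approx_trunc
  | move=> i; exact: approx_trunc].
Qed.

Lemma approx_var n k (i : 'I_n) : approx k (pvar R i) 'X_i.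
Proof. by move=> m _; rewrite mcoeffX /pvar eq_sym. Qed.

Lemma var0 n (i : 'I_n) : pvar R i 0%MM = 0.
Proof. by rewrite /pvar eq_sym mnm1_eq0. Qed.

Lemma centered_var n : centered (@pvar R n).
Proof. exact: var0. Qed.

Lemma psubst_const n p (f : series R p) (g : 'I_p -> series R n) :
  psubst f g 0%MM = f 0%MM.
Proof.
rewrite /psubst mdeg0; have -> : trunc f 0 = (f 0%MM)%:MP.
  apply/mpolyP => m; rewrite mcoeff_trunc mcoeffC leqn0 mdeg_eq0.
  by case: eqP => [->|]; rewrite ?mulr1 ?mulr0.
by rewrite comp_mpolyC mcoeffC eqxx mulr1.
Qed.

Lemma centered_psubst n p q (g : 'I_q -> series R p) (h : 'I_p -> series R n) :
  centered g -> centered (fun i => psubst (g i) h).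
Proof. by move=> g0 i; rewrite psubst_const g0. Qed.

Section Morphism.
Variables (n p : nat) (g : 'I_p -> series R n).
Hypothesis g0 : centered g.
Local Notation S f := (psubst f g).

Let psubst_eq (f : series R p) (h : series R n) :
    (forall k, exists2 P, approx k f P &
       approx k h (P \mPo [tuple trunc (g i) k | i < p])) -> S f = h.
Proof.
move=> H; apply: approx_eq => k; have [P hP hh] := H k.
exists (P \mPo [tuple trunc (g i) k | i < p]); last exact: hh.
by apply: approx_psubst; [exact: g0 | exact: hP | move=> i; exact: approx_trunc].
Qed.

Lemma psubstC c : S (pconst R p c) = pconst R n c.
Proof.
apply: psubst_eq => k; exists c%:MP; first exact: approx_const.
by rewrite comp_mpolyC; apply: approx_const.
Qed.

Lemma psubst0 : S 0 = 0.
Proof.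
apply: psubst_eq => k; exists 0; first exact: approx0.
by rewrite raddf0; apply: approx0.
Qed.

Lemma psubst1 : S 1 = 1. Proof. exact: psubstC. Qed.

Let approx_S f k : approx k (S f) (trunc f k \mPo [tuple trunc (g i) k | i < p]).
Proof. exact: approx_psubst_trunc. Qed.

Lemma psubstD f h : S (f + h) = S f + S h.
Proof.
apply: psubst_eq => k; exists (trunc f k + trunc h k).
  by apply: approxD; apply: approx_trunc.
by rewrite raddfD; apply: approxD; apply: approx_S.
Qed.

Lemma psubstN f : S (- f) = - S f.
Proof. by apply/eqP; rewrite -addr_eq0 -psubstD addNr psubst0. Qed.

Lemma psubstM f h : S (f * h) = S f * S h.
Proof.
apply: psubst_eq => k; exists (trunc f k * trunc h k).
  by apply: approxM; apply: approx_trunc.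
by rewrite rmorphM; apply: approxM; apply: approx_S.
Qed.

Lemma psubstX f e : S (f ^+ e) = S f ^+ e.
Proof. by elim: e => [|e IH]; [rewrite !expr0 psubst1 | rewrite !exprS psubstM IH]. Qed.

Lemma psubst_sum I (r : seq I) (P : pred I) F :
  S (\sum_(i <- r | P i) F i) = \sum_(i <- r | P i) S (F i).
Proof. exact: (big_morph _ psubstD psubst0). Qed.

Lemma psubst_prod I (r : seq I) (P : pred I) F :
  S (\prod_(i <- r | P i) F i) = \prod_(i <- r | P i) S (F i).
Proof. exact: (big_morph _ psubstM psubst1). Qed.

Lemma psubst_var i : S (pvar R i) = g i.
Proof.
apply: psubst_eq => k; exists 'X_i; first exact: approx_var.
rewrite comp_mpolyXU -tnth_nth tnth_mktuple; exact: approx_trunc.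
Qed.

Lemma psubst_det q (A : 'M[series R p]_q) :
  S (\det A) = \det (\matrix_(i, j) S (A i j)).
Proof.
rewrite /determinant psubst_sum; apply: eq_bigr => s _.
rewrite psubstM psubst_prod; congr (_ * _).
  by rewrite psubstX psubstN psubst1.
by apply: eq_bigr => i _; rewrite mxE.
Qed.

End Morphism.

Lemma psubst_id n (f : series R n) : psubst f (@pvar R n) = f.
Proof.
apply: approx_eq => k; exists (trunc f k); last exact: approx_trunc.
rewrite -[X in approx _ _ X]comp_mpoly_id; apply: approx_psubst.
- exact: centered_var.
- exact: approx_trunc.
- by move=> i; apply: approx_var.
Qed.

Lemma psubstA n p q (f : series R q) (g : 'I_q -> series R p) (h : 'I_p -> series R n) :
  centered g -> centered h ->
  psubst (psubst f g) h = psubst f (fun i => psubst (g i) h).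
Proof.
move=> g0 h0; apply: approx_eq => k.
pose G := [tuple trunc (g i) k | i < q]; pose H := [tuple trunc (h i) k | i < p].
exists ((trunc f k \mPo G) \mPo H).
  apply: approx_psubst; [exact: h0 | | by move=> i; apply: approx_trunc].
  exact: approx_psubst_trunc.
rewrite comp_mpolyA; apply: approx_psubst.
- exact: centered_psubst.
- exact: approx_trunc.
- move=> i; rewrite tnth_mktuple.
  exact: approx_psubst_trunc.
Qed.

Lemma approx_deriv n k (f : series R n) P i :
  approx k.+1 f P -> approx k (pderiv i f) P^`M(i).
Proof.
by move=> h m hm; rewrite mcoeff_deriv /pderiv h // mdegD mdeg1 addn1 ltnS.
Qed.

Lemma pderivD n i (f g : series R n) : pderiv i (f + g) = pderiv i f + pderiv i g.
Proof. by apply: funext => m; rewrite /pderiv !addE mulrnDl. Qed.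

Lemma pderiv0 n i : pderiv i (0 : series R n) = 0.
Proof. by apply: funext => m; rewrite /pderiv zeroE mul0rn. Qed.

Lemma pderivM n i (f g : series R n) :
  pderiv i (f * g) = pderiv i f * g + f * pderiv i g.
Proof.
apply: approx_eq => k; exists (trunc f k.+1 * trunc g k.+1)^`M(i).
  by apply: approx_deriv; apply: approxM; apply: approx_trunc.
rewrite mderivM; apply: approxD; apply: approxM.
- by apply: approx_deriv; apply: approx_trunc.
- by apply: (approx_le (leqnSn k)); apply: approx_trunc.
- by apply: (approx_le (leqnSn k)); apply: approx_trunc.
- by apply: approx_deriv; apply: approx_trunc.
Qed.

Lemma oneE n m : (1 : series R n) m = (m == 0%MM)%:R.
Proof. exact: mul1r. Qed.

Lemma pderiv_var n (i j : 'I_n) : pderiv i (pvar R j) = (i == j)%:R.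
Proof.
apply: funext => m; rewrite /pderiv /pvar.
have [<-|ij] := eqVneq i j.
  rewrite -[X in _ == X]add0m eqm_add2r; case: eqP => [->|/eqP m0].
    by rewrite mnm0E /= !mulr1n oneE eqxx.
  by rewrite mul0rn /= mulr1n oneE (negbTE m0).
case: eqP => [e|_]; last by rewrite mul0rn.
have /= := congr1 (fun a : 'X_{1..n} => a i) e; rewrite mnmDE !mnm1E eqxx addn1.
by rewrite eq_sym (negbTE ij).
Qed.

Lemma pderiv_comm n (i j : 'I_n) (f : series R n) :
  pderiv i (pderiv j f) = pderiv j (pderiv i f).
Proof.
apply: approx_eq => k; exists ((trunc f k.+2)^`M(j)^`M(i)); last rewrite mderiv_comm.
  by do 2!apply: approx_deriv; apply: approx_trunc.
by do 2!apply: approx_deriv; apply: approx_trunc.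
Qed.

Lemma pderiv_psubst n p j (f : series R p) (g : 'I_p -> series R n) : centered g ->
  pderiv j (psubst f g) = \sum_i psubst (pderiv i f) g * pderiv j (g i).
Proof.
move=> g0; apply: approx_eq => k.
pose G := [tuple trunc (g i) k.+1 | i < p].
exists (trunc f k.+1 \mPo G)^`M(j).
  by apply: approx_deriv; apply: approx_psubst_trunc.
rewrite mderiv_comp; apply: approx_sum => i; apply: approxM.
  apply: approx_psubst; first exact: g0.
    by apply: approx_deriv; apply: approx_trunc.
  by move=> l; apply: (approx_le (leqnSn k)); apply: approx_trunc.
by apply: approx_deriv; rewrite tnth_mktuple; apply: approx_trunc.
Qed.

Lemma pderiv_psubst_single n p (f : series R p) (g : 'I_p -> series R n) i j :
  centered g -> (forall a, pderiv j (g a) = (a == i)%:R) ->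
  pderiv j (psubst f g) = psubst (pderiv i f) g.
Proof.
move=> cg hg; rewrite (pderiv_psubst _ _ cg) (bigD1 i) //= big1 => [|a ne].
  by rewrite hg eqxx mulr1 addr0.
by rewrite hg (negbTE ne) mulr0.
Qed.

Definition pderivs n (l : seq 'I_n) (f : series R n) :=
  foldr (fun i h => pderiv i h) f l.

Lemma pderivs_cat n (l1 l2 : seq 'I_n) f :
  pderivs (l1 ++ l2) f = pderivs l1 (pderivs l2 f).
Proof. by rewrite /pderivs foldr_cat. Qed.

Lemma pderivs_rcons n (l : seq 'I_n) i f : pderivs (rcons l i) f = pderivs l (pderiv i f).
Proof. by rewrite -cats1 pderivs_cat. Qed.

Lemma pderivs0 n (l : seq 'I_n) : pderivs l 0 = 0.
Proof. by elim: l => //= i l ->; rewrite pderiv0. Qed.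

Lemma pderivsD n (l : seq 'I_n) f g : pderivs l (f + g) = pderivs l f + pderivs l g.
Proof. by elim: l => //= i l ->; rewrite pderivD. Qed.

Lemma pderivs_sum n (l : seq 'I_n) I (r : seq I) (P : pred I) (F : I -> series R n) :
  pderivs l (\sum_(i <- r | P i) F i) = \sum_(i <- r | P i) pderivs l (F i).
Proof. exact: (big_morph _ (pderivsD l) (pderivs0 l)). Qed.

Lemma mnm_neq0P n (m : 'X_{1..n}) : m != 0%MM -> exists i a, m = (a + U_(i))%MM.
Proof.
move=> m0; have [i mi] : exists i, m i != 0%N.
  apply: contrapT => h; move/eqP: m0; apply; apply/mnmP => i; rewrite mnm0E.
  by apply: contrapT => /eqP hi; apply: h; exists i.
by exists i, (m - U_(i))%MM; rewrite submK // lep1mP.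
Qed.

(** In characteristic 0, iterated derivatives at 0 are positive multiples of the coefficients. Later
    proofs that a series is 0 differentiate an identity repeatedly and read off constant terms. *)
Lemma series_taylor0 n (f : series R n) :
  (forall l, pderivs l f 0%MM = 0) -> f = 0.
Proof.
move=> h; apply: funext => m; rewrite zeroE; move: {2}(mdeg m) (erefl (mdeg m)) => k.
elim: k m f h => [|k IH] m f h mk.
  by move/eqP: mk; rewrite mdeg_eq0 => /eqP ->; apply: (h [::]).
have [|i [a e]] := @mnm_neq0P n m; first by rewrite -mdeg_eq0 mk.
have /eqP : pderiv i f a = 0.
  apply: IH => [l|]; first by rewrite -pderivs_rcons; apply: h.
  by apply/eqP; rewrite -eqSS -mk e mdegD mdeg1 addn1.
by rewrite /pderiv -e mulrn_eq0 => /eqP.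
Qed.

Lemma pderivs_jet n (f : series R n) k : (forall m, (mdeg m <= k)%N -> f m = 0) ->
  forall l, (size l <= k)%N -> pderivs l f 0%MM = 0.
Proof.
move=> h l; elim/last_ind: l k f h => [|l i IH] k f h; first by rewrite /= h ?mdeg0.
rewrite size_rcons pderivs_rcons; case: k h => // k h lk; apply: (IH k) => // m hm.
by rewrite /pderiv h ?mul0rn // mdegD mdeg1 addn1.
Qed.

Lemma pconjE n (f : series R n) m : pconj f m = (f m)^*. Proof. by []. Qed.

Lemma pconjK n : involutive (@pconj R n).
Proof. by move=> f; apply: funext => m; rewrite !pconjE conjCK. Qed.

Lemma pconjD n (f g : series R n) : pconj (f + g) = pconj f + pconj g.
Proof. by apply: funext => m; rewrite pconjE !addE rmorphD. Qed.

Lemma pconj0 n : pconj (0 : series R n) = 0.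
Proof. by apply: funext => m; rewrite pconjE zeroE rmorph0. Qed.

Lemma pconj_sum n I (r : seq I) (P : pred I) (F : I -> series R n) :
  pconj (\sum_(l <- r | P l) F l) = \sum_(l <- r | P l) pconj (F l).
Proof. exact: (big_morph _ (@pconjD n) (@pconj0 n)). Qed.

Lemma approx_conj n k (f : series R n) P :
  approx k f P -> approx k (pconj f) (map_mpoly Num.conj P).
Proof. by move=> h m hm; rewrite mcoeff_map_mpoly h. Qed.

Lemma pconjM n (f g : series R n) : pconj (f * g) = pconj f * pconj g.
Proof.
apply: approx_eq => k; exists (map_mpoly Num.conj (trunc f k * trunc g k)).
  by apply: approx_conj; apply: approxM; apply: approx_trunc.
by rewrite rmorphM; apply: approxM; apply: approx_conj; apply: approx_trunc.
Qed.

Lemma pconj_var n i : pconj (@pvar R n i) = pvar R i.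
Proof. by apply: funext => m; rewrite pconjE /pvar conjC_nat. Qed.

Lemma pconj_deriv n i (f : series R n) : pconj (pderiv i f) = pderiv i (pconj f).
Proof. by apply: funext => m; rewrite pconjE /pderiv rmorphMn. Qed.

Lemma pconj_derivs n l (f : series R n) : pconj (pderivs l f) = pderivs l (pconj f).
Proof. by elim: l => //= i l IH; rewrite pconj_deriv IH. Qed.

Lemma centered_conj n p (g : 'I_p -> series R n) :
  centered g -> centered (fun i => pconj (g i)).
Proof. by move=> g0 i; rewrite pconjE g0 rmorph0. Qed.

Lemma map_conjE n (P : {mpoly C[n]}) :
  map_mpoly Num.conj P = \sum_(m <- msupp P) (P@_m)^* *: 'X_[m].
Proof.
rewrite {1}[P]mpolyE raddf_sum; apply: eq_bigr => m _.
by rewrite /= map_mpolyZ map_mpolyX.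
Qed.

Lemma pconj_psubst n p (f : series R p) (g : 'I_p -> series R n) : centered g ->
  pconj (psubst f g) = psubst (pconj f) (fun i => pconj (g i)).
Proof.
move=> g0; apply: approx_eq => k.
exists (map_mpoly Num.conj (trunc f k \mPo [tuple trunc (g i) k | i < p])).
  by apply: approx_conj; apply: approx_psubst_trunc.
have -> : map_mpoly Num.conj (trunc f k \mPo [tuple trunc (g i) k | i < p]) =
    map_mpoly Num.conj (trunc f k) \mPo [tuple map_mpoly Num.conj (trunc (g i) k) | i < p].
  move: (trunc f k) => P.
  rewrite (map_conjE P) comp_mpolyEX !raddf_sum /=; apply: eq_bigr => m _.
  rewrite map_mpolyZ comp_mpolyX comp_mpolyZ comp_mpolyX rmorph_prod.
  by congr (_ *: _); apply: eq_bigr => i _; rewrite rmorphXn !tnth_mktuple.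
apply: approx_psubst; first exact: centered_conj.
  by apply: approx_conj; apply: approx_trunc.
by move=> i; apply: approx_conj; apply: approx_trunc.
Qed.

End SeriesCalculus.
Arguments centered {R n p}.

(** * Convergent power series *)

Section PolyNorm.
Variable C : numFieldType.
Implicit Types n p : nat.

(** The weighted l^1 norm of the coefficients at radius [t]. It dominates the values on the polydisc
    and is compatible with products and composition, so convergence is estimated on polynomials
    only. *)
Definition pn n (t : C) (p : {mpoly C[n]}) := \sum_(m <- msupp p) `|p@_m| * t ^+ mdeg m.

Lemma pnE n t (p : {mpoly C[n]}) k : (msize p <= k)%N ->
  pn t p = \sum_(m : 'X_{1..n < k}) `|p@_m| * t ^+ mdeg m.
Proof.
move=> le_pi; set I : subFinType _ := 'X_{1..n < k}.
rewrite /pn (big_mksub I) ?msupp_uniq //=; first last.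
  by move=> x /msize_mdeg_lt /leq_trans; apply.
by rewrite big_rmcond //= => j /memN_msupp_eq0 ->; rewrite normr0 mul0r.
Qed.

Lemma pn_ge0 n t (p : {mpoly C[n]}) : 0 <= t -> 0 <= pn t p.
Proof. by move=> t0; apply: sumr_ge0 => m _; rewrite mulr_ge0 ?exprn_ge0. Qed.

Lemma pn0 n t : pn t (0 : {mpoly C[n]}) = 0.
Proof. by rewrite /pn -[0 : mpoly _ _]mpolyC0 msupp0 big_nil. Qed.

Lemma pn_mono n t (p q : {mpoly C[n]}) : 0 <= t ->
  (forall m, `|p@_m| <= `|q@_m|) -> pn t p <= pn t q.
Proof.
move=> t0 h; rewrite (pnE t (leq_maxl (msize p) (msize q))).
rewrite (pnE t (leq_maxr (msize p) (msize q))).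
by apply: ler_sum => m _; rewrite ler_wpM2r ?exprn_ge0.
Qed.

Lemma pnD n t (p q : {mpoly C[n]}) : 0 <= t -> pn t (p + q) <= pn t p + pn t q.
Proof.
move=> t0; set k := maxn (msize p) (msize q).
rewrite (pnE t (leq_maxl (msize p) (msize q) : (msize p <= k)%N)).
rewrite (pnE t (leq_maxr (msize p) (msize q) : (msize q <= k)%N)).
rewrite (@pnE _ _ _ k); last exact: msizeD_le.
rewrite -big_split; apply: ler_sum => m _ /=.
by rewrite -mulrDl ler_wpM2r ?exprn_ge0 // mcoeffD ler_normD.
Qed.

Lemma pn_sum n t I (r : seq I) (F : I -> {mpoly C[n]}) : 0 <= t ->
  pn t (\sum_(i <- r) F i) <= \sum_(i <- r) pn t (F i).
Proof.
move=> t0; elim: r => [|i r IH]; first by rewrite !big_nil pn0.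
by rewrite !big_cons (le_trans (pnD _ _ t0)) ?lerD2l.
Qed.

Lemma pnZX n t c (m : 'X_{1..n}) : pn t (c *: 'X_[m]) = `|c| * t ^+ mdeg m.
Proof.
have [->|c0] := eqVneq c 0; first by rewrite scale0r pn0 normr0 mul0r.
by rewrite /pn msuppMCX // big_seq1 mcoeffZ mcoeffX eqxx mulr1.
Qed.

Lemma pnM n t (p q : {mpoly C[n]}) : 0 <= t -> pn t (p * q) <= pn t p * pn t q.
Proof.
move=> t0; rewrite mpolyME (le_trans (pn_sum _ _ t0)) // /pn big_distrlr /=.
rewrite big_allpairs le_eqVlt; apply/orP; left; apply/eqP.
apply: eq_bigr => a _; apply: eq_bigr => b _.
by rewrite -/(pn _ _) pnZX normrM mdegD exprD mulrACA.
Qed.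

Lemma pnC n t c : pn t (c%:MP : {mpoly C[n]}) = `|c|.
Proof. by rewrite -[c%:MP]mulr1 mul_mpolyC -mpolyX0 pnZX mdeg0 mulr1. Qed.

Lemma pn_prodX n p t s (G : 'I_p -> {mpoly C[n]}) (m : 'X_{1..p}) : 0 <= t ->
  (forall i, pn t (G i) <= s) -> pn t (\prod_i G i ^+ m i) <= s ^+ mdeg m.
Proof.
move=> t0 h.
have hX i e : pn t (G i ^+ e) <= s ^+ e.
  elim: e => [|e IH]; first by rewrite !expr0 -mpolyC1 pnC normr1.
  by rewrite !exprS (le_trans (pnM _ _ t0)) // ler_pM ?pn_ge0.
rewrite mdegE -prodrXr.
apply: (big_rec2 (fun x y => pn t x <= y)) => [|i x y _ hxy].
  by rewrite -mpolyC1 pnC normr1.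
by rewrite (le_trans (pnM _ _ t0)) // ler_pM ?pn_ge0.
Qed.

Lemma pn_comp n p t s (P : {mpoly C[p]}) (G : p.-tuple {mpoly C[n]}) : 0 <= t ->
  (forall i, pn t (tnth G i) <= s) -> pn t (P \mPo G) <= pn s P.
Proof.
move=> t0 h; rewrite comp_mpolyEX (le_trans (pn_sum _ _ t0)) // /pn.
apply: ler_sum => m _; rewrite -/(pn _ _) comp_mpolyX -mul_mpolyC.
rewrite (le_trans (pnM _ _ t0)) // pnC ler_wpM2l //.
exact: (pn_prodX (G := tnth G)).
Qed.

Lemma pn_eval n t (p : {mpoly C[n]}) (x : 'I_n -> C) :
  (forall i, `|x i| <= t) -> `|p.@[x]| <= pn t p.
Proof.
move=> h; rewrite mevalE (le_trans (ler_norm_sum _ _ _)) // ler_sum // => m _.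
rewrite normrM ler_wpM2l // normr_prod mdegE -prodrXr ler_prod // => i _.
by rewrite normrX exprn_ge0 //= lerXn2r ?nnegrE // (le_trans _ (h i)).
Qed.

(** A Schwarz lemma: every monomial present has degree at least [a], so it shrinks at least by
    [(t / T) ^+ a]. *)
Lemma pn_low n t T a (p : {mpoly C[n]}) : 0 <= t -> t <= T -> 0 < T -> lowdeg a p ->
  pn t p <= (t / T) ^+ a * pn T p.
Proof.
move=> t0 tT T0 h; rewrite mulr_sumr /pn !big_seq ler_sum // => m; rewrite mcoeff_msupp => hm.
rewrite mulrCA ler_wpM2l //.
have q0 : 0 <= t / T by rewrite divr_ge0 // ltW.
rewrite -[X in X ^+ mdeg m <= _](divfK (lt0r_neq0 T0)) exprMn.
rewrite ler_wpM2r ?exprn_ge0 ?(ltW T0) //.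
have ha : (a <= mdeg m)%N.
  by rewrite leqNgt; apply: contraNN hm => /h ->.
by rewrite ler_wiXn2l // ler_pdivrMr ?mul1r.
Qed.

Lemma pn_le_t n t T (p : {mpoly C[n]}) : 0 <= t -> t <= T -> pn t p <= pn T p.
Proof.
move=> t0 tT; apply: ler_sum => m _; rewrite ler_wpM2l // lerXn2r //.
by rewrite nnegrE (le_trans t0).
Qed.

(** A monomial of degree a varies by at most a t^(a-1) d, and a <= 2^a absorbs the factor a into the
    radius [2 * t]. *)
Lemma pn_lipschitz n t d (p : {mpoly C[n]}) (x y : 'I_n -> C) : 0 < t -> 0 <= d ->
  (forall i, `|x i| <= t) -> (forall i, `|y i| <= t) -> (forall i, `|x i - y i| <= d) ->
  `|p.@[x] - p.@[y]| <= d / t * pn (2 * t) p.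
Proof.
move=> t0 d0 hx hy hd; rewrite !mevalE -sumrB (le_trans (ler_norm_sum _ _ _)) //.
rewrite mulr_sumr ler_sum // => m _; rewrite -mulrBr normrM mulrCA ler_wpM2l //.
(* Stable under products; multiplied through by [t] to avoid the exponent [a - 1]. *)
pose Q (a : nat) (u v : C) := [/\ `|u| <= t ^+ a, `|v| <= t ^+ a &
  t * `|u - v| <= a%:R * t ^+ a * d].
have QM a b u v u' v' : Q a u v -> Q b u' v' -> Q (a + b)%N (u * u') (v * v').
  case=> u1 v1 uv1 [u2 v2 uv2]; split.
  - by rewrite normrM exprD ler_pM.
  - by rewrite normrM exprD ler_pM.
  have -> : u * u' - v * v' = u * (u' - v') + (u - v) * v' by ring.
  rewrite (le_trans (ler_wpM2l (ltW t0) (ler_normD _ _))) // mulrDr !normrM.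
  have -> : (a + b)%:R * t ^+ (a + b) * d =
      t ^+ a * (b%:R * t ^+ b * d) + a%:R * t ^+ a * d * t ^+ b.
    by rewrite natrD exprD; ring.
  apply: lerD; first by rewrite mulrCA ler_pM // mulr_ge0 // ltW.
  by rewrite mulrA ler_pM // mulr_ge0 // ltW.
have QX i e : Q e (x i ^+ e) (y i ^+ e).
  elim: e => [|e IH]; first by split; rewrite ?normr1 // subrr normr0 mulr0 !mul0r.
  rewrite !exprS -add1n; apply: QM => //; split; rewrite ?expr1 // mul1r ler_wpM2l //.
  exact: ltW.
have [_ _] : Q (mdeg m) (\prod_i x i ^+ m i) (\prod_i y i ^+ m i).
  rewrite mdegE; apply: (big_rec3 (fun u v a => Q a v u)) => [|i a u v _ h].
    by split; rewrite ?normr1 // subrr normr0 mulr0 !mul0r.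
  exact: QM.
rewrite mulrC -ler_pdivlMr // => /le_trans; apply.
have -> : d / t * (2 * t) ^+ mdeg m = 2 ^+ mdeg m * t ^+ mdeg m * d / t.
  by rewrite exprMn; ring.
rewrite ler_wpM2r ?invr_ge0 ?(ltW t0) // ler_wpM2r // ler_wpM2r ?exprn_ge0 ?(ltW t0) //.
by rewrite -natrX ler_nat ltnW // ltn_expl.
Qed.

End PolyNorm.

(** * Values as limits of Taylor polynomials *)

Section Convergence.
Variable R : realType.
Local Notation C := R[i].
Implicit Types n p : nat.

(** The intervals of radius [2 * A / 2 ^+ k] around [u k] are nested, and the supremum of their left
    ends lies in all of them. *)
Lemma real_geometric_limit (u : nat -> R) (A : R) :
    (forall k, `|u k.+1 - u k| <= A / 2 ^+ k) ->
  exists s, forall k, `|u k - s| <= 2 * A / 2 ^+ k.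
Proof.
move=> h; pose a k := u k - 2 * A / 2 ^+ k; pose b k := u k + 2 * A / 2 ^+ k.
have half k : 2 * A / 2 ^+ k = 2 * A / 2 ^+ k.+1 + A / 2 ^+ k.
  have : (2 : R) ^+ k != 0 by rewrite expf_neq0 ?pnatr_eq0.
  by rewrite exprS => ?; field.
have A0 : 0 <= A by have := le_trans (normr_ge0 _) (h 0%N); rewrite expr0 divr1.
have aS k : a k <= a k.+1.
  rewrite /a (half k); move: (2 * A / 2 ^+ k.+1) (A / 2 ^+ k) (u k) (u k.+1) (h k) => X Y p q.
  by rewrite ler_norml => /andP[? ?]; lra.
have bS k : b k.+1 <= b k.
  rewrite /b (half k); move: (2 * A / 2 ^+ k.+1) (A / 2 ^+ k) (u k) (u k.+1) (h k) => X Y p q.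
  by rewrite ler_norml => /andP[? ?]; lra.
have ab k : a k <= b k.
  have : 0 <= 2 * A / 2 ^+ k by rewrite divr_ge0 ?mulr_ge0 ?exprn_ge0.
  by rewrite /a /b; lra.
have am k l : (k <= l)%N -> a k <= a l.
  by move=> /subnK <-; elim: (l - k)%N => // j /le_trans; apply; rewrite addSn.
have bm k l : (k <= l)%N -> b l <= b k.
  by move=> /subnK <-; elim: (l - k)%N => // j; apply: le_trans; rewrite addSn.
have abm k l : a k <= b l.
  apply: (le_trans (am _ _ (leq_maxl k l))); apply: (le_trans (ab _)).
  exact: (bm _ _ (leq_maxr k l)).
pose E := [set a k | k in setT]%classic; exists (sup E) => k.
have ak : a k <= sup E.
  by apply: ub_le_sup; [exists (b 0%N) => _ [l _ <-] | exists k].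
have bk : sup E <= b k by apply: ge_sup; [exists (a 0%N); exists 0%N | move=> _ [l _ <-]].
by move: ak bk; rewrite ler_norml /a /b => ? ?; apply/andP; split; lra.
Qed.

Lemma complex_real_ge0 (x : C) : 0 <= x -> exists2 r : R, 0 <= r & x = r%:C%C.
Proof.
move=> x0; have /complex_realP[r e] := ger0_real x0; exists r => //.
by rewrite -ler0c -e.
Qed.

Lemma Im_le_norm (z : C) : `|complex.Im z|%:C%C <= `|z|.
Proof.
have := normc_ge_Re (z * 'i%C); rewrite ReiNIm normrN normrM.
suff -> : `|'i%C : C| = 1 by rewrite mulr1.
by rewrite normc_def /= expr0n expr1n add0r sqrtr1.
Qed.

(** The constant 4 is 2 for the real part plus 2 for the imaginary part. *)
Lemma geometric_limit (u : nat -> C) (A : C) :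
    (forall k, `|u k.+1 - u k| <= A / 2 ^+ k) ->
  exists s, forall k, `|u k - s| <= 4 * A / 2 ^+ k.
Proof.
move=> h.
have A0 : 0 <= A by have := le_trans (normr_ge0 _) (h 0%N); rewrite expr0 divr1.
have [a a0 eA] := complex_real_ge0 A0.
have eC k : A / 2 ^+ k = (a / 2 ^+ k)%:C%C by rewrite eA rmorphM fmorphV rmorphXn rmorph_nat.
have hR k : `|complex.Re (u k.+1) - complex.Re (u k)| <= a / 2 ^+ k.
  rewrite -lecR -eC (le_trans _ (h k)) //.
  have -> : complex.Re (u k.+1) - complex.Re (u k) = complex.Re (u k.+1 - u k).
    by case: (u k) => ? ?; case: (u k.+1).
  exact: normc_ge_Re.
have hI k : `|complex.Im (u k.+1) - complex.Im (u k)| <= a / 2 ^+ k.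
  rewrite -lecR -eC (le_trans _ (h k)) //.
  have -> : complex.Im (u k.+1) - complex.Im (u k) = complex.Im (u k.+1 - u k).
    by case: (u k) => ? ?; case: (u k.+1).
  exact: Im_le_norm.
have [s hs] := real_geometric_limit hR; have [t ht] := real_geometric_limit hI.
exists (s +i* t)%C => k.
have -> : u k - (s +i* t)%C =
    (complex.Re (u k) - s)%:C%C + 'i%C * (complex.Im (u k) - t)%:C%C.
  by rewrite [LHS]complexE; case: (u k).
rewrite (le_trans (ler_normD _ _)) // normrM.
have -> : `|'i%C : C| = 1 by rewrite normc_def /= expr0n expr1n add0r sqrtr1.
have nC (x : R) : `|x%:C%C| = `|x|%:C%C by rewrite normc_def /= expr0n addr0 sqrtr_sqr.
have -> : 4 * A / 2 ^+ k = (2 * a / 2 ^+ k)%:C%C + (2 * a / 2 ^+ k)%:C%C.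
  rewrite -rmorphD -mulrDl -mulrDl -natrD rmorphM fmorphV rmorphXn rmorphM !rmorph_nat.
  by rewrite eA.
by rewrite mul1r !nC lerD // lecR.
Qed.

Lemma half_pow_small (B e : C) : 0 < e -> 0 <= B ->
  exists k0, forall k, (k0 <= k)%N -> B / 2 ^+ k < e.
Proof.
move=> e0 B0; have [r r0 er] := complex_real_ge0 (divr_ge0 B0 (ltW e0)).
exists (Num.bound r) => k hk.
rewrite ltr_pdivrMr ?exprn_gt0 // mulrC -ltr_pdivrMr // er.
have := archi_boundP r0; rewrite -(ltcR r) rmorph_nat => /lt_trans; apply.
by rewrite -natrX ltr_nat (leq_ltn_trans hk) // ltn_expl.
Qed.

(** Equalities of values are proved in this form, by comparing both sides with polynomial values. *)
Lemma eq_of_geometric (a b B : C) : (forall k, `|a - b| <= B / 2 ^+ k) -> a = b.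
Proof.
move=> h; have B0 : 0 <= B by have := le_trans (normr_ge0 _) (h 0%N); rewrite expr0 divr1.
apply/eqP; rewrite -subr_eq0 -normr_eq0; apply/negPn/negP => nz.
have nz0 : 0 < `|a - b| by rewrite lt_def nz normr_ge0.
have [k hk] := half_pow_small nz0 B0.
by have := le_lt_trans (h k) (hk k (leqnn _)); rewrite ltxx.
Qed.

(** The weighted norm of the whole series at radius [T] is at most [A], stated on truncations so
    that only finite sums occur. Values are then controlled at radius [T / 2]. *)
Definition bnd n (T A : C) (f : series R n) := forall k, pn T (trunc f k) <= A.

Section Eval.
Variables (n : nat) (T A : C) (f : series R n).
Hypotheses (T0 : 0 < T) (fb : bnd T A f).

Lemma bnd_ge0 : 0 <= A.
Proof. exact: le_trans (pn_ge0 _ (ltW T0)) (fb 0). Qed.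

Lemma trunc_lowdeg k l : (k <= l)%N -> lowdeg k.+1 (trunc f l - trunc f k).
Proof.
move=> kl m; rewrite ltnS => hm.
by rewrite mcoeffB !mcoeff_trunc hm (leq_trans hm kl) subrr.
Qed.

Lemma pn_trunc_diff k l t : (k <= l)%N -> 0 <= t -> t <= T ->
  pn t (trunc f l - trunc f k) <= A * (t / T) ^+ k.+1.
Proof.
move=> kl t0 tT; apply: le_trans (pn_low t0 tT T0 (trunc_lowdeg kl)) _.
rewrite mulrC ler_wpM2r ?exprn_ge0 ?divr_ge0 ?(ltW T0) //.
apply: le_trans (fb l); apply: pn_mono; first exact: ltW.
move=> m; rewrite mcoeffB !mcoeff_trunc.
case: leqP => h1; case: leqP => h2; rewrite ?subrr ?subr0 ?normr0 //.
by rewrite leqNgt (leq_ltn_trans kl) in h2.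
Qed.

Variables (t : C) (x : 'rV[C]_n).
Hypotheses (tT : 2 * t <= T) (xt : forall i, `|x 0 i| <= t) (t0 : 0 <= t).

Let tT1 : t <= T.
Proof. by apply: le_trans tT; rewrite mulr_natl mulr2n lerDl. Qed.

Let q0 : 0 <= t / T. Proof. by rewrite divr_ge0 // ltW. Qed.
Let q2 : t / T <= 2^-1.
Proof. by rewrite ler_pdivrMr // mulrC ler_pdivlMr // mulrC. Qed.

Lemma half_pow k : (t / T) ^+ k <= (2 ^+ k)^-1.
Proof. by rewrite -exprVn lerXn2r ?q2 // nnegrE invr_ge0. Qed.

Let bound_diff k l : (k <= l)%N ->
  `|(trunc f l).@[x 0] - (trunc f k).@[x 0]| <= A * (t / T) ^+ k.+1.
Proof.
move=> kl; rewrite -mevalB; apply: le_trans (pn_trunc_diff kl t0 tT1).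
exact: pn_eval.
Qed.

(** Rules out the default value of [eval]: the Taylor polynomials form a geometric Cauchy
    sequence. *)
Lemma sums_to_eval : sums_to f x (eval f x).
Proof.
apply: (@xgetPex _ 0 [set s | sums_to f x s]%classic).
have [k|s hs] := @geometric_limit (fun k => (trunc f k).@[x 0]) (A / 2).
  apply: le_trans (bound_diff (leqnSn k)) _; rewrite -mulrA -invfM -exprS.
  by rewrite ler_wpM2l ?half_pow // bnd_ge0.
exists s => e e0.
have [|k0 hk] := @half_pow_small (4 * (A / 2)) _ e0.
  by rewrite mulr_ge0 // divr_ge0 // bnd_ge0.
by exists k0 => k /hk; apply: le_lt_trans.
Qed.

Lemma sums_to_unique s s' : sums_to f x s -> sums_to f x s' -> s = s'.
Proof.
move=> hs hs'; apply/eqP; rewrite -subr_eq0 -normr_le0; apply/ler_addgt0Pl => e e0.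
have e2 : 0 < e / 2 by rewrite divr_gt0.
have [k1 h1] := hs _ e2; have [k2 h2] := hs' _ e2.
set k := maxn k1 k2; rewrite addr0 [e in _ <= e]splitr.
have := ltW (h1 k (leq_maxl _ _)); have := ltW (h2 k (leq_maxr _ _)); set P := _.@[_].
move=> a b; apply: le_trans (lerD b a).
by rewrite [`|P - s|]distrC (le_trans _ (ler_normD _ _)) // addrA subrK.
Qed.

Lemma eval_taylor k : `|eval f x - (trunc f k).@[x 0]| <= A * (t / T) ^+ k.+1.
Proof.
apply/ler_addgt0Pl => e e0; have [k0 hk] := sums_to_eval e0.
set l := maxn k0 k.
apply: le_trans (ler_distD (trunc f l).@[x 0] _ _) _.
rewrite distrC; apply: lerD; first by rewrite ltW // hk // leq_maxl.
exact: bound_diff (leq_maxr k0 k).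
Qed.

Lemma eval_taylor2 k : `|eval f x - (trunc f k).@[x 0]| <= A / 2 ^+ k.+1.
Proof.
by apply: le_trans (eval_taylor k) _; rewrite ler_wpM2l ?half_pow // bnd_ge0.
Qed.

End Eval.

Section Approximants.
Variables (n : nat) (T A : C) (f : series R n) (P : nat -> {mpoly C[n]}).
Hypotheses (T0 : 0 < T) (fP : forall k, approx k f (P k)) (Pb : forall k, pn T (P k) <= A).

Lemma approx_norm k m : `|(trunc f k)@_m| <= `|(P k)@_m|.
Proof.
by rewrite mcoeff_trunc; case: leqP => h; rewrite ?normr0 // fP.
Qed.

Lemma bnd_approx : bnd T A f.
Proof.
by move=> k; apply: le_trans (Pb k); apply: pn_mono; [exact: ltW | exact: approx_norm].
Qed.

(** Natural approximants of products and composites have terms above degree [k]; being of high order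
    and bounded norm, they cost no more than a Taylor remainder. *)
Lemma eval_approx (t : C) (x : 'rV[C]_n) : 2 * t <= T -> (forall i, `|x 0 i| <= t) -> 0 <= t ->
  forall k, `|eval f x - (P k).@[x 0]| <= A / 2 ^+ k.
Proof.
move=> tT xt t0 k.
have tT1 : t <= T by apply: le_trans tT; rewrite mulr_natl mulr2n lerDl.
have q0 : 0 <= t / T by rewrite divr_ge0 // ltW.
have A0 := bnd_ge0 T0 bnd_approx.
have h1 := eval_taylor2 T0 bnd_approx tT xt t0 k.
have h2 : `|(trunc f k).@[x 0] - (P k).@[x 0]| <= A / 2 ^+ k.+1.
  rewrite -mevalB (le_trans (pn_eval _ xt)) //.
  have low : lowdeg k.+1 (trunc f k - P k).
    by move=> m hm; rewrite mcoeffB mcoeff_trunc -ltnS hm fP ?subrr.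
  apply: le_trans (pn_low t0 tT1 T0 low) _; rewrite mulrC.
  apply: ler_pM; rewrite ?exprn_ge0 ?pn_ge0 ?(ltW T0) //; last exact: half_pow.
  apply: le_trans (Pb k); apply: pn_mono; first exact: ltW.
  move=> m; rewrite mcoeffB mcoeff_trunc; case: leqP => h.
    by rewrite fP // subrr normr0.
  by rewrite sub0r normrN.
rewrite -(subrK (trunc f k).@[x 0] (eval f x)) -addrA.
apply: le_trans (ler_normD _ _) _; apply: le_trans (lerD h1 h2) _.
rewrite exprS invfM mulrA -mulrDl ler_wpM2r ?invr_ge0 ?exprn_ge0 //.
by rewrite -splitr.
Qed.

End Approximants.

End Convergence.

(** * Values of sums, products and composites near 0 *)

Section NearZero.
Variable R : realType.
Local Notation C := R[i].
Implicit Types n p : nat.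

(** The order of [R[i]] is partial; half the harmonic mean is a lower bound found without comparing
    [a] and [b]. *)
Lemma pos_min (a b : C) : 0 < a -> 0 < b -> exists c, [/\ 0 < c, c <= a & c <= b].
Proof.
move=> a0 b0; have ab : 0 < a + b by rewrite addr_gt0.
exists (a * b / (a + b)); split; first by rewrite divr_gt0 ?mulr_gt0.
  by rewrite ler_pdivrMr // ler_wpM2l ?ltW // ltrDr.
by rewrite ler_pdivrMr // mulrC ler_wpM2l ?ltW // ltrDl.
Qed.

Lemma pos_min_fin p (e : 'I_p -> C) : (forall i, 0 < e i) ->
  exists2 c, 0 < c & forall i, c <= e i.
Proof.
move=> e0; have s0 : 0 < 1 + \sum_i (e i)^-1.
  by rewrite ltr_wpDr // sumr_ge0 // => i _; rewrite invr_ge0 ltW.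
exists (1 + \sum_i (e i)^-1)^-1 => [|i]; first by rewrite invr_gt0.
rewrite -[e i]invrK lef_pV2 ?posrE ?invr_gt0 // (bigD1 i) //= addrCA lerDl.
by rewrite addr_ge0 // sumr_ge0 // => j _; rewrite invr_ge0 ltW.
Qed.

Lemma near0_and n (P Q : 'rV[C]_n -> Prop) :
  near0 P -> near0 Q -> near0 (fun x => P x /\ Q x).
Proof.
move=> [a a0 ha] [b b0 hb]; have [c [c0 ca cb]] := pos_min a0 b0.
by exists c => // x hx; split; [apply: ha | apply: hb] => i;
  apply: (lt_le_trans (hx i)).
Qed.

Lemma near0_impl n (P Q : 'rV[C]_n -> Prop) :
  (forall x, P x -> Q x) -> near0 P -> near0 Q.
Proof. by move=> PQ [a a0 ha]; exists a => // x /ha /PQ. Qed.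

Lemma near0_forall n p (P : 'I_p -> 'rV[C]_n -> Prop) :
  (forall i, near0 (P i)) -> near0 (fun x => forall i, P i x).
Proof.
move=> h; have /choice[e he] : forall i, exists e : C, 0 < e /\
    forall x : 'rV[C]_n, (forall j, `|x 0 j| < e) -> P i x.
  by move=> i; have [e e0 he] := h i; exists e.
have [|c c0 hc] := @pos_min_fin _ e; first by move=> i; have [] := he i.
exists c => // x hx i; have [_] := he i; apply => j; exact: (lt_le_trans (hx j)).
Qed.

Lemma near0_le n (t : C) (P : 'rV[C]_n -> Prop) : 0 < t ->
  (forall x : 'rV[C]_n, (forall i, `|x 0 i| <= t) -> P x) -> near0 P.
Proof. by move=> t0 h; exists t => // x hx; apply: h => i; apply: ltW. Qed.

Lemma near0_all n (P : 'rV[C]_n -> Prop) : (forall x, P x) -> near0 P.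
Proof. by move=> h; exists 1. Qed.

Lemma bnd_le n (t T A : C) (f : series R n) : 0 <= t -> t <= T -> bnd T A f -> bnd t A f.
Proof. by move=> t0 tT h k; apply: le_trans (pn_le_t _ t0 tT) _. Qed.

Lemma bnd_leA n (T A B : C) (f : series R n) : A <= B -> bnd T A f -> bnd T B f.
Proof. by move=> AB h k; apply: le_trans AB. Qed.

Lemma bnd_convergent n (T A : C) (f : series R n) : 0 < T -> bnd T A f -> convergent f.
Proof.
move=> T0 h; exists T, A; split => // m; apply: le_trans (h (mdeg m)).
rewrite (@pnE _ _ _ _ (maxn (msize (trunc f (mdeg m))) (mdeg m).+1)) ?leq_maxl //.
have hm : (mdeg m < maxn (msize (trunc f (mdeg m))) (mdeg m).+1)%N by rewrite leq_maxr.
rewrite (bigD1 (BMultinom hm)) //= mcoeff_trunc leqnn lerDl sumr_ge0 // => i _.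
by rewrite mulr_ge0 ?exprn_ge0 ?(ltW T0).
Qed.

(** Dominated by a product of [n] geometric series: bounded multi-indices embed into functions from
    ['I_n] to an ordinal. *)
Lemma sum_half_pow n k :
  \sum_(m : 'X_{1..n < k}) (2 ^+ mdeg m)^-1 <= 2 ^+ n :> C.
Proof.
case: k => [|k].
  by rewrite big1 ?exprn_ge0 // => -[m hm].
pose h (m : 'X_{1..n < k.+1}) : {ffun 'I_n -> 'I_k.+1} := [ffun i => inord (m i)].
have mi (m : 'X_{1..n < k.+1}) i : (m i < k.+1)%N.
  apply: leq_ltn_trans (bmdeg m); rewrite mdegE (bigD1 i) //= leq_addr //.
have hinj : {in predT &, injective h}.
  move=> a b _ _ /ffunP e; apply/val_inj/mnmP => i; have := congr1 val (e i).
  by rewrite !ffunE /= !inordK.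
have geo j : \sum_(i < j) (2 ^+ i)^-1 <= 2 :> C.
  have : \sum_(i < j) (2 ^+ i)^-1 = 2 - 2 / 2 ^+ j :> C.
    elim: j => [|j IH]; first by rewrite big_ord0 expr0 divr1 subrr.
    have ? : (2 : C) ^+ j != 0 by rewrite expf_neq0 ?pnatr_eq0.
    by rewrite big_ord_recr /= IH exprS; field.
  by move=> ->; rewrite gerBl divr_ge0 ?exprn_ge0.
rewrite -[n in 2 ^+ n]card_ord -prodr_const.
apply: (@le_trans _ _ (\prod_(i < n) \sum_(j < k.+1) (2 ^+ j)^-1)); last first.
  by apply: ler_prod => i _; rewrite geo andbT sumr_ge0 // => j _; rewrite invr_ge0 exprn_ge0.
rewrite bigA_distr_bigA /=.
have -> : \sum_(m : 'X_{1..n < k.+1}) (2 ^+ mdeg m)^-1 =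
    \sum_(f in h @: predT) \prod_i (2 ^+ f i)^-1 :> C.
  rewrite big_imset //=; apply: eq_big => [m|m _] //.
  rewrite mdegE -prodrXr -prodfV; apply: eq_bigr => i _.
  by rewrite ffunE inordK.
rewrite [leRHS](bigID (fun f => f \in h @: predT)) /= lerDl sumr_ge0 // => f _.
by apply: prodr_ge0 => i _; rewrite invr_ge0 exprn_ge0.
Qed.

(** Halving the radius turns a bound on each term into a summable one, at the price of the factor
    [2 ^+ n] of [sum_half_pow]. *)
Lemma convergent_bnd n (f : series R n) :
  convergent f -> exists T A, [/\ 0 < T, 0 <= A & bnd T A f].
Proof.
move=> [r [A [r0 h]]].
have A0 : 0 <= A by apply: le_trans (h 0%MM); rewrite mulr_ge0 ?exprn_ge0 // ltW.
exists (r / 2), (A * 2 ^+ n); split; rewrite ?divr_gt0 ?mulr_ge0 ?exprn_ge0 // => k.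
have r2 : 0 <= r / 2 by rewrite divr_ge0 // ltW.
rewrite (pnE _ (leqnn _)) (le_trans _ (ler_wpM2l A0 (sum_half_pow n (msize (trunc f k))))) //.
rewrite mulr_sumr ler_sum // => m _; rewrite exprMn exprVn mulrA.
rewrite ler_wpM2r ?invr_ge0 ?exprn_ge0 //.
apply: le_trans (h m); rewrite ler_wpM2r ?exprn_ge0 ?(ltW r0) // mcoeff_trunc.
by case: leqP; rewrite ?normr0.
Qed.

Lemma convergentD n (f g : series R n) :
  convergent f -> convergent g -> convergent (f + g) /\
  near0 (fun x => eval (f + g) x = eval f x + eval g x).
Proof.
move=> /convergent_bnd[T1 [A [T10 A0 hf]]] /convergent_bnd[T2 [B [T20 B0 hg]]].
have [T [T0 TT1 TT2]] := pos_min T10 T20.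
have {}hf := bnd_le (ltW T0) TT1 hf; have {}hg := bnd_le (ltW T0) TT2 hg.
pose P k := trunc f k + trunc g k.
have fP k : approx k (f + g) (P k) by apply: approxD; apply: approx_trunc.
have Pb k : pn T (P k) <= A + B.
  by rewrite (le_trans (pnD _ _ (ltW T0))) // lerD.
split; first exact: (bnd_convergent T0 (bnd_approx T0 fP Pb)).
have t0 : 0 < T / 2 by rewrite divr_gt0.
have tT : 2 * (T / 2) <= T by rewrite mulrC divfK ?pnatr_eq0.
apply: (near0_le t0) => x hx.
apply: (@eq_of_geometric _ _ _ (A + B + A + B)) => k.
apply: le_trans (ler_distD (P k).@[x 0] _ _) _.
have -> : (A + B + A + B) / 2 ^+ k = (A + B) / 2 ^+ k + (A / 2 ^+ k + B / 2 ^+ k) by ring.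
apply: lerD; first exact: (eval_approx T0 fP Pb tT hx (ltW t0)).
have hk (D : C) : 0 <= D -> D / 2 ^+ k.+1 <= D / 2 ^+ k.
  move=> D0; rewrite ler_wpM2l // lef_pV2 ?posrE ?exprn_gt0 //.
  by rewrite exprS ler_peMl ?exprn_ge0 // ler1n.
rewrite distrC mevalD opprD addrACA; apply: le_trans (ler_normD _ _) _; apply: lerD.
  by apply: le_trans (hk _ A0); apply: (eval_taylor2 T0 hf tT hx (ltW t0)).
by apply: le_trans (hk _ B0); apply: (eval_taylor2 T0 hg tT hx (ltW t0)).
Qed.

Lemma half_powS (D : C) k : 0 <= D -> D / 2 ^+ k.+1 <= D / 2 ^+ k.
Proof.
move=> D0; rewrite ler_wpM2l // lef_pV2 ?posrE ?exprn_gt0 //.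
by rewrite exprS ler_peMl ?exprn_ge0 // ler1n.
Qed.

Lemma convergentM n (f g : series R n) :
  convergent f -> convergent g -> convergent (f * g) /\
  near0 (fun x => eval (f * g) x = eval f x * eval g x).
Proof.
move=> /convergent_bnd[T1 [A [T10 A0 hf]]] /convergent_bnd[T2 [B [T20 B0 hg]]].
have [T [T0 TT1 TT2]] := pos_min T10 T20.
have {}hf := bnd_le (ltW T0) TT1 hf; have {}hg := bnd_le (ltW T0) TT2 hg.
pose P k := trunc f k * trunc g k.
have fP k : approx k (f * g) (P k) by apply: approxM; apply: approx_trunc.
have Pb k : pn T (P k) <= A * B.
  by rewrite (le_trans (pnM _ _ (ltW T0))) // ler_pM ?pn_ge0 // ltW.
split; first exact: (bnd_convergent T0 (bnd_approx T0 fP Pb)).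
have t0 : 0 < T / 2 by rewrite divr_gt0.
have tT : 2 * (T / 2) <= T by rewrite mulrC divfK ?pnatr_eq0.
have tT1 : T / 2 <= T by rewrite ler_pdivrMr // ler_peMr ?ler1n // ltW.
apply: (near0_le t0) => x hx.
(* The first term is the error for [f * g]; the other two come from splitting the difference of the
   two products of values. *)
apply: (@eq_of_geometric _ _ _ (A * B + (A * B + A * `|eval g x|))) => k.
apply: le_trans (ler_distD (P k).@[x 0] _ _) _.
rewrite mulrDl; apply: lerD; first exact: (eval_approx T0 fP Pb tT hx (ltW t0)).
rewrite mevalM mulrDl; set p := meval _ _; set q := meval _ _.
have -> : p * q - eval f x * eval g x = p * (q - eval g x) + (p - eval f x) * eval g x.
  by rewrite mulrBr mulrBl addrA subrK.
apply: le_trans (ler_normD _ _) _; rewrite !normrM; apply: lerD.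
  rewrite -mulrA; apply: ler_pM => //.
    apply: le_trans (hf k); apply: le_trans (pn_le_t _ (ltW t0) tT1).
    exact: pn_eval.
  rewrite distrC; apply: le_trans (half_powS _ B0).
  exact: (eval_taylor2 T0 hg tT hx (ltW t0)).
rewrite mulrAC ler_wpM2r // distrC; apply: le_trans (half_powS _ A0).
exact: (eval_taylor2 T0 hf tT hx (ltW t0)).
Qed.

Lemma eval_poly n (f : series R n) (P : {mpoly C[n]}) :
  (forall k, approx k f P) -> convergent f /\ near0 (fun x => eval f x = P.@[x 0]).
Proof.
move=> fP; have Pb (k : nat) : pn 1 P <= pn 1 P by [].
have b := bnd_approx ltr01 fP Pb; split; first exact: (bnd_convergent ltr01 b).
have t0 : 0 < 2^-1 :> C by rewrite invr_gt0.
apply: (near0_le t0) => x hx.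
apply: (@eq_of_geometric _ _ _ (pn 1 P)) => k.
by apply: (eval_approx ltr01 fP Pb _ hx (ltW t0)); rewrite divff ?pnatr_eq0.
Qed.

Lemma convergent_const n c : convergent (pconst R n c) /\
  near0 (fun x => eval (pconst R n c) x = c).
Proof.
have [|? h] := @eval_poly n (pconst R n c) c%:MP; first exact: approx_const.
by split=> //; apply: near0_impl h => x; rewrite mevalC.
Qed.

Lemma convergent_var n (i : 'I_n) : convergent (pvar R i) /\
  near0 (fun x => eval (pvar R i) x = x 0 i).
Proof.
have [|? h] := @eval_poly n (pvar R i) 'X_i; first by move=> k; apply: approx_var.
by split=> //; apply: near0_impl h => x; rewrite mevalXU.
Qed.

Lemma convergent0 n : convergent (0 : series R n) /\
  near0 (fun x => eval (0 : series R n) x = 0).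
Proof.
have [|? h] := @eval_poly n 0 0; first by move=> k; apply: approx0.
by split=> //; apply: near0_impl h => x; rewrite meval0.
Qed.

Lemma convergent_sum n p (F : 'I_p -> series R n) : (forall i, convergent (F i)) ->
  convergent (\sum_i F i) /\
  near0 (fun x => eval (\sum_i F i) x = \sum_i eval (F i) x).
Proof.
elim: p F => [|p IH] F h.
  rewrite big_ord0; have [? n0] := convergent0 n; split=> //.
  by apply: near0_impl n0 => x ->; rewrite big_ord0.
rewrite big_ord_recl; have [|c1 n1] := IH (fun i => F (lift ord0 i)); first by move=> i; apply: h.
have [c2 n2] := convergentD (h ord0) c1; split=> //.
by apply: near0_impl (near0_and n1 n2) => x [e1 e2]; rewrite e2 big_ord_recl e1.
Qed.

(** Halving the radius pays for the factor [(m i).+1], at most [2 ^+ mdeg m]. *)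
Lemma convergent_deriv n i (f : series R n) : convergent f -> convergent (pderiv i f).
Proof.
move=> [r [A [r0 h]]]; exists (r / 2), (A / r); split=> [|m]; first by rewrite divr_gt0.
have h1 : `|f (m + U_(i))%MM| * r ^+ mdeg m <= A / r.
  rewrite ler_pdivlMr // -mulrA -exprSr.
  by have := h (m + U_(i))%MM; rewrite mdegD mdeg1 addn1.
apply: le_trans h1; rewrite /pderiv normrMn -[_ *+ (m i).+1]mulr_natr -mulrA ler_wpM2l //.
rewrite exprMn exprVn mulrCA ler_piMr ?exprn_ge0 ?(ltW r0) //.
rewrite ler_pdivrMr ?exprn_gt0 // mul1r -natrX ler_nat.
apply: leq_trans (ltn_expl _ (ltnSn 1)); rewrite ltnS mdegE (bigD1 i) //= leq_addr //.
Qed.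

Lemma convergent_conj n (f : series R n) : convergent f -> convergent (pconj f).
Proof. by move=> [r [A [r0 h]]]; exists r, A; split=> // m; rewrite pconjE norm_conjC. Qed.

Lemma eval_conj n (f : series R n) : convergent f ->
  near0 (fun x => eval (pconj f) (conjp x) = (eval f x)^*).
Proof.
move=> cf; have [T [A [T0 A0 hf]]] := convergent_bnd cf.
have t0 : 0 < T / 2 by rewrite divr_gt0.
have tT : 2 * (T / 2) <= T by rewrite mulrC divfK ?pnatr_eq0.
have tr k : trunc (pconj f) k = map_mpoly Num.conj (trunc f k).
  apply/mpolyP => m; rewrite mcoeff_map_mpoly !mcoeff_trunc.
  by case: ifP => _; rewrite /= ?conjC0.
have hfc : bnd T A (pconj f).
  move=> k; apply: le_trans (hf k); apply: pn_mono; first exact: ltW.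
  by move=> m; rewrite tr mcoeff_map_mpoly norm_conjC.
apply: (near0_le t0) => x hx.
have hx' i : `|(conjp x) 0 i| <= T / 2 by rewrite mxE norm_conjC.
apply: (sums_to_unique (sums_to_eval T0 hfc tT hx' (ltW t0))) => e e0.
have [k0 hk] := sums_to_eval T0 hf tT hx (ltW t0) e0; exists k0 => k /hk.
rewrite tr -norm_conjC rmorphB /=; congr (`|_ - _| < _).
rewrite map_conjE mevalE rmorph_sum raddf_sum /=; apply: eq_bigr => m _.
rewrite mevalZ mevalX rmorphM rmorph_prod; congr (_ * _).
by apply: eq_bigr => i _; rewrite rmorphXn mxE.
Qed.

Lemma trunc0 n (f : series R n) : trunc f 0 = (f 0%MM)%:MP.
Proof.
apply/mpolyP => m; rewrite mcoeff_trunc mcoeffC leqn0 mdeg_eq0.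
by case: eqP => [->|]; rewrite ?mulr1 ?mulr0.
Qed.

Lemma convergent_psubst n p (f : series R p) (g : 'I_p -> series R n) :
    convergent f -> (forall i, convergent (g i)) -> centered g ->
  convergent (psubst f g) /\
  near0 (fun x => eval (psubst f g) x = eval f (evalv g x)).
Proof.
move=> /convergent_bnd[s [A [s0 A0 hf]]] cg g0.
have /choice[TB hTB] : forall i, exists TB : C * C,
    [/\ 0 < TB.1, 0 <= TB.2 & bnd TB.1 TB.2 (g i)].
  by move=> i; have [T [B ?]] := convergent_bnd (cg i); exists (T, B).
have [|T T0 hT] := @pos_min_fin _ (fun i => (TB i).1); first by move=> i; case: (hTB i).
pose B := \sum_i (TB i).2 + 1.
have B0 : 0 < B by rewrite ltr_wpDl // sumr_ge0 // => i _; case: (hTB i).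
have hg i : bnd T B (g i).
  have [_ b0 hb] := hTB i; apply: (@bnd_leA _ _ (TB i).2).
    rewrite /B (bigD1 i) //= -addrA lerDl addr_ge0 // sumr_ge0 // => j _.
    by case: (hTB j).
  exact: bnd_le (ltW T0) (hT i) hb.
(* Half the radius of [f], because [pn_lipschitz] doubles it. *)
pose tau := s / 2.
have tau0 : 0 < tau by rewrite divr_gt0.
(* By [pn_low] in order 1, the centered series [g i] have norm at most [t1 / T * B] at radius [t1];
   the last bound makes this at most [tau]. *)
have [t1 [t10 t1T t1B]] : exists t, [/\ 0 < t, t <= T & t <= tau / B * T].
  by apply: pos_min; rewrite ?mulr_gt0 ?invr_gt0.
have gb k i : pn t1 (trunc (g i) k) <= tau.
  have low : lowdeg 1 (trunc (g i) k).
    move=> m; rewrite ltnS leqn0 mdeg_eq0 => /eqP ->.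
    by rewrite mcoeff_trunc mdeg0 g0.
  apply: le_trans (pn_low (ltW t10) t1T T0 low) _; rewrite expr1.
  apply: (@le_trans _ _ (t1 / T * B)).
    by rewrite ler_wpM2l ?divr_ge0 ?(ltW t10) ?(ltW T0) ?hg.
  by rewrite -ler_pdivlMr // ler_pdivrMr.
pose P k := trunc f k \mPo [tuple trunc (g i) k | i < p].
have fP k : approx k (psubst f g) (P k) by apply: approx_psubst_trunc.
have ts : tau <= s by rewrite ler_pdivrMr // ler_peMr ?ler1n // ltW.
have Pb k : pn t1 (P k) <= A.
  apply: le_trans (hf k); apply: le_trans (pn_le_t _ (ltW tau0) ts).
  by apply: pn_comp => [|i]; rewrite ?(ltW t10) // tnth_mktuple.
split; first exact: (bnd_convergent t10 (bnd_approx t10 fP Pb)).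
have t0 : 0 < t1 / 2 by rewrite divr_gt0.
have tT : 2 * (t1 / 2) <= t1 by rewrite mulrC divfK ?pnatr_eq0.
have tle : t1 / 2 <= t1 by rewrite ler_pdivrMr // ler_peMr ?ler1n // ltW.
have tT2 : 2 * (t1 / 2) <= T by apply: le_trans t1T.
have tau2 : 2 * tau <= s by rewrite mulrC divfK ?pnatr_eq0.
apply: (near0_le t0) => x hx.
(* Three errors: the approximant of the composite, the variation of [trunc f k] between truncated
   and full arguments, and the Taylor remainder of [f]. *)
apply: (@eq_of_geometric _ _ _ (A + (B / tau * A + A))) => k.
apply: le_trans (ler_distD (P k).@[x 0] _ _) _.
rewrite mulrDl; apply: lerD; first exact: (eval_approx t10 fP Pb tT hx (ltW t0)).
have -> : (P k).@[x 0] = (trunc f k).@[fun i => (trunc (g i) k).@[x 0]].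
  by rewrite comp_mpoly_meval; apply: meval_eq => i; rewrite tnth_mktuple.
set y := evalv g x.
have hy i : `|y 0 i| <= tau.
  have := eval_taylor T0 (hg i) tT2 hx (ltW t0) 0.
  rewrite trunc0 g0 mpolyC0 meval0 subr0 expr1 mxE => /le_trans; apply.
  rewrite mulrC -ler_pdivlMr // ler_pdivrMr //.
  exact: le_trans tle t1B.
have hyk i : `|(trunc (g i) k).@[x 0]| <= tau.
  apply: le_trans (gb k i); apply: le_trans (pn_le_t _ (ltW t0) tle).
  exact: pn_eval.
apply: le_trans (ler_distD (trunc f k).@[y 0] _ _) _.
rewrite mulrDl; apply: lerD; last first.
  rewrite distrC; apply: le_trans (half_powS _ A0).
  exact: (eval_taylor2 s0 hf tau2 hy (ltW tau0)).
have d0 : 0 <= B / 2 ^+ k by rewrite divr_ge0 ?exprn_ge0 ?(ltW B0).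
have hd i : `|(trunc (g i) k).@[x 0] - y 0 i| <= B / 2 ^+ k.
  rewrite mxE distrC; apply: le_trans (half_powS _ (ltW B0)).
  exact: (eval_taylor2 T0 (hg i) tT2 hx (ltW t0)).
apply: le_trans (pn_lipschitz (trunc f k) tau0 d0 hyk hy hd) _.
have -> : B / tau * A / 2 ^+ k = B / 2 ^+ k / tau * A.
  by rewrite mulrAC; congr (_ * _); rewrite mulrAC.
apply: ler_wpM2l; first by apply: divr_ge0; [exact: d0 | exact: ltW].
apply: le_trans (hf k); apply: pn_le_t tau2.
by rewrite mulr_ge0 ?(ltW tau0).
Qed.

End NearZero.

(** * Normal coordinates and complexification *)

Section Directional.
Variable C : numFieldType.
Implicit Types n : nat.

Lemma meval_at0 n (p : {mpoly C[n]}) : p.@[fun=> 0] = p@_0%MM.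
Proof.
rewrite mevalE (eq_bigr (fun m => p@_m * ('X_[m])@_0%MM)) => [|m _].
  by rewrite [p in RHS]mpolyE linear_sum /=; apply: eq_bigr => m _; rewrite mcoeffZ.
rewrite mcoeffX; congr (_ * _); case: eqP => [->|/eqP m0].
  by rewrite big1 // => i _; rewrite mnm0E expr0.
have [i [a ->]] := mnm_neq0P m0.
by rewrite (bigD1 i) //= mnmDE mnm1E eqxx addn1 exprS !mul0r.
Qed.

Lemma poly_nat_roots (r : {poly C}) : (forall a : nat, r.[a%:R] = 0) -> r = 0.
Proof.
move=> h; apply/eqP/negPn/negP => r0.
have := max_poly_roots (rs := [seq i%:R : C | i <- iota 0 (size r)]) r0.
rewrite size_map size_iota ltnn => h'; suff : false by []; apply: h'.
  by apply/allP => _ /mapP[i _ ->]; apply/rootP.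
by rewrite map_inj_uniq ?iota_uniq // => i j /eqP; rewrite eqr_nat => /eqP.
Qed.

(** On the line, [p] is a polynomial in one variable with every natural number as a root, hence 0,
    and its linear coefficient is the directional derivative. *)
Lemma directional_deriv0 n (p : {mpoly C[n]}) (x v : 'I_n -> C) :
    (forall a : nat, p.@[fun i => x i + a%:R * v i] = 0) ->
  \sum_i (p^`M(i)).@[x] * v i = 0.
Proof.
move=> h; pose G := [tuple (x i)%:MP + v i *: 'X_(ord0 : 'I_1) | i < n].
pose q := p \mPo G.
have qe (a : C) : q.@[fun=> a] = p.@[fun i => x i + a * v i].
  rewrite comp_mpoly_meval; apply: meval_eq => i.
  by rewrite tnth_mktuple mevalD mevalC mevalZ mevalXU mulrC.
pose r : {poly C} := \sum_(m <- msupp q) q@_m *: 'X^(m ord0).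
have re a : r.[a] = q.@[fun=> a].
  rewrite mevalE horner_sum; apply: eq_bigr => m _.
  by rewrite hornerZ hornerXn big_ord1.
have r0 : r = 0 by apply: poly_nat_roots => a; rewrite re qe h.
have q1 : q@_(U_(ord0)) = 0.
  have <- : r`_1 = q@_(U_(ord0)); last by rewrite r0 coef0.
  rewrite coef_sum [RHS](_ : _ = \sum_(m <- msupp q) q@_m * ('X_[m])@_(U_(ord0))).
    apply: eq_bigr => m _; rewrite coefZ coefXn mcoeffX; congr (_ * _).
    congr (nat_of_bool _)%:R; apply/eqP/eqP => [e|->]; last by rewrite mnm1E eqxx.
    by apply/mnmP => i; rewrite ord1 mnm1E eqxx -e.
  by rewrite {1}[q]mpolyE linear_sum /=; apply: eq_bigr => m _; rewrite mcoeffZ.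
have : (q^`M(ord0)).@[fun=> 0] = 0.
  by rewrite meval_at0 mcoeff_deriv add0m q1 mul0rn.
move=> e; rewrite -[RHS]e mderiv_comp raddf_sum /=; apply: eq_bigr => i _.
rewrite mevalM comp_mpoly_meval tnth_mktuple; congr (_ * _).
  by apply: meval_eq => j; rewrite tnth_mktuple mevalD mevalC mevalZ mevalXU mulr0 addr0.
rewrite mderivD mderivC add0r mderivZ mevalZ mderivX mnm1E eqxx scale1r mevalX.
by rewrite big1 ?mulr1 // => j _; rewrite mnmBE subnn expr0.
Qed.

End Directional.

Section PolyTaylor.
Variable R : realType.
Local Notation C := R[i].

Lemma mpoly_vanish n (V : ('I_n -> C) -> Prop) (p : {mpoly C[n]}) :
    V (fun=> 0) ->
    (forall (q : {mpoly C[n]}), (forall x, V x -> q.@[x] = 0) ->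
       forall i x, V x -> (q^`M(i)).@[x] = 0) ->
    (forall x, V x -> p.@[x] = 0) -> p = 0.
Proof.
move=> V0 hD p0; pose f : series R n := fun m => p@_m.
suff f0 : f = 0 by apply/mpolyP => m; rewrite mcoeff0; apply: (congr1 (@^~ m) f0).
apply: series_taylor0 => l.
have [q hq q0] : exists2 q : {mpoly C[n]}, pderivs l f = (fun m => q@_m) &
    (forall x, V x -> q.@[x] = 0).
  elim: l => [|i l [q hq q0]]; first by exists p.
  exists q^`M(i); last by move=> x; apply: hD.
  by rewrite /= hq; apply: funext => m; rewrite mcoeff_deriv.
by rewrite hq -meval_at0 q0.
Qed.

(** The real subspace [V] spans the whole space over C, so derivatives along [V] determine all
    complex partial derivatives, and the vanishing on [V] can be differentiated. *)
Lemma mpoly_totally_real n d (p : {mpoly C[(n + d) + n]}) :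
    (forall (z : 'I_n -> C) (s : 'I_d -> R),
      p.@[bcat (bcat z (fun k => (s k)%:C%C)) (fun i => (z i)^*)] = 0) -> p = 0.
Proof.
pose pt (z : 'I_n -> C) (s : 'I_d -> R) :=
  bcat (bcat z (fun k => (s k)%:C%C)) (fun i => (z i)^*).
pose V x := exists z s, x =1 pt z s.
move=> h; apply: (@mpoly_vanish _ V) => [|q q0 i x [z [s e]]|x [z [s e]]]; last first.
- by rewrite (meval_eq _ e) h.
- rewrite (meval_eq _ e).
  have bl (T : Type) a b (g : 'I_a -> T) (k : 'I_b -> T) j : bcat g k (lshift b j) = g j.
    by rewrite /bcat (unsplitK (inl j)).
  have br (T : Type) a b (g : 'I_a -> T) (k : 'I_b -> T) j : bcat g k (rshift a j) = k j.
    by rewrite /bcat (unsplitK (inr j)).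
  have dir z' s' : \sum_j (q^`M(j)).@[pt z s] * pt z' s' j = 0.
    apply: directional_deriv0 => a; apply: q0.
    exists (fun j => z j + a%:R * z' j), (fun j => s j + a%:R * s' j) => j.
    rewrite /pt -(splitK j); case: (split j) => {}j /=; last first.
      by rewrite !br rmorphD rmorphM /= conjC_nat.
    rewrite !bl -(splitK j); case: (split j) => {}j /=; first by rewrite !bl.
    by rewrite !br rmorphD rmorphM rmorph_nat.
  have dirE z' s' : \sum_j (q^`M(lshift n (lshift d j))).@[pt z s] * z' j
     + \sum_j (q^`M(lshift n (rshift n j))).@[pt z s] * (s' j)%:C%C
     + \sum_j (q^`M(rshift (n + d) j)).@[pt z s] * (z' j)^* = 0.
    rewrite -[RHS](dir z' s') !big_split_ord /=; congr (_ + _ + _);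
      by apply: eq_bigr => j _; rewrite /pt ?(bl, br).
  have dw k : (q^`M(lshift n (rshift n k))).@[pt z s] = 0.
    have := dirE (fun=> 0) (fun j => (j == k)%:R).
    rewrite [X in X + _ + _]big1 => [|j _]; last by rewrite mulr0.
    rewrite [X in _ + _ + X]big1 => [|j _]; last by rewrite conjC0 mulr0.
    rewrite add0r addr0 (bigD1 k) //= eqxx mulr1 big1 ?addr0 // => j /negbTE ->.
    by rewrite mulr0.
  have dz k (c : C) : (q^`M(lshift n (lshift d k))).@[pt z s] * c
      + (q^`M(rshift (n + d) k)).@[pt z s] * c^* = 0.
    have := dirE (fun j => (j == k)%:R * c) (fun=> 0).
    rewrite [X in _ + X + _]big1 => [|j _]; last by rewrite mulr0.
    rewrite addr0 (bigD1 k) //= [X in _ + X + _]big1 => [|j /negbTE ->]; last first.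
      by rewrite mul0r mulr0.
    rewrite [X in _ + _ + X](bigD1 k) //= [X in _ + _ + (_ + X)]big1 => [|j /negbTE ->]; last first.
      by rewrite mul0r conjC0 mulr0.
    by rewrite eqxx mul1r !addr0.
  have dz1 k : (q^`M(lshift n (lshift d k))).@[pt z s] = 0.
    (* The directions 1 and i give D + D' = 0 and D - D' = 0 for the derivatives in z_k and in
       chi_k. *)
    have a1 := dz k 1; have a2 := dz k 'i%R.
    rewrite conjC1 2!mulr1 in a1; rewrite conjCi mulrN -mulrBl in a2.
    move/eqP: a2; rewrite mulf_eq0 (negbTE (neq0Ci _)) orbF subr_eq0 => /eqP a2.
    move/eqP: a1; rewrite -a2 -mulr2n mulrn_eq0 /= => /eqP //.
  have dz2 k : (q^`M(rshift (n + d) k)).@[pt z s] = 0.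
    by have := dz k 1; rewrite conjC1 !mulr1 dz1 add0r.
  rewrite -(splitK i); case: (split i) => {}i /=; last exact: dz2.
  by rewrite -(splitK i); case: (split i) => {}i /=; [exact: dz1 | exact: dw].
exists (fun=> 0), (fun=> 0) => i; rewrite /pt /bcat.
by case: (split i) => // j; rewrite ?conjC0 //; case: (split j).
Qed.

End PolyTaylor.

Lemma bcatL (T : Type) a b (g : 'I_a -> T) (h : 'I_b -> T) j : bcat g h (lshift b j) = g j.
Proof. by rewrite /bcat (unsplitK (inl j)). Qed.

Lemma bcatR (T : Type) a b (g : 'I_a -> T) (h : 'I_b -> T) j : bcat g h (rshift a j) = h j.
Proof. by rewrite /bcat (unsplitK (inr j)). Qed.

Lemma bcatP (T : Type) a b (P : T -> Prop) (g : 'I_a -> T) (h : 'I_b -> T) :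
  (forall i, P (g i)) -> (forall i, P (h i)) -> forall i, P (bcat g h i).
Proof. by move=> hg hh i; rewrite /bcat; case: (split i). Qed.

Lemma bcat_map (T U : Type) a b (F : T -> U) (g : 'I_a -> T) (h : 'I_b -> T)
    (g' : 'I_a -> U) (h' : 'I_b -> U) :
  (forall i, F (g i) = g' i) -> (forall i, F (h i) = h' i) ->
  forall i, F (bcat g h i) = bcat g' h' i.
Proof. by move=> eg eh i; rewrite /bcat; case: (split i). Qed.

Lemma split_ordP a b (P : 'I_(a + b) -> Prop) :
  (forall i, P (lshift b i)) -> (forall i, P (rshift a i)) -> forall i, P i.
Proof. by move=> hl hr i; rewrite -(splitK i); case: (split i). Qed.

Lemma centered_bcat (R : realType) p a b (g : 'I_a -> series R p) (h : 'I_b -> series R p) :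
  centered g -> centered h -> centered (bcat g h).
Proof. by move=> hg hh i; rewrite /bcat; case: (split i). Qed.

(** * A holomorphic fixed-point equation *)

Section Contraction.
Variable R : realType.
Local Notation C := R[i].

Lemma le_of_geometric (a b B : C) : 0 <= B -> (forall k, a <= b + B / 2 ^+ k) -> a <= b.
Proof.
move=> B0 h; apply/ler_addgt0Pr => e e0; have [k hk] := half_pow_small e0 B0.
by apply: le_trans (h k) _; rewrite lerD2l ltW // hk.
Qed.

Variables (d : nat) (t : C) (psi : 'rV[C]_d -> 'I_d -> C) (s : 'I_d -> C).
Local Notation ball w := (forall i, `|(w : 'rV[C]_d) 0 i| <= t).
Hypotheses (t0 : 0 < t) (psi_le : forall w k, ball w -> `|psi w k| <= t).
Hypothesis psi_lip : forall w w' (e : C) k, ball w -> ball w' -> 0 <= e ->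
  (forall i, `|w 0 i - w' 0 i| <= e) -> `|psi w k - psi w' k| <= e.
Hypothesis s_le : forall k, `|s k| <= t / 2.

Let phi (w : 'rV[C]_d) : 'rV[C]_d := \row_k (s k - psi w k / 2).

Let half_norm (x : C) : `|x / 2| = `|x| / 2.
Proof. by rewrite normrM normfV normr_nat. Qed.

Let phi_ball w : ball w -> ball (phi w).
Proof.
move=> hw k; rewrite mxE (le_trans (ler_normB _ _)) // half_norm.
rewrite [t in _ <= t]splitr lerD // ler_pM2r ?invr_gt0 //; exact: psi_le.
Qed.

Let phi_lip w w' (e : C) : ball w -> ball w' -> 0 <= e ->
  (forall i, `|w 0 i - w' 0 i| <= e) -> forall i, `|phi w 0 i - phi w' 0 i| <= e / 2.
Proof.
move=> hw hw' e0 h i; rewrite !mxE opprB addrC addrA subrK -mulrBl half_norm.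
by rewrite ler_pM2r ?invr_gt0 // psi_lip // => j; rewrite distrC.
Qed.

(** Picard iteration from [s]: [phi] halves distances in the sup norm, so successive iterates differ
    by at most [t / 2 ^+ j]. *)
Lemma contraction_exists : exists w : 'rV[C]_d, ball w /\ forall k, w 0 k = s k - psi w k / 2.
Proof.
pose u := fix u j := if j is j'.+1 then phi (u j') else (\row_k s k : 'rV[C]_d).
have ub j : ball (u j).
  elim: j => [|j IH] /=; last exact: phi_ball.
  move=> i; rewrite mxE (le_trans (s_le i)) // ler_pdivrMr // ler_peMr ?ler1n //.
  exact: ltW.
have ud j : forall i, `|u j.+1 0 i - u j 0 i| <= t / 2 ^+ j.
  elim: j => [|j IH] i.
    rewrite !mxE addrAC subrr add0r normrN half_norm expr0 divr1.
    rewrite ler_pdivrMr // (le_trans (psi_le _ (ub 0%N))) // ler_peMr ?ler1n //.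
    exact: ltW.
  have tj : 0 <= t / 2 ^+ j by rewrite divr_ge0 ?exprn_ge0 // ltW.
  by rewrite exprSr invfM mulrA; apply: (phi_lip (ub j.+1) (ub j) tj IH).
have /choice[v hv] : forall i, exists v : C, forall j, `|u j 0 i - v| <= 4 * t / 2 ^+ j.
  by move=> i; apply: geometric_limit => j; apply: ud.
have t40 : 0 <= 4 * t by rewrite mulr_ge0 // ltW.
pose w : 'rV[C]_d := \row_i v i; exists w.
have wb : ball w.
  move=> i; rewrite mxE; apply: (le_of_geometric t40) => j.
  rewrite -[v i](subrK (u j 0 i)) addrC (le_trans (ler_normD _ _)) //.
  by apply: lerD; [exact: ub | rewrite distrC].
have uw j i : `|u j 0 i - w 0 i| <= 4 * t / 2 ^+ j by rewrite [w 0 i]mxE.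
split=> // k; have -> : s k - psi w k / 2 = phi w 0 k by rewrite [RHS]mxE.
apply: (@eq_of_geometric _ _ _ (4 * t + 4 * t)) => j.
apply: le_trans (ler_distD (u j.+1 0 k) _ _) _; rewrite mulrDl; apply: lerD.
  by rewrite distrC; apply: le_trans (uw j.+1 k) _; apply: half_powS.
have tj : 0 <= 4 * t / 2 ^+ j by rewrite divr_ge0 ?exprn_ge0.
apply: le_trans (phi_lip (ub j) wb tj (uw j) k) _.
by rewrite -mulrA -invfM -exprSr; apply: half_powS.
Qed.

Lemma contraction_unique (w w' : 'rV[C]_d) : ball w -> ball w' ->
  (forall k, w 0 k = s k - psi w k / 2) -> (forall k, w' 0 k = s k - psi w' k / 2) ->
  w = w'.
Proof.
move=> hw hw' e e'.
have ep : phi w = w by apply/rowP => k; rewrite mxE -e.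
have ep' : phi w' = w' by apply/rowP => k; rewrite mxE -e'.
have h j : forall i, `|w 0 i - w' 0 i| <= (t + t) / 2 ^+ j.
  elim: j => [|j IH] i.
    by rewrite expr0 divr1 (le_trans (ler_normB _ _)) // lerD.
  have tj : 0 <= (t + t) / 2 ^+ j by rewrite divr_ge0 ?exprn_ge0 // addr_ge0 // ltW.
  by have := phi_lip hw hw' tj IH i; rewrite ep ep' exprSr invfM mulrA.
by apply/rowP => i; apply: (@eq_of_geometric _ _ _ (t + t)) => j.
Qed.

End Contraction.

Section EvalLow.
Variable R : realType.
Local Notation C := R[i].

Lemma eval_low n (T A t : C) a (f : series R n) (x : 'rV[C]_n) : 0 < T -> bnd T A f ->
    (forall k, lowdeg a (trunc f k)) -> 2 * t <= T -> (forall i, `|x 0 i| <= t) -> 0 <= t ->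
  `|eval f x| <= A * (t / T) ^+ a.
Proof.
move=> T0 hf low tT hx t0; have A0 := bnd_ge0 T0 hf.
have tT1 : t <= T by apply: le_trans tT; rewrite mulr_natl mulr2n lerDl.
apply: (le_of_geometric A0) => k.
rewrite -(subrK (trunc f k).@[x 0] (eval f x)) addrC; apply: le_trans (ler_normD _ _) _.
apply: lerD.
  apply: le_trans (pn_eval _ hx) _; apply: le_trans (pn_low t0 tT1 T0 (low k)) _.
  by rewrite mulrC ler_wpM2r ?exprn_ge0 ?divr_ge0 ?(ltW T0).
by apply: le_trans (half_powS _ A0); apply: (eval_taylor2 T0 hf tT hx t0).
Qed.

(** [pn_lipschitz] doubles the radius, so the Schwarz factor is taken at [2 * t]. For [a = 2] the
    Lipschitz constant is O(t), which makes the fixed-point map contract. *)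
Lemma eval_low_lipschitz n (T A t e : C) a (f : series R n) (x y : 'rV[C]_n) :
    0 < T -> bnd T A f -> (forall k, lowdeg a (trunc f k)) -> 2 * t <= T -> 0 < t -> 0 <= e ->
    (forall i, `|x 0 i| <= t) -> (forall i, `|y 0 i| <= t) ->
    (forall i, `|x 0 i - y 0 i| <= e) ->
  `|eval f x - eval f y| <= e / t * (A * (2 * t / T) ^+ a).
Proof.
move=> T0 hf low tT t0 e0 hx hy he; have A0 := bnd_ge0 T0 hf.
have t20 : 0 <= 2 * t by rewrite mulr_ge0 // ltW.
apply: (@le_of_geometric _ _ _ (A + A)); first by rewrite addr_ge0.
move=> k; apply: le_trans (ler_distD (trunc f k).@[x 0] _ _) _.
rewrite [_ + (A + A) / _]addrC mulrDl -addrA; apply: lerD.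
  by apply: le_trans (half_powS _ A0); apply: (eval_taylor2 T0 hf tT hx (ltW t0)).
rewrite addrC; apply: le_trans (ler_distD (trunc f k).@[y 0] _ _) _; apply: lerD; last first.
  rewrite distrC.
  by apply: le_trans (half_powS _ A0); apply: (eval_taylor2 T0 hf tT hy (ltW t0)).
apply: le_trans (pn_lipschitz (trunc f k) t0 e0 hx hy he) _.
apply: ler_wpM2l; first by rewrite divr_ge0 // ltW.
apply: le_trans (pn_low t20 tT T0 (low k)) _.
by rewrite mulrC ler_wpM2r ?exprn_ge0 ?divr_ge0 ?(ltW T0).
Qed.

End EvalLow.

(** * Points of [M] in normal coordinates *)

Section NormalMap.
Variables (R : realType) (n d : nat) (Q : 'I_d -> series R (n + (n + d))).
Local Notation C := R[i].
Hypothesis normQ : normal_map Q.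

Definition qz (i : 'I_n) : 'I_(n + (n + d)) := lshift (n + d) i.
Definition qchi (i : 'I_n) : 'I_(n + (n + d)) := rshift n (lshift d i).
Definition qtau (i : 'I_d) : 'I_(n + (n + d)) := rshift n (rshift n i).

Lemma qindP (P : 'I_(n + (n + d)) -> Prop) :
  (forall i, P (qz i)) -> (forall i, P (qchi i)) -> (forall i, P (qtau i)) -> forall i, P i.
Proof. by move=> h1 h2 h3; apply: split_ordP => //; apply: split_ordP. Qed.

Lemma normal_convergent k : convergent (Q k).
Proof. by case: (normQ k). Qed.

Lemma normal_const k : Q k 0%MM = 0.
Proof.
case: (normQ k) => _ /(_ 0%MM) h _ _; move: h; rewrite psubst_const => ->; exact: var0.
Qed.

Let z i := pvar R (qz i).
Let chi i := pvar R (qchi i).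
Let tau i := pvar R (qtau i).
Let zero (i : 'I_n) := pzero R (n + (n + d)).

Lemma normal_z0 k : psubst (Q k) (bcat z (bcat zero tau)) = tau k.
Proof. by apply: funext => m; case: (normQ k) => _ h _ _; apply: h. Qed.
Lemma normal_chi0 k : psubst (Q k) (bcat zero (bcat chi tau)) = tau k.
Proof. by apply: funext => m; case: (normQ k) => _ _ h _; apply: h. Qed.
Lemma normal_invol k :
  psubst (Q k) (bcat z (bcat chi (fun l => psubst (pconj (Q l)) (bcat chi (bcat z tau)))))
  = tau k.
Proof. by apply: funext => m; case: (normQ k) => _ _ _ h; apply: h. Qed.

Lemma pderiv_psubst_coord (f : series R (n + (n + d))) g i0 :
    (forall i, g i = pvar R i \/ g i = 0) -> g i0 = pvar R i0 ->
  pderiv i0 (psubst f g) 0%MM = pderiv i0 f 0%MM.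
Proof.
move=> hg g0.
have cg : centered g by move=> i; case: (hg i) => ->; rewrite ?var0.
rewrite pderiv_psubst // sumE (bigD1 i0) //= big1 => [|i ne].
  by rewrite addr0 constM psubst_const g0 pderiv_var eqxx mulr1n const1 mulr1.
rewrite constM; case: (hg i) => ->; last by rewrite pderiv0 mulr0.
by rewrite pderiv_var eq_sym (negbTE ne) mulr0.
Qed.

(** Each coordinate survives in one of the two normality substitutions, both of which give [tau k];
    so [Q k] and [tau k] have the same linear part. *)
Lemma normal_deriv k i : pderiv i (Q k) 0%MM = pderiv i (tau k) 0%MM.
Proof.
pose g1 := bcat z (bcat zero tau); pose g2 := bcat zero (bcat chi tau).
have h1 j : g1 j = pvar R j \/ g1 j = 0.
  elim/qindP: j => j; rewrite /g1.
  - by left; rewrite bcatL.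
  - by right; rewrite bcatR bcatL.
  - by left; rewrite !bcatR.
have h2 j : g2 j = pvar R j \/ g2 j = 0.
  elim/qindP: j => j; rewrite /g2.
  - by right; rewrite bcatL.
  - by left; rewrite bcatR bcatL.
  - by left; rewrite !bcatR.
elim/qindP: i => i.
- by rewrite -(normal_z0 k) (pderiv_psubst_coord _ h1) // /g1 bcatL.
- by rewrite -(normal_chi0 k) (pderiv_psubst_coord _ h2) // /g2 bcatR bcatL.
- by rewrite -(normal_z0 k) (pderiv_psubst_coord _ h1) // /g1 !bcatR.
Qed.

Lemma normal_low k m : (mdeg m < 2)%N -> (Q k - tau k) m = 0.
Proof.
rewrite ltnS leq_eqVlt ltnS leqn0 mdeg_eq0 => /orP[/mdeg1P[i /eqP ->]|/eqP ->]; last first.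
  by rewrite addE oppE normal_const /tau var0 subrr.
have := normal_deriv k i; rewrite /pderiv !add0m !mnm0E !mulr1n addE oppE => ->.
by rewrite subrr.
Qed.

(** By normality this part of bar Q has order at least 2, the source of the smallness in
    [M_points]. *)
Definition hrem k := pconj (Q k) - tau k.

Lemma hrem_low k j : lowdeg 2 (trunc (hrem k) j).
Proof.
move=> m hm; rewrite mcoeff_trunc; case: ifP => // _.
have := normal_low k hm; rewrite /hrem /tau -{2}(pconj_var R (qtau k)) !addE !oppE !pconjE.
by rewrite -rmorphB /= => ->; rewrite conjC0.
Qed.

Lemma convergent_hrem k : convergent (hrem k) /\
  near0 (fun x => eval (pconj (Q k)) x = x 0 (qtau k) + eval (hrem k) x).
Proof.
have c1 := convergent_conj (normal_convergent k).
have [c2 n2] := convergent_var R (qtau k).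
have [c3 n3] := convergentM (proj1 (convergent_const (n + (n + d)) (-1 : C))) c2.
have e : hrem k = pconj (Q k) + pconst R _ (-1) * tau k.
  have -> : pconst R (n + (n + d)) (-1) = -1.
    by apply: funext => m; rewrite oppE oneE /pconst mulN1r.
  by rewrite mulN1r.
have [c4 n4] : convergent (hrem k) /\
    near0 (fun x => eval (hrem k) x = eval (pconj (Q k)) x + eval (pconst R _ (-1) * tau k) x).
  by rewrite e; exact: (convergentD c1 c3).
split; first exact: c4.
have [_ n5] := convergent_const (n + (n + d)) (-1 : C).
have := near0_and n2 (near0_and n3 (near0_and n4 n5)); apply: near0_impl.
by move=> x [a2 [a3 [-> a5]]]; rewrite a3 a2 a5 mulN1r addrC subrK.
Qed.

Let cpt (z w : 'rV[C]_n) (u : 'rV[C]_d) := row_mx z (row_mx w u).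

Let cptE z' w' u' :
  [/\ forall i, cpt z' w' u' 0 (qz i) = z' 0 i, forall i, cpt z' w' u' 0 (qchi i) = w' 0 i
    & forall i, cpt z' w' u' 0 (qtau i) = u' 0 i].
Proof. by split=> i; rewrite ?row_mxEl ?row_mxEr ?row_mxEl ?row_mxEr. Qed.

Let cpt_le (z' w' : 'rV[C]_n) (u' : 'rV[C]_d) (t : C) :
    (forall i, `|z' 0 i| <= t) -> (forall i, `|w' 0 i| <= t) ->
  (forall i, `|u' 0 i| <= t) -> forall i, `|cpt z' w' u' 0 i| <= t.
Proof. by case: (cptE z' w' u') => a b c h1 h2 h3; apply: qindP => i; rewrite ?a ?b ?c. Qed.

Let conj_cpt z' w' u' : conjp (cpt z' w' u') = cpt (conjp z') (conjp w') (conjp u').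
Proof. by rewrite /conjp /cpt !map_row_mx. Qed.

Let conjpK p (x : 'rV[C]_p) : conjp (conjp x) = x.
Proof. by apply/rowP => i; rewrite !mxE conjCK. Qed.

Let Qb z' w' u' : 'rV[C]_d := evalv (fun k => pconj (Q k)) (cpt z' w' u').

Lemma evalv_bcat p a b (g : 'I_a -> series R p) (h : 'I_b -> series R p) x :
  evalv (bcat g h) x = row_mx (evalv g x) (evalv h x).
Proof.
apply/rowP; apply: split_ordP => i; first by rewrite row_mxEl !mxE bcatL.
by rewrite row_mxEr !mxE bcatR.
Qed.

Let near_invol : near0 (fun x : 'rV[C]_(n + (n + d)) => forall k,
  eval (Q k) (cpt (lsubmx x) (lsubmx (rsubmx x))
     (Qb (lsubmx (rsubmx x)) (lsubmx x) (rsubmx (rsubmx x)))) = x 0 (qtau k)).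
Proof.
pose g1 : 'I_(n + (n + d)) -> series R (n + (n + d)) := bcat chi (bcat z tau).
have vv m (i : 'I_m) : convergent (pvar R i) := proj1 (convergent_var R i).
have cg1 : centered g1.
  by apply: centered_bcat => [i|]; [|apply: centered_bcat => i]; apply: var0.
have vg1 : forall i, convergent (g1 i).
  by apply: bcatP => [i|]; [|apply: bcatP => i]; apply: vv.
pose g2 := bcat z (bcat chi (fun l => psubst (pconj (Q l)) g1)).
have cb k : convergent (pconj (Q k)) by apply: convergent_conj; apply: normal_convergent.
have sb k := convergent_psubst (cb k) vg1 cg1.
have cg2 : centered g2.
  apply: centered_bcat => [i|]; first exact: var0.
  apply: centered_bcat => i; first exact: var0.
  by rewrite psubst_const pconjE normal_const rmorph0.
have vg2 : forall i, convergent (g2 i).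
  apply: bcatP => [i|]; first exact: vv.
  by apply: bcatP => i; [exact: vv | exact: (proj1 (sb _))].
have a0 := near0_forall (fun i => proj2 (convergent_var R i)).
have a1 := near0_forall (fun k => proj2 (sb k)).
have a2 := near0_forall (fun k => proj2 (convergent_psubst (normal_convergent k) vg2 cg2)).
have := near0_and (a0 _) (near0_and a1 a2); apply: near0_impl => x [e0 [e1 e2]] k.
have ez : evalv z x = lsubmx x by apply/rowP => i; rewrite !mxE e0.
have ec : evalv chi x = lsubmx (rsubmx x) by apply/rowP => i; rewrite !mxE e0.
have et : evalv tau x = rsubmx (rsubmx x) by apply/rowP => i; rewrite !mxE e0.
have e3 : evalv (fun l => psubst (pconj (Q l)) g1) x =
    Qb (lsubmx (rsubmx x)) (lsubmx x) (rsubmx (rsubmx x)).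
  by apply/rowP => l; rewrite [LHS]mxE e1 /g1 !evalv_bcat ez ec et [RHS]mxE.
by rewrite -[RHS]e0 -/(tau k) -(normal_invol k) e2 /g2 !evalv_bcat ez ec e3.
Qed.

Variable M : 'rV[C]_(n + d) -> Prop.
Hypothesis coordM : normal_coordinates M Q.

Lemma near_M : near0 (fun Z => M Z <->
  rsubmx Z = evalv Q (row_mx (lsubmx Z) (conjp Z))).
Proof.
have [_ [rho [_ _ _ _ hM] [e e0 he]]] := coordM.
have n1 : near0 (fun Z : 'rV[C]_(n + d) => forall i, `|Z 0 i| < e) by exists e.
have := near0_and hM n1; apply: near0_impl => Z [hZ Ze].
have {he} := he (row_mx Z (conjp Z)) _.
rewrite row_mxKl row_mxKr => he; rewrite hZ; apply: iff_sym; apply: he.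
by apply: split_ordP => i; rewrite ?row_mxEl ?row_mxEr ?mxE ?norm_conjC.
Qed.

(** The equation w = Q(z0, conj z0, conj w) of [M] is not holomorphic in w. Instead w = s - psi(w) /
    2 is solved, with psi the value of [hrem] at (conj z0, z0, w); uniqueness of its solution then
    shows that w lies on [M]. *)
Lemma M_points : exists T0 K : C, [/\ 0 < T0, 0 <= K &
  forall t (z0 : 'rV[C]_n) (s : 'I_d -> C), 0 < t -> t <= T0 ->
    (forall i, `|z0 0 i| <= t) -> (forall k, (s k)^* = s k) -> (forall k, `|s k| <= t / 2) ->
  exists w : 'rV[C]_d, [/\ M (row_mx z0 w), forall k, `|w 0 k| <= t,
    forall k, `|w 0 k - s k| <= K * t ^+ 2
    & conjp w = evalv (fun k => pconj (Q k)) (row_mx (conjp z0) (row_mx z0 w))]].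
Proof.
have /choice[TA hTA] : forall k, exists TA : C * C,
    [/\ 0 < TA.1, 0 <= TA.2 & bnd TA.1 TA.2 (hrem k)].
  move=> k; have [T [B ?]] := convergent_bnd (proj1 (convergent_hrem k)).
  by exists (T, B).
have [|T Tp hT] := @pos_min_fin R _ (fun k => (TA k).1); first by move=> k; case: (hTA k).
pose A := \sum_k (TA k).2 + 1.
have A0 : 0 < A by rewrite ltr_wpDl // sumr_ge0 // => k _; case: (hTA k).
have hb k : bnd T A (hrem k).
  have [_ b0 hb] := hTA k; apply: (@bnd_leA _ _ _ (TA k).2).
    rewrite /A (bigD1 k) //= -addrA lerDl addr_ge0 // sumr_ge0 // => j _.
    by case: (hTA j).
  exact: bnd_le (ltW Tp) (hT k) hb.
have n1 := near0_forall (fun k => proj2 (convergent_hrem k)).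
have n2 := near0_forall (fun k => eval_conj (normal_convergent k)).
have [e1 e10 H1] := near0_and n1 (near0_and n2 near_invol).
have [e2 e20 H2] := near_M.
have [c1 [c10 c1a c1b]] := pos_min e10 e20.
(* From 4 A t <= T^2 it follows that [psi] is 1-Lipschitz and at most t / 2 in size on the ball. *)
have cT : 0 < T ^+ 2 / (4 * A) by rewrite divr_gt0 ?exprn_gt0 ?mulr_gt0.
have T20 : 0 < T / 2 by rewrite divr_gt0.
have [c2 [c20 c2a c2b]] := pos_min cT T20.
have c120 : 0 < c1 / 2 by rewrite divr_gt0.
have [T0 [T00 T0a T0b]] := pos_min c120 c20.
exists T0, (A / T ^+ 2); split=> //; first by rewrite divr_ge0 ?exprn_ge0 ?ltW.
move=> t z0 s t0 tT0 hz sr hs.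
have tc1 : t < c1.
  apply: le_lt_trans (le_trans tT0 T0a) _.
  by rewrite ltr_pdivrMr // ltr_pMr // ltr1n.
have te1 : t < e1 := lt_le_trans tc1 c1a.
have te2 : t < e2 := lt_le_trans tc1 c1b.
have tT : 2 * t <= T.
  by rewrite mulrC -ler_pdivlMr // (le_trans tT0) // (le_trans T0b).
have tA : 4 * A * t <= T ^+ 2.
  by rewrite mulrC -ler_pdivlMr ?mulr_gt0 // (le_trans tT0) // (le_trans T0b).
have half (x : C) : 0 <= x -> x / 2 <= x.
  by move=> x0; rewrite ler_pdivrMr // ler_peMr ?ler1n.
have Tn : T ^+ 2 != 0 by rewrite expf_neq0 // lt0r_neq0.
have hz' i : `|conjp z0 0 i| <= t by rewrite mxE norm_conjC.
pose psi (w : 'rV[C]_d) k := eval (hrem k) (cpt (conjp z0) z0 w).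
have psiK (w : 'rV[C]_d) k : (forall i, `|w 0 i| <= t) -> `|psi w k| <= A / T ^+ 2 * t ^+ 2.
  move=> hw; have := eval_low Tp (hb k) (hrem_low k) tT (cpt_le hz' hz hw) (ltW t0).
  by rewrite expr_div_n mulrA mulrAC.
have Kt : A / T ^+ 2 * t ^+ 2 <= t / 2.
  have At : A * t / T ^+ 2 <= 2^-1.
    rewrite ler_pdivrMr ?exprn_gt0 // [2^-1 * _]mulrC ler_pdivlMr //.
    apply: le_trans tA; rewrite [A * t * 2]mulrC mulrA ler_wpM2r ?(ltW t0) //.
    by rewrite ler_wpM2r ?(ltW A0) // ler_nat.
  have -> : A / T ^+ 2 * t ^+ 2 = t * (A * t / T ^+ 2).
    by rewrite expr2 mulrA mulrC; congr (_ * _); rewrite mulrAC.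
  by rewrite ler_wpM2l // ltW.
have Kt' : A / T ^+ 2 * t ^+ 2 <= t by apply: le_trans Kt (half _ (ltW t0)).
have psi_le (w : 'rV[C]_d) k : (forall i, `|w 0 i| <= t) -> `|psi w k| <= t.
  by move=> hw; apply: le_trans (psiK _ _ hw) _.
have psi_lip (w w' : 'rV[C]_d) (e : C) k :
    (forall i, `|w 0 i| <= t) -> (forall i, `|w' 0 i| <= t) ->
    0 <= e -> (forall i, `|w 0 i - w' 0 i| <= e) -> `|psi w k - psi w' k| <= e.
  move=> hw hw' e0 he.
  have hd i : `|cpt (conjp z0) z0 w 0 i - cpt (conjp z0) z0 w' 0 i| <= e.
    case: (cptE (conjp z0) z0 w) (cptE (conjp z0) z0 w') => a b c [a' b' c'].
    by elim/qindP: i => i; rewrite ?a ?b ?c ?a' ?b' ?c' ?subrr ?normr0.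
  apply: le_trans (eval_low_lipschitz Tp (hb k) (hrem_low k) tT t0 e0 (cpt_le hz' hz hw)
    (cpt_le hz' hz hw') hd) _.
  rewrite expr_div_n.
  have -> : e / t * (A * ((2 * t) ^+ 2 / T ^+ 2)) = e * (4 * A * t / T ^+ 2).
    by have t1 := lt0r_neq0 t0; field; rewrite t1 lt0r_neq0.
  by rewrite ler_piMr // ler_pdivrMr ?exprn_gt0 // mul1r.
have [w [wb we]] := contraction_exists t0 psi_le psi_lip hs.
exists w.
have wst k : `|w 0 k - s k| <= A / T ^+ 2 * t ^+ 2.
  rewrite we addrAC subrr add0r normrN normrM normfV normr_nat.
  by apply: le_trans (half _ _) (psiK _ _ wb).
have small (x y : 'rV[C]_n) (v : 'rV[C]_d) :
    (forall i, `|x 0 i| <= t) -> (forall i, `|y 0 i| <= t) ->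
    (forall i, `|v 0 i| <= t) -> forall i, `|cpt x y v 0 i| < e1.
  by move=> h1 h2 h3 i; apply: le_lt_trans te1; apply: cpt_le.
have [q1 [_ _]] := H1 _ (small _ _ _ hz' hz wb).
have [_ [_ q3]] := H1 _ (small _ _ _ hz hz' wb).
(* The candidate for [conjp w]: the fixed-point equation says that [s] is the mean of [w] and
   [w']. *)
pose w' := Qb (conjp z0) z0 w.
have w'E k : w' 0 k = 2 * s k - w 0 k.
  rewrite mxE q1; case: (cptE (conjp z0) z0 w) => _ _ ->; rewrite -/(psi w k).
  have -> : psi w k = 2 * (s k - w 0 k).
    by rewrite we opprB addrCA subrr addr0 mulrC divfK ?pnatr_eq0.
  by move: (w 0 k) (s k) => b a; ring.
have w'b k : `|w' 0 k| <= t.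
  rewrite w'E mulr_natl mulr2n -addrA (le_trans (ler_normD _ _)) //.
  by rewrite [t in _ <= t]splitr lerD // distrC (le_trans (wst k)).
have cw'b k : `|conjp w' 0 k| <= t by rewrite mxE norm_conjC.
have [q4 [q5 _]] := H1 _ (small _ _ _ hz' hz cw'b).
have [_ [q6 _]] := H1 _ (small _ _ _ hz hz' w'b).
(* The involution identity, conjugated, gives bar Q(conj z0, z0, conj w') = conj w. As [s] is real,
   [conjp w'] solves the equation of [w]. *)
have fixw' k : conjp w' 0 k = s k - psi (conjp w') k / 2.
  have : eval (pconj (Q k)) (cpt (conjp z0) z0 (conjp w')) = (w 0 k)^*.
    have := q6 k; rewrite conj_cpt conjpK => ->; congr (_^*).
    have := q3 k; rewrite /cpt row_mxKl row_mxKr row_mxKl row_mxKr => ->.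
    by case: (cptE z0 (conjp z0) w).
  rewrite q4; case: (cptE (conjp z0) z0 (conjp w')) => _ _ ->; rewrite -/(psi _ k) => e.
  have -> : psi (conjp w') k = (w 0 k)^* - conjp w' 0 k by rewrite -e addrC addKr.
  rewrite mxE w'E rmorphB rmorphM rmorph_nat /= sr.
  by move: ((w 0 k)^*) (s k) => b a; field.
have ww' : w = conjp w' by apply: (contraction_unique t0 psi_lip wb cw'b we fixw').
have cw : conjp w = w' by rewrite ww' conjpK.
split=> //; apply/H2.
  by apply: split_ordP => i; rewrite ?row_mxEl ?row_mxEr; apply: le_lt_trans te2.
rewrite row_mxKl row_mxKr [conjp (row_mx _ _)]map_row_mx -/(conjp z0) -/(conjp w) cw.
apply/rowP => k; rewrite mxE.
have := q3 k; rewrite /cpt row_mxKl row_mxKr row_mxKl row_mxKr => ->.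
by case: (cptE z0 (conjp z0) w).
Qed.

End NormalMap.

(** * From vanishing on [M] to vanishing on its complexification *)

Section Complexification.
Variables (R : realType) (n d : nat) (Q : 'I_d -> series R (n + (n + d))).
Local Notation C := R[i].
Hypothesis normQ : normal_map Q.

(* The complexification of M is parametrized by (Z, chi), with
   tau = bar Q (chi, Z). *)
Definition parZ (i : 'I_(n + d)) : series R ((n + d) + n) := pvar R (lshift n i).
Definition parchi (i : 'I_n) : series R ((n + d) + n) := pvar R (rshift (n + d) i).
Definition parzeta : 'I_(n + d) -> series R ((n + d) + n) :=
  bcat parchi (fun k => psubst (pconj (Q k)) (bcat parchi parZ)).
Definition par : 'I_((n + d) + (n + d)) -> series R ((n + d) + n) := bcat parZ parzeta.

Lemma centered_parZ : centered parZ. Proof. by move=> i; apply: var0. Qed.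
Lemma centered_parchi : centered parchi. Proof. by move=> i; apply: var0. Qed.
Lemma centered_parchiZ : centered (bcat parchi parZ).
Proof. exact: (centered_bcat centered_parchi centered_parZ). Qed.
Lemma centered_parzeta : centered parzeta.
Proof.
apply: (centered_bcat centered_parchi) => k.
by rewrite psubst_const pconjE normal_const // rmorph0.
Qed.
Lemma centered_par : centered par.
Proof. exact: (centered_bcat centered_parZ centered_parzeta). Qed.

Lemma convergent_par : (forall i, convergent (par i)) /\
  near0 (fun x => evalv par x = row_mx (lsubmx x)
    (row_mx (rsubmx x) (evalv (fun k => pconj (Q k)) (row_mx (rsubmx x) (lsubmx x))))).
Proof.
have cZ i : convergent (parZ i) by apply: (proj1 (convergent_var _ _)).
have cc i : convergent (parchi i) by apply: (proj1 (convergent_var _ _)).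
have cg : forall i, convergent (bcat parchi parZ i) by apply: bcatP.
have cQ k : convergent (pconj (Q k)).
  by apply: convergent_conj; apply: normal_convergent.
have sQ k := convergent_psubst (cQ k) cg centered_parchiZ.
split.
  apply: bcatP => [//|]; apply: bcatP => [//|k]; exact: (proj1 (sQ k)).
have a0 := near0_forall (fun i => proj2 (convergent_var R i)).
have a1 := near0_forall (fun k => proj2 (sQ k)).
have := near0_and (a0 _) a1; apply: near0_impl => x [e0 e1].
have eZ : evalv parZ x = lsubmx x by apply/rowP => i; rewrite !mxE e0.
have ec : evalv parchi x = rsubmx x by apply/rowP => i; rewrite !mxE e0.
have e3 : evalv (fun k => psubst (pconj (Q k)) (bcat parchi parZ)) x =
    evalv (fun k => pconj (Q k)) (row_mx (rsubmx x) (lsubmx x)).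
  by apply/rowP => l; rewrite [LHS]mxE e1 evalv_bcat ec eZ [RHS]mxE.
by rewrite /par /parzeta !evalv_bcat eZ ec e3.
Qed.

Lemma meval_homog p k (P : {mpoly C[p]}) (a : C) (x : 'I_p -> C) :
    lowdeg k P -> (forall m, (k < mdeg m)%N -> P@_m = 0) ->
  P.@[fun i => a * x i] = a ^+ k * P.@[x].
Proof.
move=> low high; rewrite !mevalE mulr_sumr !big_seq.
apply: eq_bigr => m; rewrite mcoeff_msupp => hm.
have -> : k = mdeg m.
  apply/eqP; rewrite eqn_leq; apply/andP; split.
    by rewrite leqNgt; apply: contraNN hm => /low ->.
  by rewrite leqNgt; apply: contraNN hm => /high ->.
rewrite mulrCA; congr (_ * _); rewrite mdegE -prodrXr -big_split.
by apply: eq_bigr => i _; rewrite exprMn.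
Qed.

(** With t = [2 * tau * e], the left side adds the Taylor error and the displacement error of
    [complexification_identity]; the right side is e^k times O(e). *)
Lemma bound_scaling (A K T tau e : C) k : T != 0 ->
  A * (2 * tau * e / T) ^+ k.+1 + K * (2 * tau * e) * (A * (2 * (2 * tau * e) / T) ^+ k) =
  e ^+ k * ((A / T ^+ k.+1 + K * (A * (2 / T) ^+ k)) * (2 * tau) ^+ k.+1 * e).
Proof.
move=> hT; rewrite !exprMn !exprVn !exprS ?exprMn.
have : T ^+ k != 0 by rewrite expf_neq0.
by move: (T ^+ k) (e ^+ k) (tau ^+ k) (2 ^+ k) => a b c q ha; field; rewrite ha hT.
Qed.

Variable M : 'rV[C]_(n + d) -> Prop.
Hypothesis coordM : normal_coordinates M Q.

(** Scaling argument: at points of [M] within O(e^2) of e (z, s), the remainder and the displacement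
    both cost O(e^(k+1)), against e^k |P(z, s, conj z)| for the lowest term P. *)
Theorem complexification_identity (F : series R ((n + d) + (n + d))) :
    convergent F ->
    near0 (fun Z => M Z -> eval F (row_mx Z (conjp Z)) = 0) ->
  psubst F par = 0.
Proof.
move=> cF hF; have [cpar npar] := convergent_par.
have [cG nG] := convergent_psubst cF cpar centered_par.
set G := psubst F par in cG nG *.
apply: contrapT => /eqP G0; have [k [P0 Plow]] := series_neq0 G0.
set P := trunc G k in P0 Plow.
have Phigh m : (k < mdeg m)%N -> P@_m = 0 by move=> hm; rewrite mcoeff_trunc leqNgt hm.
move/eqP: P0; apply; apply: mpoly_totally_real => z s.
pose pt := bcat (bcat z (fun k => (s k)%:C%C)) (fun i => (z i)^*).
rewrite -/pt.
have [T [A [T0 A0 hG]]] := convergent_bnd cG.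
have [e1 e10 H1] := near0_and nG npar; have [e2 e20 H2] := hF.
have [T1 [K [T10 K0 HM]]] := M_points normQ coordM.
pose tau : C := 1 + (\sum_i `|z i| + \sum_k `|(s k)%:C%C : C|).
have sz : 0 <= \sum_i `|z i| by apply: sumr_ge0.
have ss : 0 <= \sum_k `|(s k)%:C%C : C| by apply: sumr_ge0.
have tau0 : 0 < tau by rewrite ltr_pwDl // addr_ge0.
have zt i : `|z i| <= tau.
  have h : `|z i| <= \sum_i `|z i| by rewrite (bigD1 i) //= lerDl sumr_ge0.
  by apply: le_trans h _; rewrite /tau addrCA lerDl addr_ge0.
have st i : `|(s i)%:C%C : C| <= tau.
  have h : `|(s i)%:C%C : C| <= \sum_k `|(s k)%:C%C : C|.
    by rewrite (bigD1 i) //= lerDl sumr_ge0.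
  by apply: le_trans h _; rewrite /tau addrA lerDr addr_ge0.
have [b1 [b10 b1a b1b]] := pos_min e10 e20.
have T20 : 0 < T / 2 by rewrite divr_gt0.
have [b2 [b20 b2a b2b]] := pos_min T10 T20.
have b120 : 0 < b1 / 2 by rewrite divr_gt0.
have [b3 [b30 b3a b3b]] := pos_min b120 b20.
pose e0 := b3 / (2 * tau).
have tau20 : 0 < 2 * tau by rewrite mulr_gt0.
have e00 : 0 < e0 by rewrite divr_gt0.
pose B := (A / T ^+ k.+1 + K * (A * (2 / T) ^+ k)) * (2 * tau) ^+ k.+1.
apply: (@eq_of_geometric _ _ _ (B * e0)) => j; rewrite subr0.
pose e := e0 / 2 ^+ j; have ep : 0 < e by rewrite divr_gt0 ?exprn_gt0.
have ee0 : e <= e0 by rewrite ler_pdivrMr ?exprn_gt0 // ler_peMr ?(ltW e00) // exprn_ege1 // ler1n.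
rewrite -mulrA -/e.
(* Twice the size of the scaled data, since [M_points] wants [s] in the half ball. *)
pose t := 2 * tau * e; have t0 : 0 < t by rewrite mulr_gt0.
have tb : t <= b3 by rewrite /t mulrC -ler_pdivlMr.
have et : e * tau <= t by rewrite /t mulrC -mulrA mulr_natl mulr2n lerDl mulr_ge0 // ltW.
have et2 : e * tau <= t / 2.
  have -> : t = e * tau * 2 by rewrite /t -mulrA mulrC [tau * e]mulrC.
  by rewrite mulfK ?pnatr_eq0.
have eP x : `|x| <= tau -> `|e * x| <= e * tau.
  by move=> hx; rewrite normrM (ger0_norm (ltW ep)) ler_wpM2l // ltW.
have ec : e^* = e by apply: geC0_conj; apply: ltW.
pose z0 : 'rV[C]_n := \row_i (e * z i).
have [||||w [Mw wt ws wc]] := HM t z0 (fun k => e * (s k)%:C%C) t0.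
- by apply: le_trans tb (le_trans b3b b2a).
- by move=> i; rewrite mxE (le_trans (eP _ (zt i))).
- move=> l; rewrite rmorphM /= ec; congr (_ * _); exact: conjc_real.
- by move=> l; rewrite (le_trans (eP _ (st l))).
pose x := row_mx (row_mx z0 w) (conjp z0).
have z0t i : `|z0 0 i| <= t by rewrite mxE (le_trans (eP _ (zt i))).
have Zt : forall i, `|row_mx z0 w 0 i| <= t.
  by apply: split_ordP => i; rewrite ?row_mxEl ?row_mxEr.
have xt : forall i, `|x 0 i| <= t.
  by apply: split_ordP => i; rewrite ?row_mxEl ?row_mxEr // mxE norm_conjC.
have tb1 : t < b1.
  by rewrite (le_lt_trans tb) // (le_lt_trans b3a) // ltr_pdivrMr // ltr_pMr // ltr1n.
have G0x : eval G x = 0.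
  have [|h1 h2] := H1 x; first by move=> i; rewrite (le_lt_trans (xt i)) // (lt_le_trans tb1).
  rewrite h1 h2 /x row_mxKl row_mxKr -wc.
  have -> : row_mx (conjp z0) (conjp w) = conjp (row_mx z0 w) by rewrite /conjp map_row_mx.
  by apply: H2 => // i; rewrite (le_lt_trans (Zt i)) // (lt_le_trans tb1).
have tT : 2 * t <= T by rewrite mulrC -ler_pdivlMr // (le_trans tb) // (le_trans b3b).
have h1 : `|P.@[x 0]| <= A * (t / T) ^+ k.+1.
  by have := eval_taylor T0 hG tT xt (ltW t0) k; rewrite G0x sub0r normrN.
have yt : forall i, `|e * pt i| <= t.
  rewrite /pt; apply: split_ordP => i; last first.
    by rewrite bcatR (le_trans (eP _ _)) // norm_conjC.
  rewrite bcatL; move: i; apply: split_ordP => i; rewrite ?bcatL ?bcatR (le_trans (eP _ _)) //.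
have xy : forall i, `|x 0 i - e * pt i| <= K * t ^+ 2.
  have Kt : 0 <= K * t ^+ 2 by rewrite mulr_ge0 ?exprn_ge0 // ltW.
  rewrite /pt /x; apply: split_ordP => i; last first.
    by rewrite bcatR row_mxEr !mxE rmorphM /= ec subrr normr0.
  rewrite bcatL row_mxEl; move: i; apply: split_ordP => i; rewrite ?bcatL ?bcatR.
    by rewrite row_mxEl mxE subrr normr0.
  by rewrite row_mxEr.
have h2 : `|P.@[x 0] - P.@[fun i => e * pt i]| <= K * t * (A * (2 * t / T) ^+ k).
  have Kt : 0 <= K * t ^+ 2 by rewrite mulr_ge0 ?exprn_ge0 // ltW.
  apply: le_trans (pn_lipschitz P t0 Kt xt yt xy) _.
  have -> : K * t ^+ 2 / t = K * t by rewrite expr2 mulrA mulfK ?lt0r_neq0.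
  apply: ler_wpM2l; first by rewrite mulr_ge0 // ltW.
  have t20 : 0 <= 2 * t by rewrite mulr_ge0 // ltW.
  apply: le_trans (pn_low t20 tT T0 Plow) _.
  by rewrite mulrC ler_wpM2r ?exprn_ge0 ?divr_ge0 ?(ltW T0) // hG.
have h3 : e ^+ k * `|P.@[pt]| <= A * (t / T) ^+ k.+1 + K * t * (A * (2 * t / T) ^+ k).
  rewrite -{1}(ger0_norm (exprn_ge0 k (ltW ep))) -normrM -meval_homog //.
  move: h1 h2; set a := P.@[x 0]; move: (P.@[fun i => e * pt i]) => b h1 h2.
  have -> : b = a - (a - b) by rewrite opprB addrC subrK.
  by apply: le_trans (ler_normB _ _) _; apply: lerD.
rewrite -(ler_pM2l (exprn_gt0 k ep)); apply: le_trans h3 _.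
rewrite le_eqVlt; apply/orP; left; apply/eqP.
exact: (bound_scaling _ _ _ _ _ (lt0r_neq0 T0)).
Qed.

End Complexification.

(** * The reflection identity *)

Lemma const_det (R : realType) n q (A : 'M[series R n]_q) :
  (\det A) 0%MM = \det (\matrix_(i, j) A i j 0%MM).
Proof.
rewrite /determinant sumE; apply: eq_bigr => s _; rewrite constM; congr (_ * _).
  by rewrite constX oppE const1.
apply: (big_rec2 (fun (x : series R n) y => x 0%MM = y)); first exact: const1.
by move=> i x y _ <-; rewrite constM mxE.
Qed.

Lemma pconst1 (R : realType) n : pconst R n 1 = 1.
Proof. by []. Qed.

Section JetSpan.
Variables (R : realType) (p q m : nat) (b : 'I_p -> series R q) (g : 'I_q -> series R m).
Hypothesis g0 : centered g.

(* The ideal generated by the derivatives of order at most k of the b_j,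
   evaluated along g. *)
Inductive jet_span (k : nat) : series R m -> Prop :=
| jet_gen j l : (size l <= k)%N -> jet_span k (psubst (pderivs l (b j)) g)
| jet_mul A G : jet_span k G -> jet_span k (A * G)
| jet_add G1 G2 : jet_span k G1 -> jet_span k G2 -> jet_span k (G1 + G2)
| jet_zero : jet_span k 0.

Lemma jet_opp k G : jet_span k G -> jet_span k (- G).
Proof. by rewrite -mulN1r; apply: jet_mul. Qed.

Lemma jet_sum k I (r : seq I) (F : I -> series R m) :
  (forall i, jet_span k (F i)) -> jet_span k (\sum_(i <- r) F i).
Proof. by move=> h; apply: big_ind => *; [apply: jet_zero | apply: jet_add | apply: h]. Qed.

Lemma jet_le k k' G : (k <= k')%N -> jet_span k G -> jet_span k' G.
Proof.
move=> kk'; elim=> [j l lk|A G' _ IH|G1 G2 _ h1 _ h2|].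
- by apply: jet_gen; apply: leq_trans kk'.
- exact: jet_mul.
- exact: jet_add.
- exact: jet_zero.
Qed.

(** Leibniz and chain rules: derivatives of coefficients remain coefficients, and a generator yields
    generators with one more derivative. *)
Lemma jet_deriv k i G : jet_span k G -> jet_span k.+1 (pderiv i G).
Proof.
elim=> [j l lk|A G' hG IH|G1 G2 _ h1 _ h2|].
- rewrite pderiv_psubst //; apply: jet_sum => a; rewrite mulrC; apply: jet_mul.
  by apply: (@jet_gen k.+1 j (a :: l)).
- rewrite pderivM; apply: jet_add; apply: jet_mul => //.
  exact: jet_le (leqnSn k) hG.
- by rewrite pderivD; apply: jet_add.
- by rewrite pderiv0; apply: jet_zero.
Qed.

Lemma jet_derivs k l G : jet_span k G -> jet_span (k + size l) (pderivs l G).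
Proof.
by move=> h; elim: l => [|i l IH] /=; rewrite ?addn0 // addnS; apply: jet_deriv.
Qed.

Lemma jet_vanish r (s : 'I_m -> series R r) k G : centered s ->
    (forall j l, (size l <= k)%N ->
       psubst (pderivs l (b j)) (fun i => psubst (g i) s) = 0) ->
  jet_span k G -> psubst G s = 0.
Proof.
move=> s0 h; elim=> [j l lk|A G' _ IH|G1 G2 _ h1 _ h2|].
- by rewrite psubstA // h.
- by rewrite psubstM // IH mulr0.
- by rewrite psubstD // h1 h2 addr0.
- by rewrite psubst0.
Qed.

End JetSpan.

(** * The conjugate of a series in (Z, conj Z) *)

Section Swap.
Variables (R : realType) (N : nat).
Local Notation C := R[i].
Local Notation sw := (bcat (fun i => pvar R (rshift N i)) (fun i => pvar R (lshift N i))).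

(** The series bar F(zeta, Z), whose value on the diagonal zeta = conj Z is the conjugate of that of
    F. It makes real parts accessible to complexification. *)
Definition cswap (F : series R (N + N)) : series R (N + N) := psubst (pconj F) sw.

Lemma centered_sw : centered (sw : 'I_(N + N) -> series R (N + N)).
Proof. by apply: centered_bcat => i; apply: var0. Qed.

Lemma cswapM F G : cswap (F * G) = cswap F * cswap G.
Proof. by rewrite /cswap pconjM psubstM //; apply: centered_sw. Qed.

Lemma cswap_sum p (F : 'I_p -> series R (N + N)) :
  cswap (\sum_i F i) = \sum_i cswap (F i).
Proof. by rewrite /cswap pconj_sum psubst_sum //; apply: centered_sw. Qed.

Lemma cswap_Z (f : series R N) :
  cswap (psubst f (fun l => pvar R (lshift N l))) =
  psubst (pconj f) (fun l => pvar R (rshift N l)).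
Proof.
have c1 : centered (fun l : 'I_N => pvar R (lshift N l)) by move=> i; apply: var0.
rewrite /cswap (pconj_psubst _ c1) (psubstA _ (centered_conj c1) centered_sw).
congr psubst; apply: funext => i; rewrite pconj_var psubst_var; last exact: centered_sw.
by rewrite bcatL.
Qed.

Lemma near0_diag (P : 'rV[C]_(N + N) -> Prop) :
  near0 P -> near0 (fun Z => P (row_mx Z (conjp Z))).
Proof.
move=> [e e0 h]; exists e => // Z hZ; apply: h.
by apply: split_ordP => i; rewrite ?row_mxEl ?row_mxEr ?mxE ?norm_conjC.
Qed.

Lemma convergent_cswap F : convergent F -> convergent (cswap F) /\
  near0 (fun Z => eval (cswap F) (row_mx Z (conjp Z)) = (eval F (row_mx Z (conjp Z)))^*).
Proof.
move=> cF; have cs : forall i, convergent (sw i).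
  by apply: bcatP => i; apply: (proj1 (convergent_var _ _)).
have [c1 n1] := convergent_psubst (convergent_conj cF) cs centered_sw.
split=> //.
have := near0_forall (fun i => proj2 (convergent_var R i)) => n2.
have := near0_diag (near0_and n1 (near0_and (n2 _) (eval_conj cF))).
apply: near0_impl => Z [e1 [e2 e3]].
rewrite e1 -e3; congr eval; rewrite evalv_bcat.
have -> : conjp (row_mx Z (conjp Z)) = row_mx (conjp Z) Z.
  rewrite /conjp map_row_mx; congr row_mx; apply/rowP => i.
  by rewrite !mxE conjCK.
by congr row_mx; apply/rowP => i; rewrite mxE e2 ?row_mxEl ?row_mxEr.
Qed.

End Swap.

(** * Expressing alpha(Z) by derivatives of bar alpha(zeta) *)

Section BasicIdentity.
Variables (R : realType) (n d N' d' : nat).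
Variables (M : 'rV[R[i]]_(n + d) -> Prop) (M' : 'rV[R[i]]_N' -> Prop).
Variables (Q : 'I_d -> series R (n + (n + d))) (H : 'I_N' -> series R (n + d)).
Hypothesis coordM : normal_coordinates M Q.
Hypotheses (convH : forall j, convergent (H j)) (H0 : centered H).
Local Notation C := R[i].
Local Notation N := (n + d)%N.

Let normQ : normal_map Q := proj1 coordM.

Definition varZ (l : 'I_N) : series R (N + N) := pvar R (lshift N l).
Definition varzeta (l : 'I_N) : series R (N + N) := pvar R (rshift N l).
Definition Hpair : 'I_(N' + N') -> series R (N + N) :=
  bcat (fun i => psubst (H i) varZ) (fun i => psubst (pconj (H i)) varzeta).

Lemma centered_varZ : centered varZ. Proof. by move=> i; apply: var0. Qed.
Lemma centered_varzeta : centered varzeta. Proof. by move=> i; apply: var0. Qed.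
Lemma centered_Hpair : centered Hpair.
Proof.
apply: centered_bcat; first exact: (centered_psubst _ H0).
exact: (centered_psubst _ (centered_conj H0)).
Qed.

Lemma pullbackE r : pullback H r = psubst r Hpair. Proof. by []. Qed.

Lemma convergent_substZ (f : series R N) : convergent f -> convergent (psubst f varZ) /\
  near0 (fun X => eval (psubst f varZ) X = eval f (lsubmx X)).
Proof.
move=> cf; have cv i : convergent (varZ i) := proj1 (convergent_var R _).
have [c1 n1] := convergent_psubst cf cv centered_varZ; split; first exact: c1.
have n2 := near0_forall (fun i => proj2 (convergent_var R (lshift N i))).
have := near0_and n1 (n2 _); apply: near0_impl => X [-> e2]; congr eval.
by apply/rowP => i; rewrite !mxE e2.
Qed.

Lemma convergent_substzeta (f : series R N) : convergent f -> convergent (psubst f varzeta) /\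
  near0 (fun X => eval (psubst f varzeta) X = eval f (rsubmx X)).
Proof.
move=> cf; have cv i : convergent (varzeta i) := proj1 (convergent_var R _).
have [c1 n1] := convergent_psubst cf cv centered_varzeta; split; first exact: c1.
have n2 := near0_forall (fun i => proj2 (convergent_var R (rshift N i))).
have := near0_and n1 (n2 _); apply: near0_impl => X [-> e2]; congr eval.
by apply/rowP => i; rewrite !mxE e2.
Qed.

Lemma convergent_pullback (r : series R (N' + N')) : convergent r ->
  convergent (pullback H r) /\
  near0 (fun Z => eval (pullback H r) (row_mx Z (conjp Z)) =
                  eval r (row_mx (evalv H Z) (conjp (evalv H Z)))).
Proof.
move=> cr; rewrite pullbackE.
have cH : forall i, convergent (Hpair i).
  apply: bcatP => i; first exact: (proj1 (convergent_substZ (convH i))).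
  exact: (proj1 (convergent_substzeta (convergent_conj (convH i)))).
have [c1 n1] := convergent_psubst cr cH centered_Hpair; split; first exact: c1.
have n2 := near0_forall (fun i => proj2 (convergent_substZ (convH i))).
have n3 := near0_forall (fun i => proj2 (convergent_substzeta (convergent_conj (convH i)))).
have n4 := near0_forall (fun i => eval_conj (convH i)).
have := near0_and n4 (near0_diag (near0_and n1 (near0_and n2 n3))).
apply: near0_impl => Z [e4 [e1 [e2 e3]]]; rewrite e1; congr eval.
rewrite evalv_bcat; congr row_mx; apply/rowP => i.
  by rewrite [LHS]mxE e2 row_mxKl [RHS]mxE.
by rewrite [LHS]mxE e3 row_mxKr e4 [RHS]mxE [in RHS]mxE.
Qed.

Variable alpha : 'I_N' -> series R N.
Hypothesis defA : infinitesimal_deformation d' M M' H alpha.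

Let convA j : convergent (alpha j). Proof. by case: defA. Qed.

Definition deform_term (r : 'I_N' -> series R (N' + N')) : series R (N + N) :=
  \sum_j psubst (alpha j) varZ * pullback H (r j).

Let grad (rho : series R (N' + N')) j := pderiv (lshift N' j) rho.

Lemma defining_convergent rho : defining_function d' M' rho -> convergent rho.
Proof. by move=> [rh [k [[c _ _ _ _] ->]]]. Qed.

(** On the diagonal the series is twice the real part in the definition of a deformation, so it
    vanishes on [M]. *)
Lemma deformation_identity rho : defining_function d' M' rho ->
  psubst (deform_term (grad rho) + cswap (deform_term (grad rho))) (par Q) = 0.
Proof.
move=> hr; have cr := defining_convergent hr.
have ct j : convergent (psubst (alpha j) varZ * pullback H (grad rho j)) /\ near0 (fun Z =>
    eval (psubst (alpha j) varZ * pullback H (grad rho j)) (row_mx Z (conjp Z)) =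
    eval (alpha j) Z * eval (grad rho j) (row_mx (evalv H Z) (conjp (evalv H Z)))).
  have [c1 n1] := convergent_substZ (convA j).
  have [c2 n2] := convergent_pullback (convergent_deriv (lshift N' j) cr).
  have [c3 n3] := convergentM c1 c2; split; first exact: c3.
  have := near0_and n2 (near0_diag (near0_and n1 n3)); apply: near0_impl.
  by move=> Z [e2 [e1 e3]]; rewrite e3 e1 e2 row_mxKl.
have [c4 n4] := convergent_sum (fun j => proj1 (ct j)).
have [c5 n5] := convergent_cswap c4.
have [c6 n6] := convergentD c4 c5.
apply: (complexification_identity normQ coordM c6).
have n7 := near0_forall (fun j => proj2 (ct j)).
have [_ _ /(_ _ hr) n8] := defA.
have := near0_and n8 (near0_and n7 (near0_and n5 (near0_diag (near0_and n4 n6)))).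
apply: near0_impl => Z [e8 [e7 [e5 [e4 e6]]]] /e8; rewrite e6 e5 e4 ReE.
under eq_bigr do rewrite -e7.
by move/eqP; rewrite mulf_eq0 invr_eq0 pnatr_eq0 orbF => /eqP.
Qed.

Lemma psubst_varZ_par (f : series R N) :
  psubst (psubst f varZ) (par Q) = psubst f (@parZ R n d).
Proof.
rewrite (psubstA _ centered_varZ (centered_par normQ)); congr psubst.
apply: funext => i; rewrite psubst_var; last exact: centered_par.
by rewrite /par bcatL.
Qed.

Lemma psubst_varzeta_par (f : series R N) :
  psubst (psubst f varzeta) (par Q) = psubst f (parzeta Q).
Proof.
rewrite (psubstA _ centered_varzeta (centered_par normQ)); congr psubst.
apply: funext => i; rewrite psubst_var; last exact: centered_par.
by rewrite /par bcatR.
Qed.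

Definition abar j := pconj (alpha j).

Lemma deform_term_jet0 rho : defining_function d' M' rho ->
  jet_span abar (parzeta Q) 0 (psubst (deform_term (grad rho)) (par Q)).
Proof.
move=> hr; have := deformation_identity hr.
rewrite psubstD; last exact: centered_par.
move/eqP; rewrite addr_eq0 => /eqP ->; apply: jet_opp.
rewrite /deform_term cswap_sum psubst_sum; last exact: centered_par.
apply: jet_sum => j; rewrite cswapM cswap_Z psubstM; last exact: centered_par.
rewrite psubst_varzeta_par mulrC; apply: jet_mul.
exact: (@jet_gen _ _ _ _ abar (parzeta Q) 0 j [::]).
Qed.

Lemma pconstE m c (f : series R m) a : (pconst R m c * f) a = c * f a.
Proof.
rewrite -(@approxM _ _ _ _ _ _ (mdeg a) (@approx_const _ _ c _) (approx_trunc f _)) //.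
by rewrite mcoeffCM mcoeff_trunc leqnn.
Qed.

(** Complex combinations of the [rho] need not be real, but once the identity is a membership in an
    ideal, complex constants are harmless. *)
Lemma gradient_span_jet0 r : gradient_span d' M' r ->
  jet_span abar (parzeta Q) 0
    (\sum_j psubst (alpha j) (@parZ R n d) * psubst (pullback H (r j)) (par Q)).
Proof.
move=> [s [c [rho [hrho hr]]]].
have cp := centered_par normQ; have cH := centered_Hpair.
have er j : r j = \sum_i pconst R _ (c i) * grad (rho i) j.
  by apply: funext => m; rewrite hr sumE; apply: eq_bigr => i _; rewrite pconstE.
have -> : \sum_j psubst (alpha j) (@parZ R n d) * psubst (pullback H (r j)) (par Q) =
    \sum_i pconst R _ (c i) * psubst (deform_term (grad (rho i))) (par Q).
  under eq_bigr => j _.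
    rewrite er pullbackE psubst_sum // psubst_sum // mulr_sumr.
    over.
  rewrite exchange_big; apply: eq_bigr => i _.
  rewrite /deform_term psubst_sum // mulr_sumr; apply: eq_bigr => j _.
  rewrite (psubstM cp (psubst (alpha j) varZ) (pullback H (grad (rho i) j))).
  rewrite psubst_varZ_par !pullbackE.
  rewrite (psubstM cH (pconst R _ (c i)) (grad (rho i) j)) (psubstC cH).
  rewrite (psubstM cp (pconst R _ (c i)) (psubst (grad (rho i) j) Hpair)) (psubstC cp).
  exact: mulrCA.
by apply: jet_sum => i; apply: jet_mul; apply: deform_term_jet0.
Qed.

(** The parametrization straightens [L_j] into the derivative in chi_j: Z does not depend on chi,
    and differentiating tau = bar Q(chi, Z) yields the coefficients of [L_j]. *)
Lemma psubst_cr_field (f : series R (N + N)) j :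
  psubst (cr_field Q j f) (par Q) = pderiv (rshift N j) (psubst f (par Q)).
Proof.
have cp := centered_par normQ; have cz := @centered_parchiZ R n d.
set chi := fun i : 'I_n => pvar R (rshift N (lshift d i)).
have -> : cr_field Q j f = pderiv (rshift N (lshift d j)) f +
    \sum_(k < d) psubst (pderiv (lshift N j) (pconj (Q k))) (bcat chi varZ) *
      pderiv (rshift N (rshift n k)) f.
  by apply: funext => m; rewrite addE sumE.
rewrite (psubstD cp) (psubst_sum cp) (pderiv_psubst _ _ cp) [RHS]big_split_ord /=.
rewrite [X in _ = X + _]big1 ?add0r => [|i _]; last first.
  by rewrite /par bcatL /parZ pderiv_var eq_rlshift mulr0.
rewrite [RHS]big_split_ord /=; congr (_ + _).
  rewrite (bigD1 j) //= big1 => [|i ne].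
    by rewrite /par bcatR /parzeta bcatL /parchi pderiv_var eqxx mulr1 addr0.
  by rewrite /par bcatR /parzeta bcatL /parchi pderiv_var eq_rshift eq_sym (negbTE ne) mulr0.
apply: eq_bigr => k _; rewrite [LHS](psubstM cp) [RHS]mulrC.
suff -> : pderiv (rshift N j) (par Q (rshift N (rshift n k))) =
  psubst (psubst (pderiv (lshift N j) (pconj (Q k))) (bcat chi varZ)) (par Q) by [].
rewrite {1}/par bcatR {1}/parzeta bcatR (pderiv_psubst _ _ cz) (bigD1 (lshift N j)) //=.
rewrite big1 => [|i ne]; last first.
  move: i ne; apply: split_ordP => i ne.
    move: ne; rewrite bcatL /parchi pderiv_var eq_rshift eq_lshift eq_sym => /negbTE ->.
    by rewrite mulr0.
  by rewrite bcatR /parZ pderiv_var eq_rlshift mulr0.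
rewrite addr0 bcatL /parchi pderiv_var eqxx mulr1.
have cchi : centered chi by move=> i; apply: var0.
rewrite [RHS](psubstA _ (centered_bcat cchi centered_varZ) cp).
have -> // : (fun i => psubst (bcat chi varZ i) (par Q)) = bcat (@parchi R n d) (@parZ R n d).
apply: funext; apply: split_ordP => i.
  rewrite !bcatL (psubst_var cp (rshift N (lshift d i))) /par bcatR /parzeta bcatL.
  by [].
by rewrite !bcatR (psubst_var cp (lshift N i)) /par bcatL.
Qed.

Lemma psubst_cr_fields iota : exists l : seq 'I_n, size l = mdeg iota /\
  forall f, psubst (cr_fields Q iota f) (par Q) =
            pderivs (map (@rshift N n) l) (psubst f (par Q)).
Proof.
exists (flatten [seq nseq (iota j) j | j <- enum 'I_n]); split.
  rewrite size_flatten /shape -map_comp mdegE -big_enum /= sumnE big_map.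
  by apply: eq_bigr => i _; rewrite /= size_nseq.
move=> f; rewrite /cr_fields; elim: (enum 'I_n) => //= j r IH.
rewrite map_cat pderivs_cat -IH; elim: (iota j) => //= k IHk.
by rewrite psubst_cr_field IHk.
Qed.

(** Derivatives in chi pass over alpha(Z), which leaves a linear system for alpha(Z). The constant
    term of its determinant is nonzero by nondegeneracy, so the determinant is a unit of the series
    ring. *)
Theorem basic_identity k : nondegenerate_order d' Q M' H k ->
  forall j, jet_span abar (parzeta Q) k (psubst (alpha j) (@parZ R n d)).
Proof.
move=> [iota [r [hi hr hdet]]].
have cp := centered_par normQ.
pose A := \matrix_(l, j) cr_fields Q (iota l) (pullback H (r l j)) : 'M[series R (N + N)]_N'.
pose B := \matrix_(l, j) psubst (A l j) (par Q) : 'M[series R (N + n)]_N'.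
pose a := \col_j psubst (alpha j) (@parZ R n d).
have unitB : \det B \is a GRing.unit.
  apply: unit_const; rewrite -(psubst_det cp) psubst_const const_det.
  rewrite (_ : (\matrix_(i, j) A i j 0%MM) =
    \matrix_(l, j) cr_fields Q (iota l) (pullback H (r l j)) 0%MM) //.
  by apply/matrixP => l j; rewrite !mxE.
have dZ i f : pderiv (rshift N i) (psubst f (@parZ R n d)) = 0.
  rewrite pderiv_psubst; last exact: centered_parZ.
  by rewrite big1 // => l _; rewrite /parZ pderiv_var eq_rlshift mulr0.
have hB l : jet_span abar (parzeta Q) k ((B *m a) l 0).
  have [s [hs es]] := psubst_cr_fields (iota l).
  have := jet_derivs (centered_parzeta normQ) (map (@rshift N n) s) (gradient_span_jet0 (hr l)).
  rewrite add0n size_map hs => /(jet_le (hi l)).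
  congr jet_span; rewrite pderivs_sum mxE; apply: eq_bigr => j _.
  rewrite !mxE es mulrC; elim: s {hs es} => //= i s ->.
  by rewrite pderivM dZ mulr0 addr0.
move=> j.
have -> : psubst (alpha j) (@parZ R n d) =
    (\det B)^-1 * (\sum_l (\adj B) j l * (B *m a) l 0).
  have : ((\adj B *m B) *m a) j 0 = \det B * a j 0.
    by rewrite mul_adj_mx mul_scalar_mx mxE.
  rewrite -mulmxA mxE => ->; rewrite mulKr // mxE //.
by apply: jet_mul; apply: jet_sum => l; apply: jet_mul.
Qed.

End BasicIdentity.

(** * Segre maps *)

Section Segre.
Variables (R : realType) (n d : nat) (Q : 'I_d -> series R (n + (n + d))).
Local Notation C := R[i].
Local Notation N := (n + d)%N.
Hypothesis normQ : normal_map Q.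

Definition firstvar q (i : 'I_n) : series R (n + q * n) := pvar R (lshift (q * n) i).
Definition restvar q (i : 'I_(q * n)) : series R (n + q * n) := pvar R (rshift n i).
(* bar S^q (x_2, ..., x_(q+1)) *)
Definition segrebar q (i : 'I_N) : series R (n + q * n) :=
  psubst (pconj (segre Q q i)) (@restvar q).

Lemma centered_firstvar q : centered (@firstvar q).
Proof. by move=> i; apply: var0. Qed.
Lemma centered_restvar q : centered (@restvar q).
Proof. by move=> i; apply: var0. Qed.

Lemma centered_bcat_Q p (a : 'I_n -> series R p) (b : 'I_N -> series R p) k :
  psubst (Q k) (bcat a b) 0%MM = 0.
Proof. by rewrite psubst_const normal_const. Qed.

Lemma normal_z00 p (a : 'I_n -> series R p) k : centered a ->
  psubst (Q k) (bcat a (fun=> 0)) = 0.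
Proof.
move=> ca; pose g := bcat a (fun=> 0 : series R p) : 'I_(n + N) -> _.
have cg : centered g by apply: centered_bcat.
pose vz (i : 'I_n) := pvar R (qz d i); pose vt (i : 'I_d) := pvar R (qtau n i).
have /= := congr1 (fun f : series R (n + N) => psubst f g) (normal_z0 normQ k).
rewrite (psubst_var cg (qtau n k)) {2}/g /qtau !bcatR => h; rewrite -[RHS]h.
have c0 : centered (bcat vz (bcat (fun _ : 'I_n => pzero R (n + N)) vt)).
  apply: centered_bcat => [i|]; first exact: var0.
  by apply: centered_bcat => i; last exact: var0.
rewrite (psubstA _ c0 cg); congr psubst; apply: funext.
apply: qindP => i.
- by rewrite /qz !bcatL (psubst_var cg) /g bcatL.
- by rewrite /qchi !(bcatL, bcatR) (psubst0 cg).
- by rewrite /qtau !bcatR (psubst_var cg) /g !bcatR.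
Qed.

(** With the value 0 for S^0, the general recursion also covers S^1, because Q(x_1, 0, 0) = 0. *)
Lemma segre_succ q : segre Q q.+1 =
  bcat (@firstvar q) (fun k => psubst (Q k) (bcat (@firstvar q) (@segrebar q))).
Proof.
apply: funext; apply: split_ordP => i; first by rewrite /= !bcatL.
rewrite /= !bcatR; case: q => [|q] //=.
rewrite (_ : bcat _ _ = bcat (@firstvar 0) (fun=> 0)).
  by rewrite normal_z00 //; apply: centered_firstvar.
congr bcat; apply: funext => k; rewrite /segrebar /=.
have -> : pconj (pzero R (0 * n)) = 0 by rewrite -[RHS]pconj0.
by rewrite psubst0 //; apply: centered_restvar.
Qed.

Lemma centered_segre q : centered (segre Q q).
Proof.
case: q => [|q]; first by [].
rewrite segre_succ; apply: centered_bcat; first exact: centered_firstvar.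
by move=> k; apply: centered_bcat_Q.
Qed.

Lemma centered_segrebar q : centered (@segrebar q).
Proof. exact: (centered_psubst _ (centered_conj (@centered_segre q))). Qed.

(** The involution identity with conjugated coefficients and z, chi exchanged: w = Q(z, chi, tau)
    gives back tau = bar Q(chi, z, w). *)
Lemma normal_invol_conj p (x : 'I_n -> series R p) (chi : 'I_n -> series R p)
    (tau : 'I_d -> series R p) k :
    centered x -> centered chi -> centered tau ->
  psubst (pconj (Q k))
    (bcat chi (bcat x (fun l => psubst (Q l) (bcat x (bcat chi tau))))) = tau k.
Proof.
move=> cx cc ct.
pose vz i := pvar R (@qz n d i); pose vc i := pvar R (@qchi n d i).
pose vt i := pvar R (@qtau n d i).
have c1 : centered (bcat vc (bcat vz vt)).
  apply: centered_bcat => [i|]; first exact: var0.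
  by apply: centered_bcat => i; apply: var0.
pose G (F : 'I_d -> series R (n + N)) := bcat vz (bcat vc (fun l =>
  psubst (F l) (bcat vc (bcat vz vt)))).
have c2 (F : 'I_d -> series R (n + N)) : (forall k, F k 0%MM = 0) -> centered (G F).
  move=> F0; apply: centered_bcat => [i|]; first exact: var0.
  apply: centered_bcat => i; first exact: var0.
  by rewrite psubst_const F0.
have cQb l : pconj (Q l) 0%MM = 0 by rewrite pconjE normal_const // conjC0.
have Q0 l : Q l 0%MM = 0 by rewrite normal_const.
have e1 : psubst (pconj (Q k)) (G Q) = vt k.
  have := congr1 (@pconj R _) (normal_invol normQ k).
  rewrite pconj_var (pconj_psubst _ (c2 _ cQb)) => h; rewrite -[RHS]h.
  have pv (m : nat) (i : 'I_m) := pconj_var R i.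
  congr psubst; apply/esym/funext; apply: (bcat_map (F := @pconj R _)) => [i|]; first exact: pv.
  apply: (bcat_map (F := @pconj R _)) => i; first exact: pv.
  rewrite (pconj_psubst _ c1) pconjK; congr psubst; apply: funext.
  apply: (bcat_map (F := @pconj R _)) => [j|]; first exact: pv.
  by apply: (bcat_map (F := @pconj R _)) => j; exact: pv.
pose s : 'I_(n + N) -> series R p := bcat chi (bcat x tau).
have cs : centered s by apply: centered_bcat => //; apply: centered_bcat.
pose F (f : series R (n + N)) := psubst f s.
have sz i : F (vz i) = chi i by rewrite /F (psubst_var cs) /s /qz bcatL.
have sc i : F (vc i) = x i by rewrite /F (psubst_var cs) /s /qchi bcatR bcatL.
have st i : F (vt i) = tau i by rewrite /F (psubst_var cs) /s /qtau !bcatR.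
have := congr1 F e1; rewrite st {1}/F (psubstA _ (c2 _ Q0) cs) => h; rewrite -[RHS]h.
congr psubst; apply/esym/funext; apply: (bcat_map (F := F)) => [i|]; first exact: sz.
apply: (bcat_map (F := F)) => i; first exact: sc.
rewrite /F (psubstA _ c1 cs); congr psubst; apply: funext.
apply: (bcat_map (F := F)) => [j|]; first exact: sc.
by apply: (bcat_map (F := F)) => j; [exact: sz | exact: st].
Qed.

(** The parameters (Z, chi) of the point (S^(q+1), bar S^q) of the complexification; [segre_parzeta]
    recovers its tau. *)
Definition segre_par q : 'I_(N + n) -> series R (n + q * n) :=
  bcat (segre Q q.+1) (fun i => @segrebar q (lshift d i)).

Lemma centered_segre_par q : centered (@segre_par q).
Proof.
apply: centered_bcat; first exact: (@centered_segre q.+1).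
by move=> i; apply: centered_segrebar.
Qed.

Lemma segre_parZ q (f : series R N) :
  psubst (psubst f (@parZ R n d)) (@segre_par q) = psubst f (segre Q q.+1).
Proof.
rewrite (psubstA _ (@centered_parZ R n d) (@centered_segre_par q)); congr psubst.
apply: funext => i; rewrite /parZ (psubst_var (@centered_segre_par q)).
by rewrite /segre_par bcatL.
Qed.

Lemma segre_parzeta q i : psubst (parzeta Q i) (@segre_par q) = @segrebar q i.
Proof.
have cp := @centered_segre_par q.
move: i; apply: split_ordP => i.
  by rewrite /parzeta bcatL /parchi (psubst_var cp) /segre_par bcatR.
rewrite /parzeta bcatR (psubstA _ (@centered_parchiZ R n d) cp).
have eb : bcat (fun l => @segrebar q (lshift d l)) (fun l => @segrebar q (rshift n l)) =
    @segrebar q.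
  by apply: funext; apply: split_ordP => l; rewrite ?bcatL ?bcatR.
have := @normal_invol_conj _ (@firstvar q) (fun l => @segrebar q (lshift d l))
  (fun l => @segrebar q (rshift n l)) i (@centered_firstvar q).
rewrite eb => h; rewrite -[RHS]h; try by move=> l; apply: centered_segrebar.
congr psubst; apply: funext.
pose F (f : series R (N + n)) := psubst f (@segre_par q).
apply: (bcat_map (F := F)) => j.
  by rewrite /F /parchi (psubst_var cp) /segre_par bcatR.
have eZ : F (@parZ R n d j) = segre Q q.+1 j.
  by rewrite /F /parZ (psubst_var cp) /segre_par bcatL.
by rewrite eZ segre_succ.
Qed.

Lemma psubst_segrebar q (f : series R N) :
  psubst f (segre Q q) = 0 -> psubst (pconj f) (@segrebar q) = 0.
Proof.
move=> h.
rewrite -(psubstA _ (centered_conj (@centered_segre q)) (@centered_restvar q)).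
by rewrite -pconj_psubst ?h ?pconj0 ?psubst0 //; [exact: centered_restvar | exact: centered_segre].
Qed.

(** * Jets of a deformation along the Segre maps *)

Section Jets.
Variables (p : nat) (kappa : nat) (alpha : 'I_p -> series R N).
Hypothesis basic : forall j,
  jet_span (abar alpha) (parzeta Q) kappa (psubst (alpha j) (@parZ R n d)).

Let jet0 q m := forall j l, (size l <= m)%N -> psubst (pderivs l (alpha j)) (segre Q q) = 0.

(** Each derivative of alpha in Z costs one derivative of bar alpha beyond [kappa]; after pullback
    these are evaluated along bar S^q, where the conjugated hypothesis applies. *)
Lemma jet_step q m : jet0 q (m + kappa) -> jet0 q.+1 m.
Proof.
move=> h j l lm; have cZ := @centered_parZ R n d.
rewrite -segre_parZ.
have -> : psubst (pderivs l (alpha j)) (@parZ R n d) =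
    pderivs (map (@lshift N n) l) (psubst (alpha j) (@parZ R n d)).
  elim: l {lm} => //= i l <-; rewrite (pderiv_psubst _ _ cZ) (bigD1 i) //= big1 => [|a ne].
    by rewrite /parZ pderiv_var eqxx mulr1 addr0.
  by rewrite /parZ pderiv_var eq_lshift eq_sym (negbTE ne) mulr0.
have hs := jet_derivs (centered_parzeta normQ) (map (@lshift N n) l) (basic j).
apply: (jet_vanish (centered_parzeta normQ) (@centered_segre_par q) _ hs).
move=> a l'; rewrite size_map => hl'.
have -> : (fun i => psubst (parzeta Q i) (@segre_par q)) = @segrebar q.
  by apply: funext => i; apply: segre_parzeta.
rewrite /abar -pconj_derivs psubst_segrebar // h // (leq_trans hl') //.
by rewrite addnC leq_add2r.
Qed.

Lemma jet_vanish_segre t : (forall j m, (mdeg m <= t * kappa)%N -> alpha j m = 0) ->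
  forall j, psubst (alpha j) (segre Q t) = 0.
Proof.
(* S^0 has no variables, so the start of the induction is the jet at the origin. *)
move=> h; have h0 : jet0 0 (t * kappa).
  move=> j l hl; apply: funext => m; have -> : m = 0%MM by apply/mnmP => -[].
  by rewrite psubst_const (pderivs_jet (h j)).
have hq q : (q <= t)%N -> jet0 q ((t - q) * kappa).
  elim: q => [|q IH] hq; first by rewrite subn0.
  by apply: jet_step; rewrite addnC -mulSn subnSK //; apply: IH; apply: ltnW.
by move=> j; apply: (hq t (leqnn t) j [::]).
Qed.

End Jets.

End Segre.

(** * Generic ranks *)

Section EvalDet.
Variable R : realType.
Local Notation C := R[i].

Definition evaluates n (f : series R n) (phi : 'rV[C]_n -> C) :=
  convergent f /\ near0 (fun x => eval f x = phi x).

Lemma evaluatesD n (f g : series R n) phi psi : evaluates f phi -> evaluates g psi ->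
  evaluates (f + g) (fun x => phi x + psi x).
Proof.
move=> [c1 n1] [c2 n2]; have [c n3] := convergentD c1 c2; split; first exact: c.
by have := near0_and n1 (near0_and n2 n3); apply: near0_impl => x [<- [<- ->]].
Qed.

Lemma evaluatesM n (f g : series R n) phi psi : evaluates f phi -> evaluates g psi ->
  evaluates (f * g) (fun x => phi x * psi x).
Proof.
move=> [c1 n1] [c2 n2]; have [c n3] := convergentM c1 c2; split; first exact: c.
by have := near0_and n1 (near0_and n2 n3); apply: near0_impl => x [<- [<- ->]].
Qed.

Lemma evaluates_const n (c : C) : evaluates (pconst R n c) (fun=> c).
Proof. exact: convergent_const. Qed.

Lemma evaluates_sum n I (r : seq I) (F : I -> series R n) phi :
  (forall i, evaluates (F i) (phi i)) ->
  evaluates (\sum_(i <- r) F i) (fun x => \sum_(i <- r) phi i x).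
Proof.
move=> h; elim: r => [|i r IH].
  have [c0 n0] := convergent0 R n; rewrite big_nil; split; first exact: c0.
  by apply: near0_impl n0 => x ->; rewrite big_nil.
have [c1 n1] := evaluatesD (h i) IH; rewrite big_cons; split; first exact: c1.
by apply: near0_impl n1 => x ->; rewrite big_cons.
Qed.

Lemma evaluates_prod n I (r : seq I) (F : I -> series R n) phi :
  (forall i, evaluates (F i) (phi i)) ->
  evaluates (\prod_(i <- r) F i) (fun x => \prod_(i <- r) phi i x).
Proof.
move=> h; elim: r => [|i r IH].
  have [c0 n0] := evaluates_const n 1; rewrite big_nil; split; first exact: c0.
  by apply: near0_impl n0 => x; rewrite big_nil pconst1.
have [c1 n1] := evaluatesM (h i) IH; rewrite big_cons; split; first exact: c1.
by apply: near0_impl n1 => x ->; rewrite big_cons.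
Qed.

Lemma pconstX n (c : C) e : pconst R n c ^+ e = pconst R n (c ^+ e).
Proof.
elim: e => [|e IH]; first by rewrite !expr0 pconst1.
by rewrite !exprS IH; apply: funext => m; rewrite pconstE /pconst mulrA.
Qed.

Lemma pconstN1 n : pconst R n (-1) = -1.
Proof. by apply: funext => m; rewrite oppE oneE /pconst mulN1r. Qed.

Lemma evaluates_det n q (A : 'M[series R n]_q) : (forall i j, convergent (A i j)) ->
  evaluates (\det A) (fun x => \det (\matrix_(i, j) eval (A i j) x)).
Proof.
move=> cA; have hA i j : evaluates (A i j) (eval (A i j)).
  by split; [exact: cA | apply: near0_all].
have [c1 n1] : evaluates (\det A) (fun x => \sum_(s : 'S_q) (-1) ^+ s *
    \prod_i eval (A i (s i)) x).
  rewrite /determinant; apply: evaluates_sum => s; apply: evaluatesM.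
    by rewrite -pconstN1 pconstX; apply: evaluates_const.
  by apply: evaluates_prod => i; apply: hA.
split; first exact: c1.
apply: near0_impl n1 => x ->; rewrite /determinant; apply: eq_bigr => s _.
by congr (_ * _); apply: eq_bigr => i _; rewrite mxE.
Qed.

End EvalDet.

Section FullRank.
Variables (R : realType) (m p : nat) (S : 'I_p -> series R m).
Local Notation C := R[i].
Hypotheses (convS : forall i, convergent (S i)) (S0 : centered S).

Definition jacobian : 'M[series R m]_(p, m) := \matrix_(i, j) pderiv j (S i).

(** A minor that is 0 as a series has value 0 near 0; if all of them were, no point near 0 would
    have full rank. *)
Lemma generic_minor : generically_full_rank S ->
  exists g : 'I_p -> 'I_m, \det (colsub g jacobian) != 0.
Proof.
move=> hS; apply: contrapT => hno.
have hdet (g : {ffun 'I_p -> 'I_m}) :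
    near0 (fun x => \det (\matrix_(i, j) eval (colsub g jacobian i j) x) = 0).
  have cA i j : convergent (colsub g jacobian i j).
    by rewrite !mxE; apply: convergent_deriv.
  have [_ n1] := evaluates_det cA.
  have e0 : \det (colsub g jacobian) = 0.
    by apply/eqP/negPn/negP => h; apply: hno; exists g.
  have [_ n2] := convergent0 R m; rewrite e0 in n1.
  by have := near0_and n1 n2; apply: near0_impl => x [e1 e2]; exact: etrans (esym e1) e2.
(* One radius for all the finitely many choices of columns. *)
have [e e0 he] :=
  near0_forall (fun i => hdet (enum_val (i : 'I_#|{: {ffun 'I_p -> 'I_m}}|))).
case: hS => e1 e10 /(_ 0) h0; have [|y hy rk] := h0 _ e e0.
  by move=> i; rewrite mxE normr0.
set A := \matrix_(i, j) _ in rk.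
have hf : row_full A^T by rewrite /row_full mxrank_tr rk.
have := fullrowsub_unit hf; rewrite unitmxE unitfE.
set g := fullrankfun hf.
have hy0 i : `|y 0 i| < e by have := hy i; rewrite mxE subr0.
have := he y hy0 (enum_rank (finfun g)); rewrite enum_rankK => h.
suff e2 : (rowsub g A^T)^T = \matrix_(i, j) eval (colsub (finfun g) jacobian i j) y.
  by rewrite -det_tr e2 h eqxx.
apply/matrixP => i j; rewrite [LHS]mxE [rowsub _ _ _ _]mxE [A^T _ _]mxE [A _ _]mxE.
by rewrite [RHS]mxE [colsub _ _ _ _]mxE [jacobian _ _]mxE ffunE.
Qed.

End FullRank.

(** * Order of vanishing along a coordinate subspace *)

Section VanishingOrder.
Variables (R : realType) (p p' : nat) (iota : 'I_p' -> 'I_p) (eps : 'I_p -> series R p').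
Hypothesis eps0 : centered eps.
Hypothesis eps_deriv : forall a (g : series R p),
  psubst (pderiv (iota a) g) eps = pderiv a (psubst g eps).
Local Notation normal y := (forall a, y <> iota a).

(* g vanishes to order k along the coordinate subspace parametrized by eps, on
   which the variables outside of the range of iota are 0. *)
Fixpoint vanishes (k : nat) (g : series R p) : Prop :=
  if k is k'.+1 then psubst g eps = 0 /\ forall y, normal y -> vanishes k' (pderiv y g)
  else True.

Lemma vanishesS k g : vanishes k.+1 g -> vanishes k g.
Proof.
elim: k g => // k IH g [h0 h]; split; first exact: h0.
by move=> y hy; apply: IH; apply: h.
Qed.

Lemma vanishes0 k : vanishes k 0.
Proof.
elim: k => // k IH; split; first exact: (psubst0 eps0).
by move=> y _; rewrite pderiv0.
Qed.

Lemma vanishesD k f g : vanishes k f -> vanishes k g -> vanishes k (f + g).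
Proof.
elim: k f g => // k IH f g [f0 hf] [g0 hg]; split.
  by rewrite (psubstD eps0) f0 g0 addr0.
by move=> y hy; rewrite pderivD; apply: IH; [apply: hf | apply: hg].
Qed.

Lemma vanishesM k c g : vanishes k g -> vanishes k (c * g).
Proof.
elim: k c g => // k IH c g hg; have [g0 dg] := hg; split.
  by rewrite (psubstM eps0) g0 mulr0.
move=> y hy; rewrite pderivM; apply: vanishesD; apply: IH; last exact: dg.
exact: vanishesS hg.
Qed.

Lemma vanishes_sum k I (r : seq I) (F : I -> series R p) :
  (forall i, vanishes k (F i)) -> vanishes k (\sum_(i <- r) F i).
Proof.
by move=> h; apply: big_ind => *; [apply: vanishes0 | apply: vanishesD | apply: h].
Qed.

Lemma vanishes_deriv k a g : vanishes k g -> vanishes k (pderiv (iota a) g).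
Proof.
elim: k g => // k IH g [g0 dg]; split; first by rewrite eps_deriv g0 pderiv0.
by move=> y hy; rewrite pderiv_comm; apply: IH; apply: dg.
Qed.

(** Derivatives in the subspace directions keep the order and the others lower it by one; with
    infinite order, all iterated derivatives vanish at 0. *)
Lemma vanishes_all g : (forall k, vanishes k g) -> g = 0.
Proof.
move=> h; apply: series_taylor0 => l.
suff : forall k, vanishes k (pderivs l g).
  by move=> /(_ 1%N)[h1 _]; rewrite -(psubst_const _ eps) h1.
elim: l => [|y l IH] k; first exact: h.
have [[a ->]|hy] := pselect (exists a, y = iota a); first exact: vanishes_deriv (IH k).
by have [_] := IH k.+1; apply=> a e; apply: hy; exists a.
Qed.

(** On the subspace [delta] cancels in an integral domain. In the Leibniz rule the extra term is a
    multiple of [g], which is first shown to vanish to one order less. *)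
Lemma vanishes_divl k delta g : psubst delta eps != 0 ->
  vanishes k (delta * g) -> vanishes k g.
Proof.
move=> d0; elim: k g => // k IH g hdg; have [dg0 ddg] := hdg.
have hg : vanishes k g by apply: IH; apply: vanishesS hdg.
split.
  have /eqP : psubst delta eps * psubst g eps = 0.
    exact: etrans (esym (psubstM eps0 delta g)) dg0.
  rewrite mulf_eq0; case/orP => /eqP e; last exact: e.
  by case: (elimN eqP d0 e).
move=> y hy; apply: IH.
have -> : delta * pderiv y g = pderiv y (delta * g) + (-1) * (pderiv y delta * g).
  by rewrite pderivM mulN1r addrAC subrr add0r.
by apply: vanishesD; [apply: ddg | do 2!apply: vanishesM].
Qed.

(* delta need not be a unit: by vanishes_divl it cancels without any loss of
   vanishing order, since it does not vanish identically on the subspace. *)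
Lemma transport_unique (r : nat) (delta : series R p) (idx : 'I_r -> 'I_p')
    (c : 'I_p -> 'I_r -> series R p) (g : series R p) :
    psubst delta eps != 0 -> psubst g eps = 0 ->
    (forall y, delta * pderiv y g = \sum_b c y b * pderiv (iota (idx b)) g) ->
  g = 0.
Proof.
move=> d0 g0 hg; apply: vanishes_all; elim=> // k IH; split; first exact: g0.
move=> y _; apply: (vanishes_divl d0); rewrite hg; apply: vanishes_sum => b.
by apply: vanishesM; apply: vanishes_deriv.
Qed.

Lemma vanishes_derivs k g :
  (forall l : seq 'I_p, (forall y, y \in l -> normal y) -> psubst (pderivs l g) eps = 0) ->
  vanishes k g.
Proof.
elim: k g => // k IH g h; split; first exact: (h [::]).
move=> y hy; apply: IH => l hl; rewrite -pderivs_rcons; apply: h => z.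
by rewrite mem_rcons inE => /orP[/eqP ->|/hl].
Qed.

End VanishingOrder.

Section CoordinateProjection.
Variables (R : realType) (p p' : nat) (iota : 'I_p' -> 'I_p).
Variable eps : 'I_p -> series R p'.
Hypothesis eps_iota : forall a, eps (iota a) = pvar R a.
Hypothesis eps_out : forall y, (forall a, y <> iota a) -> eps y = 0.

Lemma centered_proj : centered eps.
Proof.
move=> y; have [[a ->]|hy] := pselect (exists a, y = iota a).
  by rewrite eps_iota var0.
by rewrite eps_out // => a e; apply: hy; exists a.
Qed.

Lemma proj_deriv a (g : series R p) :
  psubst (pderiv (iota a) g) eps = pderiv a (psubst g eps).
Proof.
rewrite (pderiv_psubst _ _ centered_proj) (bigD1 (iota a)) //= big1 => [|y ne].
  by rewrite eps_iota pderiv_var eqxx mulr1 addr0.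
have [[b e]|hy] := pselect (exists b, y = iota b); last first.
  by rewrite eps_out ?pderiv0 ?mulr0 // => b e; apply: hy; exists b.
rewrite e eps_iota pderiv_var; case: eqP => [ab|_]; last by rewrite mulr0.
by rewrite e ab eqxx in ne.
Qed.

End CoordinateProjection.

(** * Generic rank over the fraction field *)

Section FractionRank.
Variables (E : idomainType) (N p : nat) (J : 'M[E]_(N, p)).
Local Notation F := {fraction E}.
Local Notation toF := (@FracField.tofrac E).

Definition frank := \rank (map_mx toF J).

(** A transposed submatrix: its rows are indexed by the variables, as in the row spaces of
    [minor_relation]. *)
Definition minor r (f : 'I_r -> 'I_N) (g : 'I_r -> 'I_p) : 'M[E]_r :=
  \matrix_(b, a) J (f a) (g b).

Lemma minor_unit r (f : 'I_r -> 'I_N) (g : 'I_r -> 'I_p) :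
  (\det (minor f g) != 0) = (map_mx toF (minor f g) \in unitmx).
Proof. by rewrite unitmxE unitfE det_map_mx tofrac_eq0. Qed.

Lemma max_minor : exists (f : 'I_frank -> 'I_N) (g : 'I_frank -> 'I_p),
  \det (minor f g) != 0.
Proof.
rewrite /frank; set A := map_mx toF J.
have hf := maxrowsub_free A.
have hB : row_full (rowsub (maxrankfun A) A)^T by rewrite /row_full mxrank_tr.
exists (maxrankfun A), (fullrankfun hB); rewrite minor_unit.
suff -> : map_mx toF (minor (maxrankfun A) (fullrankfun hB)) =
  rowsub (fullrankfun hB) (rowsub (maxrankfun A) A)^T by apply: fullrowsub_unit.
by apply/matrixP => b a; rewrite !mxE.
Qed.

Lemma minor_rank r (f : 'I_r -> 'I_N) (g : 'I_r -> 'I_p) :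
  \det (minor f g) != 0 -> (r <= \rank (rowsub g (map_mx toF J)^T))%N.
Proof.
rewrite minor_unit => /mxrank_unit rk; rewrite -[X in (X <= _)%N]rk.
have -> : map_mx toF (minor f g) =
    rowsub g (map_mx toF J)^T *m \matrix_(i, a) (i == f a)%:R.
  apply/matrixP => b a; rewrite !mxE (bigD1 (f a)) //= !mxE eqxx mulr1 big1 ?addr0 //.
  by move=> i ne; rewrite !mxE (negbTE ne) mulr0.
exact: mxrankM_maxl.
Qed.

Lemma minor_le_frank r (f : 'I_r -> 'I_N) (g : 'I_r -> 'I_p) :
  \det (minor f g) != 0 -> (r <= frank)%N.
Proof.
move=> /minor_rank /leq_trans; apply; rewrite /frank -[X in (_ <= X)%N]mxrank_tr.
by apply: mxrankS; apply: rowsub_sub.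
Qed.

(* Cramer's rule. *)
Lemma minor_relation r (f : 'I_r -> 'I_N) (g : 'I_r -> 'I_p) :
    \det (minor f g) != 0 -> (frank <= r)%N ->
  forall y, exists c : 'I_r -> E,
    forall i, \det (minor f g) * J i y = \sum_b c b * J i (g b).
Proof.
move=> hd hr y; set A := map_mx toF J; set B := rowsub g A^T.
have BA : (B <= A^T)%MS by apply: rowsub_sub.
(* The rows selected by [g] already have the full rank, hence span all rows. *)
have AB : (A^T <= B)%MS.
  rewrite -(geq_leqif (mxrank_leqif_sup BA)) mxrank_tr.
  exact: leq_trans hr (minor_rank hd).
have /submxP[D eD] : (row y A^T <= B)%MS := submx_trans (row_sub _ _) AB.
pose c := (\row_a J (f a) y) *m \adj (minor f g).
exists (c 0) => i; apply/eqP; rewrite -tofrac_eq; apply/eqP.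
have ec : map_mx toF c = toF (\det (minor f g)) *: D.
  rewrite map_mxM map_mx_adj.
  have -> : map_mx toF (\row_a J (f a) y) = D *m map_mx toF (minor f g).
    apply/rowP => a; have /rowP/(_ (f a)) := eD; rewrite !mxE => ->.
    by apply: eq_bigr => b _; rewrite !mxE.
  by rewrite -mulmxA mul_mx_adj mul_mx_scalar det_map_mx.
have eDi : toF (J i y) = \sum_b D 0 b * toF (J i (g b)).
  by have /rowP/(_ i) := eD; rewrite !mxE => ->; apply: eq_bigr => b _; rewrite !mxE.
rewrite tofracM [RHS]rmorph_sum /= eDi mulr_sumr; apply: eq_bigr => b _.
rewrite tofracM mulrA; congr (_ * _).
by have /rowP/(_ b) := ec; rewrite [LHS]mxE [RHS]mxE => ->.
Qed.

End FractionRank.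

Section RankStable.
Variables (R : realType) (N p p' : nat).
Variables (S : 'I_N -> series R p') (S' : 'I_N -> series R p).
Variables (iota : 'I_p' -> 'I_p) (eps : 'I_p -> series R p').
Hypothesis eps_iota : forall a, eps (iota a) = pvar R a.
Hypothesis eps_out : forall y, (forall a, y <> iota a) -> eps y = 0.
Hypothesis S'0 : centered S'.
Hypothesis S'_eps : forall i, psubst (S' i) eps = S i.

Let eps0 := centered_proj eps_iota eps_out.

(** A maximal minor of [S] is the restriction of a minor of [S'] in the old variables. As the rank
    does not grow, Cramer's rule expresses all derivatives of f o S' by those in the old variables,
    and [transport_unique] concludes. *)
Lemma rank_stable (f : series R N) :
    (frank (jacobian S') <= frank (jacobian S))%N ->
  psubst f S = 0 -> psubst f S' = 0.
Proof.
move=> hr f0; have [f1 [g1 hd]] := max_minor (jacobian S).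
pose h1 b := iota (g1 b).
have ed : psubst (\det (minor (jacobian S') f1 h1)) eps = \det (minor (jacobian S) f1 g1).
  rewrite (psubst_det eps0); congr (\det _); apply/matrixP => b a.
  rewrite [LHS]mxE [RHS]mxE [minor _ _ _ _ _]mxE [jacobian S' _ _]mxE [jacobian S _ _]mxE.
  by rewrite (proj_deriv eps_iota eps_out) S'_eps.
have d0 : psubst (\det (minor (jacobian S') f1 h1)) eps != 0 by rewrite ed.
have hd' : \det (minor (jacobian S') f1 h1) != 0.
  by apply: contra_neq d0 => ->; apply: psubst0.
have /choice[c hc] := minor_relation hd' hr.
apply: (transport_unique eps0 (proj_deriv eps_iota eps_out) d0 (idx := g1) (c := c)).
  by rewrite (psubstA _ S'0 eps0) -[RHS]f0; congr psubst; apply: funext.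
move=> y; rewrite (pderiv_psubst _ _ S'0) mulr_sumr.
under eq_bigr => i _.
  rewrite mulrCA; have := hc y i; rewrite [jacobian S' i y]mxE => ->.
  rewrite mulr_sumr; over.
rewrite exchange_big; apply: eq_bigr => b _ /=.
rewrite (pderiv_psubst _ _ S'0) mulr_sumr; apply: eq_bigr => i _.
by rewrite [jacobian S' i _]mxE mulrCA.
Qed.

End RankStable.

(** * Ranks and kernels of the Segre maps *)

Section SegreRank.
Variables (R : realType) (n d : nat) (Q : 'I_d -> series R (n + (n + d))).
Local Notation N := (n + d)%N.
Hypothesis normQ : normal_map Q.

(** The recursion adds x_1 in front, yet S^q is S^(q+1) with the last block set to 0. Relative to
    S^q the new variables are the last [n], hence the widening instead of a shift. *)
Definition wid q (i : 'I_(q * n)) : 'I_(n + q * n) := widen_ord (leq_addl n (q * n)) i.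
Definition lastproj q (i : 'I_(n + q * n)) : series R (q * n) :=
  oapp (@pvar R (q * n)) 0 (insub (val i)).

Lemma lastproj_wid q a : lastproj (@wid q a) = pvar R a.
Proof. by rewrite /lastproj /= valK. Qed.

Lemma lastproj_out q y : (forall a, y <> @wid q a) -> lastproj y = 0.
Proof.
rewrite /lastproj; case: insubP => //= u _ e h.
by case: (h u); apply: val_inj.
Qed.

Lemma centered_lastproj q : centered (@lastproj q).
Proof. exact: (centered_proj (@lastproj_wid q) (@lastproj_out q)). Qed.

Lemma pconj_lastproj q i : pconj (@lastproj q i) = lastproj i.
Proof. by rewrite /lastproj; case: insub => [a|] /=; [apply: pconj_var | apply: pconj0]. Qed.

Lemma lastproj_rest q (l : 'I_(n + q * n)) :
  @lastproj q.+1 (rshift n l) = psubst (@lastproj q l) (@restvar R n q).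
Proof.
have cr := @centered_restvar R n q.
have [[a ->]|hl] := pselect (exists a, l = @wid q a).
  rewrite lastproj_wid (psubst_var cr).
  have -> : rshift n (wid a) = @wid q.+1 (rshift n a : 'I_(n + q * n)) by apply: val_inj.
  exact: lastproj_wid.
rewrite (@lastproj_out q l) => [|a e]; last by apply: hl; exists a.
rewrite (psubst0 cr); apply: lastproj_out => b /(congr1 val) /= e; apply: hl.
have lq : (l < q * n)%N by have := ltn_ord b; rewrite -e mulSn ltn_add2l.
by exists (Ordinal lq); apply: val_inj.
Qed.

(** The recursion carries the zero block down to S^1, whose value at 0 is the origin, that is,
    S^0. *)
Lemma lastproj_segre q k : psubst (segre Q q.+1 k) (@lastproj q) = segre Q q k.
Proof.
elim: q k => [|q IH] k.
  apply: funext => m; have -> : m = 0%MM by apply/mnmP => -[].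
  by rewrite psubst_const; apply: (centered_segre normQ 1).
have cl := @centered_lastproj q.+1; have cl' := @centered_lastproj q.
have cr := @centered_restvar R n q; have cr' := @centered_restvar R n q.+1.
rewrite (segre_succ normQ q.+1) (segre_succ normQ q); move: k.
pose F (f : series R (n + q.+1 * n)) := psubst f (@lastproj q.+1).
have ef i : F (@firstvar R n q.+1 i) = @firstvar R n q i.
  rewrite /F /firstvar (psubst_var cl).
  have -> : lshift (q.+1 * n) i = @wid q.+1 (lshift (q * n) i : 'I_(n + q * n)).
    exact: val_inj.
  exact: lastproj_wid.
have es j : F (segrebar Q (q := q.+1) j) = segrebar Q (q := q) j.
  have ei : pconj (segre Q q j) = psubst (pconj (segre Q q.+1 j)) (@lastproj q).
    rewrite -IH (pconj_psubst _ cl'); congr psubst; apply: funext.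
    exact: pconj_lastproj.
  have e1 : F (segrebar Q (q := q.+1) j) = psubst (pconj (segre Q q.+1 j))
      (fun l => psubst (@restvar R n q.+1 l) (@lastproj q.+1)).
    by rewrite /F /segrebar (psubstA _ cr' cl).
  have e2 : segrebar Q (q := q) j = psubst (pconj (segre Q q.+1 j))
      (fun l => psubst (@lastproj q l) (@restvar R n q)).
    by rewrite /segrebar ei; exact: (psubstA _ cl' cr).
  rewrite e1 e2; congr psubst; apply: funext => l.
  by rewrite -lastproj_rest /restvar (psubst_var cl).
apply: (bcat_map (F := F)) => k; first exact: ef.
have cX := centered_bcat (@centered_firstvar R n q.+1) (centered_segrebar normQ q.+1).
rewrite /F (psubstA _ cX cl); congr psubst; apply: funext.
by apply: (bcat_map (F := F)) => j; [exact: ef | exact: es].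
Qed.

Lemma frank_segre1 : (n <= frank (jacobian (segre Q 1)))%N.
Proof.
apply: (@minor_le_frank _ _ _ _ n (@lshift n d) (fun i => lshift (0 * n) i)).
rewrite (_ : minor _ _ _ = 1%:M) ?det1 ?oner_eq0 //.
apply/matrixP => b a; rewrite [LHS]mxE [RHS]mxE [jacobian _ _ _]mxE.
by rewrite (segre_succ normQ 0) bcatL /firstvar pderiv_var eq_lshift.
Qed.

Lemma segre_kernel_down q f : psubst f (segre Q q.+1) = 0 -> psubst f (segre Q q) = 0.
Proof.
move=> h; have cl := @centered_lastproj q.
have -> : segre Q q = fun k => psubst (segre Q q.+1 k) (@lastproj q).
  by apply: funext => k; rewrite lastproj_segre.
by rewrite -(psubstA _ (centered_segre normQ q.+1) cl) h (psubst0 cl).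
Qed.

Let vZ (i : 'I_n) : series R (n + N) := pvar R (lshift N i).
Let vzeta (i : 'I_N) : series R (n + N) := pvar R (rshift n i).
(** The part of f o S^(q+1) that does not depend on q; the dependence on q is all in [X q]. *)
Let Phi f := psubst f (bcat vZ (fun k => psubst (Q k) (bcat vZ vzeta))).
Let X q := bcat (@firstvar R n q) (segrebar Q (q := q)).
Let eps q : 'I_(n + q * n) -> series R (q * n) := bcat (fun=> 0) (@pvar R (q * n)).
Let bar0 : 'I_(n + N) -> series R N := bcat (fun=> 0) (@pvar R N).

Let cX q : centered (@X q).
Proof. exact: (centered_bcat (@centered_firstvar R n q) (centered_segrebar normQ q)). Qed.
Let ceps q : centered (@eps q).
Proof. by apply: centered_bcat => i //; apply: var0. Qed.
Let cbar0 : centered bar0.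
Proof. by apply: centered_bcat => i //; apply: var0. Qed.
Let cvv : centered (bcat vZ vzeta).
Proof. by apply: centered_bcat => i; apply: var0. Qed.

Let segre_Phi q f : psubst f (segre Q q.+1) = psubst (Phi f) (@X q).
Proof.
have cQ : centered (bcat vZ (fun k => psubst (Q k) (bcat vZ vzeta))).
  apply: centered_bcat => [i|k]; first exact: var0.
  by rewrite psubst_const normal_const.
rewrite /Phi (psubstA _ cQ (cX q)) (segre_succ normQ q); congr psubst.
apply/esym/funext; pose F (g : series R (n + N)) := psubst g (@X q).
have e1 i : F (vZ i) = @firstvar R n q i by rewrite /F (psubst_var (cX q)) /X bcatL.
have e2 i : F (vzeta i) = segrebar Q (q := q) i by rewrite /F (psubst_var (cX q)) /X bcatR.
apply: (bcat_map (F := F)) => k; first exact: e1.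
rewrite /F (psubstA _ cvv (cX q)); congr psubst; apply: funext.
by apply: (bcat_map (F := F)) => j; [exact: e1 | exact: e2].
Qed.

Let deriv_X q (l : seq 'I_n) (g : series R (n + N)) :
  pderivs (map (@lshift n (q * n)) l) (psubst g (@X q)) =
  psubst (pderivs (map (@lshift n N) l) g) (@X q).
Proof.
elim: l => [|i l IH]; first exact: erefl.
rewrite [LHS]/= IH [RHS]/=; move: (pderivs (map _ l) g) => h {IH g}.
apply: etrans (pderiv_psubst _ _ (cX q)) _; rewrite (bigD1 (lshift N i)) //=.
rewrite big1 => [|j]; last first.
  move: j; apply: split_ordP => j ne.
    rewrite /X bcatL /firstvar pderiv_var; case: eqP => [/lshift_inj e|_].
      by rewrite e eqxx in ne.
    exact: mulr0.
  rewrite /X bcatR /segrebar (pderiv_psubst _ _ (@centered_restvar R n q)) big1.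
    exact: mulr0.
  by move=> a _; rewrite /restvar pderiv_var eq_lrshift; apply: mulr0.
by rewrite addr0 /X bcatL /firstvar pderiv_var eqxx mulr1.
Qed.

(** Setting x_1 = 0 leaves a series along bar S^q; conjugating it gives one along S^q, to which
    hypotheses on kernels apply. *)
Let X_eps q (g : series R (n + N)) :
  psubst (psubst g (@X q)) (@eps q) = pconj (psubst (pconj (psubst g bar0)) (segre Q q)).
Proof.
have cs := centered_segre normQ q.
rewrite (pconj_psubst _ cs) pconjK (psubstA _ cbar0 (centered_conj cs)).
rewrite (psubstA _ (cX q) (@ceps q)); congr psubst; apply: funext => i.
apply: etrans (_ : bcat (fun=> 0) (fun j => pconj (segre Q q j)) i = _).
  move: i; pose F (h : series R (n + q * n)) := psubst h (@eps q).
  apply: (bcat_map (F := F)) => i.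
    by rewrite /F /firstvar (psubst_var (@ceps q)) /eps bcatL.
  have e : (fun l => psubst (@restvar R n q l) (@eps q)) = @pvar R (q * n).
    by apply: funext => l; rewrite /restvar (psubst_var (@ceps q)) /eps bcatR.
  by rewrite /F /segrebar (psubstA _ (@centered_restvar R n q) (@ceps q)) e psubst_id.
apply/esym; move: i; pose F (h : series R N) := psubst h (fun j => pconj (segre Q q j)).
apply: (bcat_map (F := F)) => i; rewrite /F; first exact: (psubst0 (centered_conj cs)).
exact: (psubst_var (centered_conj cs)).
Qed.

(** The x_1-coefficients of f o S^(q+2) are series derived from [Phi f], taken along bar S^(q+1).
    Along bar S^q they are the coefficients of f o S^(q+1) = 0, and the conjugated hypothesis lifts
    their vanishing. *)
Lemma segre_kernel_step q :
    (forall f, psubst f (segre Q q) = 0 -> psubst f (segre Q q.+1) = 0) ->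
  forall f, psubst f (segre Q q.+1) = 0 -> psubst f (segre Q q.+2) = 0.
Proof.
move=> H f; rewrite !segre_Phi => f0.
have eo (y : 'I_(n + q.+1 * n)) : (forall a, y <> rshift n a) -> @eps q.+1 y = 0.
  move: y; apply: split_ordP => i h; first by rewrite /eps bcatL.
  by case: (h i).
have ei a : @eps q.+1 (rshift n a) = pvar R a by rewrite /eps bcatR.
apply: (vanishes_all (proj_deriv ei eo)) => k.
apply: (vanishes_derivs (iota := @rshift n (q.+1 * n))) => l hl.
have [l' ->] : exists l', l = map (@lshift n (q.+1 * n)) l'.
  elim: l hl => [|y l IH] hl; first by exists [::].
  have [|l' ->] := IH; first by move=> z hz; apply: hl; rewrite inE hz orbT.
  have : forall a, y <> rshift n a by apply: hl; rewrite inE eqxx.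
  move: y {hl}; apply: split_ordP => i h; first by exists (i :: l').
  by case: (h i).
rewrite deriv_X X_eps H ?pconj0 //.
apply: (can_inj (@pconjK R _)); rewrite -X_eps -deriv_X f0 pderivs0 pconj0.
exact: (psubst0 (@ceps q)).
Qed.

Theorem segre_kernel t (f : series R N) :
    (forall g, psubst g (segre Q t) = 0 -> g = 0) ->
  psubst f (segre Q d.+1) = 0 -> f = 0.
Proof.
move=> ht f0.
have down a b g : (a <= b)%N -> psubst g (segre Q b) = 0 -> psubst g (segre Q a) = 0.
  move=> /subnK <-; elim: (b - a)%N => // k IH h; apply: IH.
  exact: segre_kernel_down.
pose rk q := frank (jacobian (segre Q q)).
(* Strict increase at every step would bring the rank of S^(d+2) to n + d + 1. *)
have [q [qd rq]] : exists q, (q <= d.+1)%N /\ (rk q.+1 <= rk q)%N.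
  apply: contrapT => h.
  have lt q : (q <= d.+1)%N -> (rk q < rk q.+1)%N.
    by move=> qd; rewrite ltnNge; apply/negP => ?; apply: h; exists q.
  have ge q : (q <= d.+1)%N -> (n + q <= rk q.+1)%N.
    elim: q => [|q IH] qd; first by rewrite addn0 frank_segre1.
    by rewrite addnS (leq_ltn_trans (IH (ltnW qd))) // lt.
  have := ge d.+1 (leqnn _); rewrite addnS ltnNge /rk /frank => /negP; apply.
  exact: rank_leq_row.
have up j g : psubst g (segre Q q) = 0 -> psubst g (segre Q (j + q)) = 0.
  (* Ranks are compared at [q] only; beyond it the inclusion of kernels propagates by itself. *)
  have step : forall j g, psubst g (segre Q (j + q)) = 0 -> psubst g (segre Q (j + q).+1) = 0.
    elim=> [|i IH] h; last exact: segre_kernel_step IH h.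
    apply: (rank_stable (@lastproj_wid q) (@lastproj_out q) (centered_segre normQ q.+1)) rq.
    exact: lastproj_segre.
  elim: j => // j IH h; rewrite addSn; apply: step; exact: IH.
(* [t + q] is above [t], where the kernel is trivial, and above [q], from which vanishing
   propagates. *)
apply: ht; apply: (down _ (t + q)%N); first exact: leq_addr.
by apply: up; apply: down f0.
Qed.

End SegreRank.

(** * Infinitesimal deformations *)

Section Deformation.
Variables (R : realType).
Local Notation C := R[i].

(** The gradient of f along S is annihilated by a Jacobian of full row rank over the fraction field,
    hence is 0. Iterating, all derivatives of f vanish along S, in particular at 0. *)
Lemma kernel_of_frank m p (S : 'I_p -> series R m) (f : series R p) :
  centered S -> (p <= frank (jacobian S))%N -> psubst f S = 0 -> f = 0.
Proof.
move=> S0 hp f0; apply: series_taylor0 => l; suff h : psubst (pderivs l f) S = 0.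
  by rewrite -(psubst_const _ S) h.
elim: l => [|i l]; first exact: f0.
rewrite [pderivs (i :: l) f]/=; move: (pderivs l f) => {f f0}f f0.
pose v := \row_a psubst (pderiv a f) S.
have vA : v *m jacobian S = 0.
  apply/rowP => j; have := congr1 (pderiv j) f0.
  rewrite (pderiv_psubst _ _ S0) pderiv0 => h; rewrite [RHS]mxE -[RHS]h mxE.
  by apply: eq_bigr => a _; rewrite !mxE.
have rf : row_free (map_mx (@FracField.tofrac _) (jacobian S)).
  by rewrite /row_free eqn_leq rank_leq_row.
have : map_mx (@FracField.tofrac _) v = 0.
  apply: (row_free_inj rf); rewrite mul0mx -map_mxM vA.
  by apply/matrixP => a b; rewrite !mxE rmorph0.
by move=> /rowP/(_ i); rewrite !mxE => /eqP; rewrite tofrac_eq0 => /eqP.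
Qed.

Section SegreKernel.
Variables (n d : nat) (Q : 'I_d -> series R (n + (n + d))).
Local Notation N := (n + d)%N.
Hypothesis normQ : normal_map Q.

Lemma convergent_segre q i : convergent (segre Q q i).
Proof.
elim: q i => [|q IH] i; first exact: (proj1 (convergent0 R _)).
rewrite (segre_succ normQ q).
have cf j : convergent (@firstvar R n q j) by exact: (proj1 (convergent_var _ _)).
move: i; apply: (bcatP (P := @convergent R _)) => [//|k].
apply: (proj1 (convergent_psubst (normal_convergent normQ k) _ _)); last first.
  exact: (centered_bcat (@centered_firstvar R n q) (centered_segrebar normQ q)).
apply: bcatP => [//|j].
apply: (proj1 (convergent_psubst (convergent_conj (IH j)) _ (@centered_restvar R n q))).
by move=> l; exact: (proj1 (convergent_var _ _)).
Qed.

Lemma generic_segre_kernel t : generically_full_rank (segre Q t) ->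
  forall g, psubst g (segre Q t) = 0 -> g = 0.
Proof.
move=> hr g; apply: (kernel_of_frank (centered_segre normQ t)).
have [h hd] := generic_minor (@convergent_segre t) hr.
apply: (@minor_le_frank _ _ _ _ _ id h).
rewrite (_ : minor _ _ _ = (colsub h (jacobian (segre Q t)))^T) ?det_tr //.
by apply/matrixP => a b; rewrite [LHS]mxE [RHS]mxE [colsub _ _ _ _]mxE.
Qed.

End SegreKernel.

(** * The real vector space of deformations and its dimension *)

Section Deformations.
Variables (N N' d' : nat).
Variables (M : 'rV[C]_N -> Prop) (M' : 'rV[C]_N' -> Prop) (H : 'I_N' -> series R N).
Local Notation deformation := (infinitesimal_deformation d' M M' H).

Lemma deformation0 : deformation (fun=> 0).
Proof.
split=> [j|//|rho hr]; first exact: (proj1 (convergent0 R N)).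
have := proj2 (convergent0 R N); apply: near0_impl => Z e0 _.
by rewrite big1 ?raddf0 // => j _; rewrite e0 mul0r.
Qed.

Lemma deformation_lin (a : R) alpha beta : deformation alpha -> deformation beta ->
  deformation (fun j => pconst R N (a%:C%C) * alpha j + beta j).
Proof.
move=> [ca a0 ha] [cb b0 hb]; have [cc nc] := convergent_const N (a%:C%C : C).
have h1 j := convergentM cc (ca j).
have h2 j := convergentD (proj1 (h1 j)) (cb j).
split=> [j|j|rho hr].
- exact: (proj1 (h2 j)).
- by rewrite addE constM a0 b0 mulr0 addr0.
have n1 := near0_forall (fun j => proj2 (h1 j)).
have n2 := near0_forall (fun j => proj2 (h2 j)).
have := near0_and nc (near0_and n1 (near0_and n2 (near0_and (ha _ hr) (hb _ hr)))).
apply: near0_impl => Z [e0 [e1 [e2 [ea eb]]]] MZ.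
under eq_bigr => j _ do rewrite e2 e1 e0 mulrDl -mulrA.
rewrite big_split /= raddfD /= eb // addr0 -mulr_sumr.
have ar : (a%:C%C : C) \is Num.real by apply/complex_realP; exists a.
by rewrite ReMl // ea // mulr0.
Qed.

Lemma deformation_sum D (c : 'I_D -> R) (b : 'I_D -> 'I_N' -> series R N) :
  (forall i, deformation (b i)) ->
  deformation (fun j => \sum_i pconst R N ((c i)%:C%C) * b i j).
Proof.
elim: D c b => [|D IH] c b hb.
  have -> : (fun j : 'I_N' => \sum_(i < 0) pconst R N ((c i)%:C%C) * b i j) = fun=> 0.
    by apply: funext => j; rewrite big_ord0.
  exact: deformation0.
have -> : (fun j => \sum_(i < D.+1) pconst R N ((c i)%:C%C) * b i j) =
    (fun j => pconst R N ((c ord0)%:C%C) * b ord0 j +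
       \sum_(i < D) pconst R N ((c (lift ord0 i))%:C%C) * b (lift ord0 i) j).
  by apply: funext => j; rewrite big_ord_recl.
by apply: deformation_lin => //; apply: IH.
Qed.

Definition vanishing_jet k :=
  forall alpha, deformation alpha -> (forall j m, (mdeg m <= k)%N -> alpha j m = 0) ->
  forall j, alpha j = 0.

Lemma deformationB alpha beta : deformation alpha -> deformation beta ->
  deformation (fun j => alpha j - beta j).
Proof.
move=> ha hb; have -> : (fun j => alpha j - beta j) =
    (fun j => pconst R N ((-1)%:C%C) * beta j + alpha j).
  by apply: funext => j; rewrite rmorphN1 pconstN1 mulN1r addrC.
exact: deformation_lin.
Qed.

Lemma vanishing_jet_determined k : vanishing_jet k -> determined_by_jet d' M M' H k.
Proof.
move=> hv alpha beta ha hb hab j m.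
have e : alpha j - beta j = 0.
  apply: (hv _ (deformationB ha hb)) => {}j {}m hm.
  by rewrite addE oppE hab // subrr.
have := congr1 (fun f : series R N => f m) e; rewrite /= addE oppE => /eqP.
by rewrite subr_eq0 => /eqP.
Qed.

Section FiniteDim.
Variable k : nat.
Local Notation I := ('I_N' * 'X_{1..N < k.+1} * bool)%type.

(** Real coordinates of the jet, since deformations form a vector space over the reals. *)
Definition jet_vector (alpha : 'I_N' -> series R N) : 'rV[R]_#|{: I}| :=
  \row_i let: (j, m, b) := (enum_val i : I) in
    if b then complex.Re (alpha j m) else complex.Im (alpha j m).

Lemma jet_vectorE alpha j (m : 'X_{1..N < k.+1}) (b : bool) :
  jet_vector alpha 0 (enum_rank (j, m, b)) =
  if b then complex.Re (alpha j m) else complex.Im (alpha j m).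
Proof. by rewrite mxE enum_rankK. Qed.

Lemma jet_vector_eq0 alpha : jet_vector alpha = 0 ->
  forall j m, (mdeg m <= k)%N -> alpha j m = 0.
Proof.
move=> h j m hm; have hm' : (mdeg m < k.+1)%N by rewrite ltnS.
have hb b : jet_vector alpha 0 (enum_rank (j, BMultinom hm', b)) = 0 by rewrite h mxE.
have := hb true; have := hb false; rewrite !jet_vectorE /=.
by case: (alpha j m) => x y /= -> ->.
Qed.

Lemma jet_vectorB_sum D (c : 'rV[R]_D) (b : 'I_D -> 'I_N' -> series R N) alpha :
  jet_vector alpha = c *m (\matrix_i jet_vector (b i)) ->
  jet_vector (fun j => alpha j - \sum_i pconst R N ((c 0 i)%:C%C) * b i j) = 0.
Proof.
move=> h; apply/rowP => i; rewrite [RHS]mxE.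
have [[[j m] e] ->] : exists x, i = enum_rank x by exists (enum_val i); rewrite enum_valK.
have := congr1 (fun v : 'rV_#|{: I}| => v 0 (enum_rank (j, m, e))) h.
have -> : (c *m \matrix_l jet_vector (b l)) 0 (enum_rank (j, m, e)) =
    \sum_l c 0 l * (if e then complex.Re (b l j m) else complex.Im (b l j m)).
  by rewrite mxE; apply: eq_bigr => l _; rewrite -jet_vectorE [X in _ * X]mxE.
rewrite !jet_vectorE addE oppE sumE.
have ReB (x y : C) : complex.Re (x - y) = complex.Re x - complex.Re y by case: x y => ? ? [].
have ImB (x y : C) : complex.Im (x - y) = complex.Im x - complex.Im y by case: x y => ? ? [].
have Re_sum (F : 'I_D -> C) : complex.Re (\sum_i F i) = \sum_i complex.Re (F i).
  by apply: (big_morph (@complex.Re R) (id1 := 0) (op1 := +%R)) => // -[? ?] [].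
have Im_sum (F : 'I_D -> C) : complex.Im (\sum_i F i) = \sum_i complex.Im (F i).
  by apply: (big_morph (@complex.Im R) (id1 := 0) (op1 := +%R)) => // -[? ?] [].
case: e => /= he; rewrite ?ReB ?ImB ?Re_sum ?Im_sum he -sumrB big1 // => l _;
  by rewrite pconstE; case: (b l j m) => x y /=; rewrite mul0r ?subr0 ?addr0 subrr.
Qed.

(** A largest family of deformations with independent jets exists, as jets have finitely many
    coordinates. By maximality the jet of [alpha] is a combination of theirs, and the difference has
    zero jet. *)
Lemma finite_dim : vanishing_jet k -> finite_dim_deformations d' M M' H.
Proof.
move=> hv.
pose P D := `[< exists b : 'I_D -> 'I_N' -> series R N, (forall i, deformation (b i)) /\
   row_free (\matrix_i jet_vector (b i)) >].
have P0 : exists D, P D.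
  exists 0%N; apply/asboolP; exists (fun _ _ => 0); split=> [[]//|].
  by rewrite /row_free -leqn0 rank_leq_row.
have Pmax D : P D -> (D <= #|{: I}|)%N.
  by move=> /asboolP[b [_ /eqP <-]]; apply: rank_leq_col.
case: (ex_maxnP P0 Pmax) => D /asboolP[b [hb fb]] maxD; exists D, b; split=> // alpha ha.
set A := \matrix_i jet_vector (b i) in fb.
have : (jet_vector alpha <= A)%MS.
  apply/negPn/negP => nA.
  pose b' : 'I_(1 + D) -> 'I_N' -> series R N := bcat (fun=> alpha) b.
  have : P (1 + D)%N.
    apply/asboolP; exists b'; split; first exact: bcatP.
    have -> : \matrix_i jet_vector (b' i) = col_mx (jet_vector alpha) A.
      apply/row_matrixP; apply: split_ordP => i; rewrite rowK /b'.
        by rewrite bcatL rowKu; apply/rowP => l; rewrite [RHS]mxE ord1.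
      by rewrite bcatR rowKd rowK.
    have : (A < jet_vector alpha + A)%MS by rewrite /ltmx addsmxSr addsmx_sub negb_and nA.
    move=> /rank_ltmx; rewrite addsmxE (eqP fb) => h.
    by rewrite /row_free eqn_leq rank_leq_row; exact: h.
  by move=> /maxD; rewrite add1n ltnn.
move=> /submxP[c hc].
have := hv _ (deformationB ha (deformation_sum (fun i => c 0 i) hb)).
move=> /(_ (jet_vector_eq0 (jet_vectorB_sum hc))) h.
exists (fun i => c 0 i) => j m; have := congr1 (fun f : series R N => f m) (h j).
rewrite /= addE oppE sumE zeroE => /eqP; rewrite subr_eq0 => /eqP ->.
by apply: eq_bigr => i _; rewrite pconstE.
Qed.

End FiniteDim.

End Deformations.

End Deformation.

(** * Strictly pseudoconvex hypersurfaces *)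

Section StrictlyPseudoconvex.
Variables (R : realType) (n : nat) (Q : 'I_1 -> series R (n + (n + 1))).
Local Notation C := R[i].
Local Notation N := (n + 1)%N.
Variable M : 'rV[C]_N -> Prop.
Hypothesis coordM : normal_coordinates M Q.
Let normQ : normal_map Q := proj1 coordM.

Let x1 := @firstvar R n 1.
Let x2 (i : 'I_n) : series R (n + 1 * n) := @restvar R n 1 (lshift (0 * n) i).

Lemma segrebar0 : segrebar Q (q := 0) = fun=> 0.
Proof.
apply: funext => l; rewrite /segrebar.
have -> : pconj (segre Q 0 l) = 0 by exact: pconj0.
exact: (psubst0 (@centered_restvar R n 0)).
Qed.

Lemma segrebar1 : segrebar Q (q := 1) = bcat x2 (fun=> 0).
Proof.
have cr := @centered_restvar R n 1.
apply: funext => i; rewrite /segrebar (segre_succ normQ 0); move: i.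
pose F (h : series R (n + 0 * n)) := psubst (pconj h) (@restvar R n 1).
apply: (bcat_map (F := F)) => i; rewrite /F.
  by rewrite /firstvar pconj_var (psubst_var cr).
by rewrite segrebar0 (normal_z00 normQ _ (@centered_firstvar R n 0)) pconj0 (psubst0 cr).
Qed.

Lemma segre2_neq0 : (0 < n)%N -> strictly_pseudoconvex_hypersurface M ->
  segre Q 2 (rshift n 0) != 0.
Proof.
move=> n0 [rho [crho _ _ _ hM] levi]; apply/eqP => q0.
pose i1 := Ordinal n0.
pose z : series R (n + 1 * n) := 0.
have c1 : centered x1 by exact: (@centered_firstvar R n 1).
have c2 : centered x2 by move=> i; exact: (@centered_restvar R n 1).
have c12 : centered (bcat x1 (bcat x2 (fun _ : 'I_1 => z))).
  by apply: (centered_bcat c1); apply: (centered_bcat c2) => i.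
(* The relation Q(x1, x2, 0) = 0 with conjugated coefficients: the parameters Z = (x2, 0), chi = x1
   have tau = 0. *)
have qb k : psubst (pconj (Q k)) (bcat x1 (bcat x2 (fun _ : 'I_1 => z))) = 0.
  move: q0; rewrite ord1 (segre_succ normQ 1) bcatR segrebar1.
  move=> /(congr1 (@pconj R _)); rewrite pconj0 (pconj_psubst _ c12) => h.
  rewrite -[RHS]h; congr psubst; apply/esym/funext.
  apply: (bcat_map (F := @pconj R _)) => i; first exact: pconj_var.
  move: i; apply: (bcat_map (F := @pconj R _)) => i; first exact: pconj_var.
  exact: pconj0.
pose s : 'I_(N + n) -> series R (n + 1 * n) := bcat (bcat x2 (fun _ : 'I_1 => z)) x1.
have cs : centered s.
  by apply: centered_bcat => //; apply: (centered_bcat c2) => i.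
(* A family of points of the complexification in which x2 plays z and x1 plays chi; one derivative
   in each produces the entries of the Levi form. *)
pose g : 'I_(N + N) -> series R (n + 1 * n) :=
  bcat (bcat x2 (fun _ : 'I_1 => z)) (bcat x1 (fun _ : 'I_1 => z)).
have cg : centered g.
  by apply: centered_bcat; [apply: (centered_bcat c2) => i|apply: (centered_bcat c1) => i].
have rg : psubst (rho 0) g = 0.
  have h : psubst (rho 0) (par Q) = 0.
    apply: (complexification_identity normQ coordM (crho 0)).
    by move: hM; apply: near0_impl => Z hZ /hZ.
  have := congr1 (fun f : series R (N + n) => psubst f s) h.
  rewrite /= (psubst0 cs) (psubstA _ (centered_par normQ) cs) => {}h; rewrite -[RHS]h.
  pose F (f : series R (N + n)) := psubst f s.
  congr psubst; apply/esym/funext; apply: (bcat_map (F := F)) => i.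
    by rewrite /F /parZ (psubst_var cs) /s bcatL.
  have Fc j : F (@parchi R n 1 j) = x1 j by rewrite /F /parchi (psubst_var cs) /s bcatR.
  move: i; apply: (bcat_map (F := F)) => i; first exact: Fc.
  rewrite /F (psubstA _ (@centered_parchiZ R n 1) cs) -[RHS](qb i).
  congr psubst; apply: funext; apply: (bcat_map (F := F)) => j; first exact: Fc.
  by rewrite /F /parZ (psubst_var cs) /s bcatL.
have d1 f (a : 'I_n) : pderiv (rshift n (lshift (0 * n) a)) (psubst f g) =
    psubst (pderiv (lshift N (lshift 1 a)) f) g.
  apply: (pderiv_psubst_single _ cg); apply: split_ordP; apply: split_ordP => i; rewrite /g.
  - by rewrite !bcatL /x2 /restvar pderiv_var eq_rshift !eq_lshift eq_sym.
  - by rewrite bcatL bcatR pderiv0 eq_lshift eq_rlshift.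
  - by rewrite bcatR bcatL /x1 /firstvar pderiv_var eq_rlshift eq_rlshift.
  - by rewrite !bcatR pderiv0 eq_rlshift.
have d2 f (a : 'I_n) : pderiv (lshift (1 * n) a) (psubst f g) =
    psubst (pderiv (rshift N (lshift 1 a)) f) g.
  apply: (pderiv_psubst_single _ cg); apply: split_ordP; apply: split_ordP => i; rewrite /g.
  - by rewrite !bcatL /x2 /restvar pderiv_var !eq_lrshift.
  - by rewrite bcatL bcatR pderiv0 eq_lrshift.
  - by rewrite bcatR bcatL /x1 /firstvar pderiv_var eq_rshift !eq_lshift eq_sym.
  - by rewrite !bcatR pderiv0 eq_rshift eq_rlshift.
have D1 a : psubst (pderiv (lshift N (lshift 1 a)) (rho 0)) g = 0.
  by rewrite -d1 rg pderiv0.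
have D1' a : pderiv (lshift N (lshift 1 a)) (rho 0) 0%MM = 0.
  by rewrite -(psubst_const _ g) D1.
have D2 a b : pderiv (lshift N (lshift 1 a)) (pderiv (rshift N (lshift 1 b)) (rho 0)) 0%MM = 0.
  by rewrite pderiv_comm -(psubst_const _ g) -d2 D1 pderiv0.
pose v : 'rV[C]_N := delta_mx 0 (lshift 1 i1).
have v0 j : j != lshift 1 i1 -> v 0 j = 0 by move=> ne; rewrite mxE (negbTE ne) andbF.
have := levi v; rewrite big1 => [|j _]; last first.
  by have [->|/v0 ->] := eqVneq j (lshift 1 i1); rewrite ?D1' ?mul0r ?mulr0.
rewrite big1 ?ltxx => [|j _]; last first.
  rewrite big1 // => k _; have [->|/v0 ->] := eqVneq j (lshift 1 i1); last first.
    by rewrite mulr0 mul0r.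
  by have [->|/v0 ->] := eqVneq k (lshift 1 i1); rewrite ?D2 ?mul0r // conjC0 mulr0.
move=> h; suff /h/(_ erefl) : v != 0 by [].
by apply/eqP => /rowP/(_ (lshift 1 i1)); rewrite !mxE !eqxx => /eqP; rewrite oner_eq0.
Qed.

Lemma strictly_pseudoconvex_kernel : (0 < n)%N -> strictly_pseudoconvex_hypersurface M ->
  forall f, psubst f (segre Q 2) = 0 -> f = 0.
Proof.
move=> n0 spc f; apply: (kernel_of_frank (centered_segre normQ 2)).
(* If the rank did not grow, [rank_stable] applied to the coordinate w, which vanishes on S^1, would
   give w o S^2 = 0. *)
have [rk|] := leqP (frank (jacobian (segre Q 2))) (frank (jacobian (segre Q 1))); last first.
  by apply: leq_trans; rewrite -[in X in (_ <= X)%N]addn1 leq_add2r; apply: frank_segre1.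
have := segre2_neq0 n0 spc; rewrite -(psubst_var (centered_segre normQ 2)).
rewrite (rank_stable (@lastproj_wid R n 1) (@lastproj_out R n 1) (centered_segre normQ 2) _ rk).
- by rewrite eqxx.
- exact: lastproj_segre.
rewrite (psubst_var (centered_segre normQ 1)) (segre_succ normQ 0) bcatR segrebar0.
exact: (normal_z00 normQ _ (@centered_firstvar R n 0)).
Qed.

End StrictlyPseudoconvex.

Theorem corollary30 (R : realType) (n d N' d' kappa : nat)
    (M : 'rV[R[i]]_(n + d) -> Prop) (M' : 'rV[R[i]]_N' -> Prop)
    (Q : 'I_d -> series R (n + (n + d)))
    (H : 'I_N' -> series R (n + d))
    (leNN' : (n + d <= N')%N)
    (genM : generic_submanifold d M)
    (genM' : generic_submanifold d' M')
    (coordM : normal_coordinates M Q)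
    (embH : holomorphic_embedding M M' H)
    (nondegH : kappa_nondegenerate d' Q M' H kappa) :
  (forall t : nat, (0 < t)%N -> generically_full_rank (segre Q t) ->
    [/\ finite_dim_deformations d' M M' H,
        determined_by_jet d' M M' H (t * kappa)
      & determined_by_jet d' M M' H (d.+1 * kappa)])
  /\
  (d = 1%N -> (0 < n)%N -> strictly_pseudoconvex_hypersurface M ->
    determined_by_jet d' M M' H (2 * kappa)).
Proof.
have normQ := proj1 coordM; have [convH H0 _ _] := embH.
(* All the jet orders reduce to the injectivity of f -> f o S^t for a suitable t. *)
have vanish t : (forall f, psubst f (segre Q t) = 0 -> f = 0) ->
    vanishing_jet d' M M' H (t * kappa).
  move=> ker alpha ha jet j; apply: ker; move: j.
  apply: (jet_vanish_segre normQ _ jet).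
  exact: (basic_identity coordM convH H0 ha (proj1 nondegH)).
split=> [t _ full|d1 n0 spc].
  have ker := generic_segre_kernel normQ full.
  split; first exact: finite_dim (vanish _ ker).
    exact: vanishing_jet_determined (vanish _ ker).
  apply/vanishing_jet_determined/vanish => f; exact: segre_kernel ker.
apply/vanishing_jet_determined/vanish.
move: {H H0 convH embH nondegH leNN' genM vanish} coordM spc n0; subst d => coordM spc n0.
exact: (strictly_pseudoconvex_kernel coordM).
Qed.
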